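(* The family of quantum automorphism groups of tree-cographs is exactly the smallest family of quantum permutation groups containing the trivial quantum group and stable by free product and by wreath product with $S_n^+$ for every $n\ge 1$. In particular, it is the class of quantum automorphism groups of trees.
   Context: Graphs are finite, simple and undirected, with at least one vertex. The class of tree-cographs is the smallest class of graphs containing all trees and stable under finite disjoint unions and complement. A quantum permutation group of size $n$ is a pair $\Gamma=(\mathcal A,p)$ where $\mathcal A=\mathcal O(\Gamma)$ is a unital complex $*$-algebra generated by $p=(p_{ij})_{1\le i,j\le n}$ satisfying relations ($\mathcal P_s$): $p_{ij}^*=p_{ij}=p_{ij}^2$, $\sum_j p_{ij}=1=\sum_j p_{ji}$, $p_{ij}p_{ik}=0=p_{ji}p_{ki}$ for $j\neq k$, and such that there is a unital $*$-morphism $\Delta:\mathcal A\to\mathcal A\otimes\mathcal A$ (algebraic tensor product) with $\Delta(p_{ij})=\sum_k p_{ik}\otimes p_{kj}$. Quantum permutation groups (of possibly different sizes) are identified when isomorphic, i.e. when there is a $*$-isomorphism of the algebras intertwining the comultiplications $\Delta$. The trivial quantum group has algebra $\mathbb C$. $S_n^+$ is the quantum permutation group whose algebra is universal for ($\mathcal P_s$). The quantum automorphism group $\mathrm{Qu}(G)$ of a graph $G$ is the quantum permutation group whose algebra is the universal unital $*$-algebra generated by $u=(u_{xy})_{x,y\in V(G)}$ with relations ($\mathcal P_s$) and $u\,\mathrm{Adj}(G)=\mathrm{Adj}(G)\,u$, where $\mathrm{Adj}(G)$ is the adjacency matrix. The free product of $(\mathcal A,p)$ and $(\mathcal B,q)$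 is $(\mathcal A*\mathcal B,\mathrm{Diag}(p,q))$ with $*$ the unital free product of $*$-algebras. The wreath product $(\mathcal A,u)\wr S_n^+$, for $(\mathcal A,u)$ of size $m$ and $S_n^+=(\mathcal S,p)$, has algebra $\mathcal A^{*n}*\mathcal S$ modulo the ideal generated by the commutators $[\nu_i(a),p_{ij}]$ ($a\in\mathcal A$, $1\le i,j\le n$), where $\nu_i:\mathcal A\to\mathcal A^{*n}$ is the $i$-th inclusion, and fundamental representation of size $mn$ with coefficients $w_{ij,kl}=\nu_i(u_{kl})p_{ij}$ (row $(i,k)$, column $(j,l)$). *)

(* Defs.v *)
From HB Require Import structures.
From mathcomp Require Import all_boot all_order all_algebra.
From mathcomp Require Import boolp.

Set Implicit Arguments.
Unset Strict Implicit.
Unset Printing Implicit Defensive.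

Import GRing.Theory Num.Theory.
Local Open Scope ring_scope.
Local Open Scope quotient_scope.

(* Not based on [algType], which excludes the zero algebra: algebras given by
   generators and relations may collapse.  The ring structure is part of the
   mixin because Hierarchy Builder admits no structure between [PzRing] and
   [Lmodule] on the one hand and [Lalgebra] on the other. *)
HB.mixin Record isStarAlgebra (C : numClosedFieldType) A
    of GRing.Lmodule C A := {
  smul : A -> A -> A;
  sone : A;
  smulA : associative smul;
  smul1r : left_id sone smul;
  smulr1 : right_id sone smul;
  smulDl : left_distributive smul +%R;
  smulDr : right_distributive smul +%R;
  smul_scalel : forall (c : C) (a b : A), c *: smul a b = smul (c *: a) b;
  smul_scaler : forall (c : C) (a b : A), c *: smul a b = smul a (c *: b);
  star : A -> A;
  starD : {morph star : a b / a + b};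
  starZ : forall (c : C) (a : A), star (c *: a) = c^* *: star a;
  star_smul : forall a b : A, star (smul a b) = smul (star b) (star a);
  starK : involutive star
}.

#[short(type="starAlgType")]
HB.structure Definition StarAlgebra (C : numClosedFieldType) :=
  {A of GRing.Lmodule C A & isStarAlgebra C A}.

HB.instance Definition _ (C : numClosedFieldType) (A : starAlgType C) :=
  GRing.Zmodule_isPzRing.Build A
    (@smulA C A) (@smul1r C A) (@smulr1 C A) (@smulDl C A) (@smulDr C A).

Section StarTheory.
Context {C : numClosedFieldType} {A : starAlgType C}.

Lemma sscalerAl (c : C) (a b : A) : c *: (a * b) = (c *: a) * b.
Proof. exact: smul_scalel. Qed.

Lemma sscalerAr (c : C) (a b : A) : c *: (a * b) = a * (c *: b).
Proof. exact: smul_scaler. Qed.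

Lemma starM (a b : A) : star (a * b) = star b * star a.
Proof. exact: star_smul. Qed.

Lemma star0 : star (0 : A) = 0.
Proof. by rewrite -[X in star X](scale0r (0 : A)) starZ conjC0 scale0r. Qed.

Lemma star1 : star (1 : A) = 1.
Proof. by rewrite -[LHS]mulr1 -{2}[1](starK (1 : A)) -starM mulr1 starK. Qed.

Lemma starB (a b : A) : star (a - b) = star a - star b.
Proof. by rewrite -scaleN1r starD starZ rmorphN1 scaleN1r. Qed.

Lemma star_sum I r (P : pred I) (F : I -> A) :
  star (\sum_(i <- r | P i) F i) = \sum_(i <- r | P i) star (F i).
Proof. exact: (big_morph _ starD star0). Qed.

End StarTheory.

Section StarMorphism.
Context {C : numClosedFieldType}.

Definition star_morphism (A B : starAlgType C) (f : A -> B) : Prop :=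
  [/\ linear f, monoid_morphism f & {morph f : a / star a}].

Section Theory.
Context {A B : starAlgType C} {f : A -> B}.
Hypothesis hf : star_morphism f.

Lemma smD : {morph f : a b / a + b}.
Proof. by case: hf => lf _ _ a b; have := lf 1 a b; rewrite !scale1r. Qed.

Lemma sm0 : f 0 = 0.
Proof. by apply: (addrI (f 0)); rewrite -smD !addr0. Qed.

Lemma smZ c a : f (c *: a) = c *: f a.
Proof. by case: hf => lf _ _; have := lf c a 0; rewrite sm0 !addr0. Qed.

Lemma smB : {morph f : a b / a - b}.
Proof. by move=> a b; rewrite -scaleN1r smD smZ scaleN1r. Qed.

Lemma smM : {morph f : a b / a * b}.
Proof. by case: hf => _ []. Qed.

Lemma sm1 : f 1 = 1.
Proof. by case: hf => _ []. Qed.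

Lemma smS : {morph f : a / star a}.
Proof. by case: hf. Qed.

Lemma sm_sum I r (P : pred I) (F : I -> A) :
  f (\sum_(i <- r | P i) F i) = \sum_(i <- r | P i) f (F i).
Proof. exact: (big_morph _ smD sm0). Qed.

End Theory.

Lemma mk_star_morphism (A B : starAlgType C) (f : A -> B) :
  {morph f : a b / a + b} -> (forall c a, f (c *: a) = c *: f a) ->
  {morph f : a b / a * b} -> f 1 = 1 -> {morph f : a / star a} ->
  star_morphism f.
Proof. by move=> fD fZ fM f1 fS; split=> // c a b; rewrite fD fZ. Qed.

Lemma star_morphism_comp (A B D : starAlgType C) (g : B -> D) (f : A -> B) :
  star_morphism g -> star_morphism f -> star_morphism (g \o f).
Proof.
move=> hg hf; apply: mk_star_morphism => [a b|c a|a b||a] /=.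
- by rewrite (smD hf) (smD hg).
- by rewrite (smZ hf) (smZ hg).
- by rewrite (smM hf) (smM hg).
- by rewrite (sm1 hf) (sm1 hg).
- by rewrite (smS hf) (smS hg).
Qed.

Definition star_subalgebra (A : starAlgType C) (S : A -> Prop) : Prop :=
  [/\ S 1, forall (c : C) a b, S a -> S b -> S (c *: a + b),
      forall a b, S a -> S b -> S (a * b) & forall a, S a -> S (star a)].

Definition generates (A : starAlgType C) (I : Type) (p : I -> I -> A) : Prop :=
  forall S : A -> Prop, star_subalgebra S ->
    (forall i j, S (p i j)) -> forall a, S a.

Section Subalgebra.
Context {A : starAlgType C} {S : A -> Prop} (hS : star_subalgebra S).

Lemma subalg1 : S 1. Proof. by case: hS. Qed.

Lemma subalgM a b : S a -> S b -> S (a * b).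
Proof. by case: hS => _ _ + _; apply. Qed.

Lemma subalg0 : S 0.
Proof.
case: hS => S1 SD _ _.
by have := SD (-1) 1 1 S1 S1; rewrite scaleN1r addNr.
Qed.

Lemma subalgD a b : S a -> S b -> S (a + b).
Proof. by case: hS => _ SD _ _ Sa Sb; rewrite -[a]scale1r; apply: SD. Qed.

Lemma subalgZ c a : S a -> S (c *: a).
Proof.
case: hS => _ SD _ _ Sa; rewrite -[_ *: _]addr0; apply: SD => //.
exact: subalg0.
Qed.

Lemma subalg_sum I r (P : pred I) (F : I -> A) :
  (forall i, P i -> S (F i)) -> S (\sum_(i <- r | P i) F i).
Proof.
by move=> h; apply: big_ind => //; [apply: subalg0 | apply: subalgD].
Qed.

Lemma subalg_preim (B : starAlgType C) (f : B -> A) :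
  star_morphism f -> star_subalgebra (S \o f).
Proof.
case: (hS) => S1 SD SM SS hf; split=> [|c a b|a b|a] /=.
- by rewrite (sm1 hf).
- by rewrite (smD hf) (smZ hf); apply: SD.
- by rewrite (smM hf); apply: SM.
- by rewrite (smS hf); apply: SS.
Qed.

End Subalgebra.

End StarMorphism.

Section Regular.
Variable C : numClosedFieldType.

Fact regular_conjD : {morph (Num.conj : C^o -> C^o) : a b / a + b}.
Proof. exact: rmorphD. Qed.

Fact regular_scalerAl (c : C) (a b : C^o) : c *: (a * b) = (c *: a) * b.
Proof. exact: mulrA. Qed.

Fact regular_scalerAr (c : C) (a b : C^o) : c *: (a * b) = a * (c *: b).
Proof. exact: mulrCA. Qed.

Fact regular_conjZ (c : C) (a : C^o) :
  (Num.conj (c *: a : C^o) : C^o) = c^* *: (Num.conj a : C^o).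
Proof. exact: rmorphM. Qed.

Fact regular_conjM (a b : C^o) :
  (Num.conj (a * b) : C^o) = Num.conj b * Num.conj a.
Proof. by rewrite mulrC; exact: rmorphM. Qed.

Fact regular_conjK : involutive (Num.conj : C^o -> C^o).
Proof. exact: conjCK. Qed.

HB.instance Definition _ := isStarAlgebra.Build C C^o
  (@mulrA C) (@mul1r C) (@mulr1 C) (@mulrDl C) (@mulrDr C)
  regular_scalerAl regular_scalerAr regular_conjD regular_conjZ
  regular_conjM regular_conjK.

End Regular.

Inductive sterm (C X : Type) : Type :=
| TGen of X
| TConst of C
| TAdd of sterm C X & sterm C X
| TMul of sterm C X & sterm C X
| TStar of sterm C X.
Arguments TGen {C X}.
Arguments TConst {C X}.

HB.instance Definition _ (C X : Type) := gen_eqMixin (sterm C X).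
HB.instance Definition _ (C X : Type) := gen_choiceMixin (sterm C X).

Fixpoint seval (C : numClosedFieldType) X (A : starAlgType C) (f : X -> A)
    (t : sterm C X) : A :=
  match t with
  | TGen x => f x
  | TConst c => c *: (1 : A)
  | TAdd s t => seval f s + seval f t
  | TMul s t => seval f s * seval f t
  | TStar s => star (seval f s)
  end.

(* [P A f] expresses that the family [f] of elements of [A] satisfies the
   defining relations.  Two *-polynomials in the generators are identified
   when every family satisfying [P] gives them the same value; when [P] is a
   conjunction of equations between *-polynomials (as in every use below),
   this is the congruence generated by these equations. *)
Section Universal.
Variables (C : numClosedFieldType) (X : Type).
Variable P : forall A : starAlgType C, (X -> A) -> Prop.
Implicit Types (A : starAlgType C) (s t : sterm C X).

Definition sterm_eqv s t : bool :=
  `[< forall A (f : X -> A), P f -> seval f s = seval f t >].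

Fact sterm_eqv_refl : reflexive sterm_eqv.
Proof. by move=> s; apply/asboolP. Qed.

Fact sterm_eqv_sym : symmetric sterm_eqv.
Proof.
by move=> s t; apply/asboolP/asboolP => h A f Pf; rewrite (h A f Pf).
Qed.

Fact sterm_eqv_trans : transitive sterm_eqv.
Proof.
move=> t s u /asboolP h1 /asboolP h2; apply/asboolP => A f Pf.
by rewrite (h1 A f Pf) (h2 A f Pf).
Qed.

Canonical sterm_eqv_equiv :=
  EquivRel sterm_eqv sterm_eqv_refl sterm_eqv_sym sterm_eqv_trans.

Definition universal : Type := {eq_quot sterm_eqv}.
HB.instance Definition _ := Choice.on universal.

Implicit Types x y z : universal.

Definition ulift A (f : X -> A) x : A := seval f (repr x).

Definition upi t : universal := \pi_({eq_quot sterm_eqv}) t.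

Definition ugen (x : X) : universal := upi (TGen x).

Lemma ulift_pi A (f : X -> A) t : P f -> ulift f (upi t) = seval f t.
Proof.
move=> Pf; rewrite /ulift /upi.
have : sterm_eqv (repr (\pi_({eq_quot sterm_eqv}) t)) t.
  by apply/eqmodP; rewrite reprK.
by move/asboolP; apply.
Qed.

Lemma uext x y :
  (forall A (f : X -> A), P f -> ulift f x = ulift f y) -> x = y.
Proof.
move=> h; rewrite -[x]reprK -[y]reprK; apply/eqmodP/asboolP => A f Pf.
exact: h.
Qed.

Definition u0 : universal := upi (TConst 0).
Definition u1 : universal := upi (TConst 1).
Definition uadd x y : universal := upi (TAdd (repr x) (repr y)).
Definition umul x y : universal := upi (TMul (repr x) (repr y)).
Definition uscale c x : universal := upi (TMul (TConst c) (repr x)).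
Definition uopp x : universal := uscale (-1) x.
Definition ustar x : universal := upi (TStar (repr x)).

Section Lift.
Context {A : starAlgType C} {f : X -> A} (Pf : P f).

Lemma ulift0 : ulift f u0 = 0.
Proof. by rewrite ulift_pi //= scale0r. Qed.
Lemma ulift1 : ulift f u1 = 1.
Proof. by rewrite ulift_pi //= scale1r. Qed.
Lemma uliftD x y : ulift f (uadd x y) = ulift f x + ulift f y.
Proof. by rewrite ulift_pi. Qed.
Lemma uliftM x y : ulift f (umul x y) = ulift f x * ulift f y.
Proof. by rewrite ulift_pi. Qed.
Lemma uliftZ c x : ulift f (uscale c x) = c *: ulift f x.
Proof. by rewrite ulift_pi //= -sscalerAl mul1r. Qed.
Lemma uliftN x : ulift f (uopp x) = - ulift f x.
Proof. by rewrite uliftZ scaleN1r. Qed.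
Lemma uliftS x : ulift f (ustar x) = star (ulift f x).
Proof. by rewrite ulift_pi. Qed.
Lemma ulift_gen g : ulift f (ugen g) = f g.
Proof. by rewrite ulift_pi. Qed.

Definition uliftE :=
  (ulift0, ulift1, uliftD, uliftM, uliftN, uliftZ, uliftS).
End Lift.

Fact uaddA : associative uadd.
Proof. by move=> x y z; apply: uext => A f Pf; rewrite !(uliftE Pf) addrA. Qed.
Fact uaddC : commutative uadd.
Proof. by move=> x y; apply: uext => A f Pf; rewrite !(uliftE Pf) addrC. Qed.
Fact uadd0 : left_id u0 uadd.
Proof. by move=> x; apply: uext => A f Pf; rewrite !(uliftE Pf) add0r. Qed.
Fact uaddN : left_inverse u0 uopp uadd.
Proof. by move=> x; apply: uext => A f Pf; rewrite !(uliftE Pf) addNr. Qed.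
HB.instance Definition _ :=
  GRing.isZmodule.Build universal uaddA uaddC uadd0 uaddN.

Fact umulA : associative umul.
Proof. by move=> x y z; apply: uext => A f Pf; rewrite !(uliftE Pf) mulrA. Qed.
Fact umul1 : left_id u1 umul.
Proof. by move=> x; apply: uext => A f Pf; rewrite !(uliftE Pf) mul1r. Qed.
Fact umulr1 : right_id u1 umul.
Proof. by move=> x; apply: uext => A f Pf; rewrite !(uliftE Pf) mulr1. Qed.
Fact umulDl : left_distributive umul +%R.
Proof.
by move=> x y z; apply: uext => A f Pf; rewrite !(uliftE Pf) mulrDl.
Qed.
Fact umulDr : right_distributive umul +%R.
Proof.
by move=> x y z; apply: uext => A f Pf; rewrite !(uliftE Pf) mulrDr.
Qed.
HB.instance Definition _ := GRing.Zmodule_isPzRing.Build universal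
  umulA umul1 umulr1 umulDl umulDr.

Fact uscaleA a b x : uscale a (uscale b x) = uscale (a * b) x.
Proof. by apply: uext => A f Pf; rewrite !(uliftE Pf) scalerA. Qed.
Fact uscale1 : left_id 1 uscale.
Proof. by move=> x; apply: uext => A f Pf; rewrite !(uliftE Pf) scale1r. Qed.
Fact uscaleDr : right_distributive uscale +%R.
Proof.
by move=> c x y; apply: uext => A f Pf; rewrite !(uliftE Pf) scalerDr.
Qed.
Fact uscaleDl x : {morph uscale^~ x : a b / a + b}.
Proof.
by move=> a b; apply: uext => A f Pf; rewrite !(uliftE Pf) scalerDl.
Qed.
HB.instance Definition _ := GRing.Zmodule_isLmodule.Build C universal
  uscaleA uscale1 uscaleDr uscaleDl.

Fact uscalerAl (c : C) x y : c *: (x * y) = (c *: x) * y.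
Proof. by apply: uext => A f Pf; rewrite !(uliftE Pf) sscalerAl. Qed.
Fact uscalerAr (c : C) x y : c *: (x * y) = x * (c *: y).
Proof. by apply: uext => A f Pf; rewrite !(uliftE Pf) sscalerAr. Qed.
Fact ustarD : {morph ustar : x y / x + y}.
Proof. by move=> x y; apply: uext => A f Pf; rewrite !(uliftE Pf) starD. Qed.
Fact ustarZ (c : C) x : ustar (c *: x) = c^* *: ustar x.
Proof. by apply: uext => A f Pf; rewrite !(uliftE Pf) starZ. Qed.
Fact ustarM x y : ustar (x * y) = ustar y * ustar x.
Proof. by apply: uext => A f Pf; rewrite !(uliftE Pf) starM. Qed.
Fact ustarK : involutive ustar.
Proof. by move=> x; apply: uext => A f Pf; rewrite !(uliftE Pf) starK. Qed.
HB.instance Definition _ := isStarAlgebra.Build C universal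
  umulA umul1 umulr1 umulDl umulDr
  uscalerAl uscalerAr ustarD ustarZ ustarM ustarK.

Lemma ulift_morphism A (f : X -> A) : P f -> star_morphism (ulift f).
Proof.
move=> Pf; apply: mk_star_morphism.
- exact: uliftD.
- exact: uliftZ.
- exact: uliftM.
- exact: ulift1.
- exact: uliftS.
Qed.

Lemma universal_ind (S : universal -> Prop) :
  star_subalgebra S -> (forall g, S (ugen g)) -> forall x, S x.
Proof.
move=> hS Sg x; rewrite -[x]reprK.
have -> : \pi_({eq_quot sterm_eqv}) (repr x)
    = seval (ugen : X -> (universal : starAlgType C)) (repr x).
  apply: uext => A f Pf; rewrite [LHS](ulift_pi _ Pf).
  have hf := ulift_morphism Pf.
  elim: (repr x) => [y|c|s hs t ht|s hs t ht|s hs] /=.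
  - by rewrite ulift_gen.
  - by rewrite (smZ hf) (sm1 hf).
  - by rewrite (smD hf) -hs -ht.
  - by rewrite (smM hf) -hs -ht.
  - by rewrite (smS hf) -hs.
elim: (repr x) => [y|c|s ? t ?|s ? t ?|s ?] //=.
- exact: subalgZ (subalg1 hS).
- exact: subalgD.
- exact: subalgM.
- by case: hS => _ _ _; apply.
Qed.

Lemma universal_morphism (B : starAlgType C) (g : B -> universal) :
  (forall A (f : X -> A), P f -> star_morphism (ulift f \o g)) ->
  star_morphism g.
Proof.
move=> h; apply: mk_star_morphism => [a b|c a|a b||a];
  apply: uext => D f Pf; have hf := ulift_morphism Pf;
  have /= hg := h D f Pf.
- by rewrite (smD hf); exact: (smD hg).
- by rewrite (smZ hf); exact: (smZ hg).
- by rewrite (smM hf); exact: (smM hg).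
- by rewrite (sm1 hf); exact: (sm1 hg).
- by rewrite (smS hf); exact: (smS hg).
Qed.

End Universal.

(* The tensor product of modules over C: finite formal sums of pairs, two
   sums being identified when every balanced biadditive map into an abelian
   group gives them the same value. *)
Section Tensor.
Variables (C : numClosedFieldType) (A B : starAlgType C).
Implicit Types (G : zmodType) (s t : seq (A * B)).

Definition balanced G (b : A -> B -> G) : Prop :=
  [/\ forall y, {morph b^~ y : x x' / x + x'},
      forall x, {morph b x : y y' / y + y'}
    & forall (c : C) x y, b (c *: x) y = b x (c *: y)].

Definition bieval G (b : A -> B -> G) s : G := \sum_(z <- s) b z.1 z.2.

Definition tens_eqv s t : bool :=
  `[< forall G (b : A -> B -> G), balanced b -> bieval b s = bieval b t >].

Fact tens_eqv_refl : reflexive tens_eqv.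
Proof. by move=> s; apply/asboolP. Qed.

Fact tens_eqv_sym : symmetric tens_eqv.
Proof.
by move=> s t; apply/asboolP/asboolP => h G b hb; rewrite (h G b hb).
Qed.

Fact tens_eqv_trans : transitive tens_eqv.
Proof.
move=> t s u /asboolP h1 /asboolP h2; apply/asboolP => G b hb.
by rewrite (h1 G b hb) (h2 G b hb).
Qed.

Canonical tens_eqv_equiv :=
  EquivRel tens_eqv tens_eqv_refl tens_eqv_sym tens_eqv_trans.

Definition tens : Type := {eq_quot tens_eqv}.
HB.instance Definition _ := Choice.on tens.

Implicit Types x y : tens.

Definition tpi s : tens := \pi_({eq_quot tens_eqv}) s.

Definition tpure (a : A) (b : B) : tens := tpi [:: (a, b)].

Definition tlift G (b : A -> B -> G) x : G := bieval b (repr x).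

Lemma tlift_pi G (b : A -> B -> G) s :
  balanced b -> tlift b (tpi s) = bieval b s.
Proof.
move=> hb; rewrite /tlift /tpi.
have : tens_eqv (repr (\pi_({eq_quot tens_eqv}) s)) s.
  by apply/eqmodP; rewrite reprK.
by move/asboolP; apply.
Qed.

Lemma tlift_pure G (b : A -> B -> G) a a' :
  balanced b -> tlift b (tpure a a') = b a a'.
Proof. by move=> hb; rewrite tlift_pi // /bieval big_seq1. Qed.

Lemma text x y :
  (forall G (b : A -> B -> G), balanced b -> tlift b x = tlift b y) -> x = y.
Proof.
move=> h; rewrite -[x]reprK -[y]reprK; apply/eqmodP/asboolP => G b hb.
exact: h.
Qed.

Lemma eq_tlift G (b b' : A -> B -> G) : b =2 b' -> tlift b =1 tlift b'.
Proof. by move=> e x; apply: eq_bigr => z _; rewrite e. Qed.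

Definition t0 : tens := tpi [::].
Definition t1 : tens := tpure 1 1.
Definition tadd x y : tens := tpi (repr x ++ repr y).
Definition tscale (c : C) x : tens :=
  tpi [seq (c *: z.1, z.2) | z <- repr x].
Definition topp x : tens := tpi [seq (- z.1, z.2) | z <- repr x].
Definition tmul x y : tens :=
  tpi [seq (z.1 * w.1, z.2 * w.2) | z <- repr x, w <- repr y].
Definition tstar x : tens := tpi [seq (star z.1, star z.2) | z <- repr x].

Section Lift.
Context {G : zmodType} {b : A -> B -> G} (hb : balanced b).

Lemma balancedN a a' : b (- a) a' = - b a a'.
Proof.
have [hl _ _] := hb.
have b0 : b 0 a' = 0 by apply: (addrI (b 0 a')); rewrite -hl !addr0.
by apply: (addrI (b a a')); rewrite -hl !subrr.
Qed.

Lemma balanced_scale (c : C) : balanced (fun u v => b (c *: u) v).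
Proof.
have [hl hr hz] := hb; split=> [y x x'|x y y'|d x y].
- by rewrite scalerDr hl.
- by rewrite hr.
- by rewrite scalerA mulrC -scalerA hz.
Qed.

Lemma balanced_mull a a' : balanced (fun u v => b (a * u) (a' * v)).
Proof.
have [hl hr hz] := hb; split=> [y x x'|x y y'|c x y].
- by rewrite mulrDr hl.
- by rewrite mulrDr hr.
- by rewrite -sscalerAr hz sscalerAr.
Qed.

Lemma balanced_mulr a a' : balanced (fun u v => b (u * a) (v * a')).
Proof.
have [hl hr hz] := hb; split=> [y x x'|x y y'|c x y].
- by rewrite mulrDl hl.
- by rewrite mulrDl hr.
- by rewrite -sscalerAl hz sscalerAl.
Qed.

Lemma balanced_tlift_mul y :
  balanced (fun u v => tlift (fun u' v' => b (u * u') (v * v')) y).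
Proof.
split=> [v u u'|u v v'|c u v]; rewrite /tlift /bieval -?big_split;
  apply: eq_bigr => z _; have [h1 h2 h3] := balanced_mulr z.1 z.2.
- by rewrite h1.
- by rewrite h2.
- by rewrite h3.
Qed.

Lemma balanced_star : balanced (fun u v => b (star u) (star v)).
Proof.
have [hl hr hz] := hb; split=> [y x x'|x y y'|c x y].
- by rewrite starD hl.
- by rewrite starD hr.
- by rewrite !starZ hz.
Qed.

Lemma tlift0 : tlift b t0 = 0.
Proof. by rewrite tlift_pi // /bieval big_nil. Qed.
Lemma tlift1 : tlift b t1 = b 1 1.
Proof. exact: tlift_pure. Qed.
Lemma tliftD x y : tlift b (tadd x y) = tlift b x + tlift b y.
Proof. by rewrite tlift_pi // /bieval big_cat. Qed.
Lemma tliftN x : tlift b (topp x) = - tlift b x.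
Proof.
rewrite tlift_pi // /bieval big_map -sumrN.
by apply: eq_bigr => z _; rewrite balancedN.
Qed.
Lemma tliftZ c x : tlift b (tscale c x) = tlift (fun u v => b (c *: u) v) x.
Proof. by rewrite tlift_pi // /bieval big_map. Qed.
Lemma tliftM x y : tlift b (tmul x y) =
  tlift (fun u v => tlift (fun u' v' => b (u * u') (v * v')) y) x.
Proof. by rewrite tlift_pi // /bieval big_allpairs_dep. Qed.
Lemma tliftS x : tlift b (tstar x) = tlift (fun u v => b (star u) (star v)) x.
Proof. by rewrite tlift_pi // /bieval big_map. Qed.

End Lift.

Lemma tlift_add G (b b' : A -> B -> G) x :
  tlift (fun u v => b u v + b' u v) x = tlift b x + tlift b' x.
Proof. exact: big_split. Qed.

Fact taddA : associative tadd.
Proof. by move=> x y z; apply: text => G b hb; rewrite !(tliftD hb) addrA. Qed.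
Fact taddC : commutative tadd.
Proof. by move=> x y; apply: text => G b hb; rewrite !(tliftD hb) addrC. Qed.
Fact tadd0 : left_id t0 tadd.
Proof.
by move=> x; apply: text => G b hb; rewrite (tliftD hb) (tlift0 hb) add0r.
Qed.
Fact taddN : left_inverse t0 topp tadd.
Proof.
move=> x; apply: text => G b hb.
by rewrite (tliftD hb) (tliftN hb) (tlift0 hb) addNr.
Qed.
HB.instance Definition _ :=
  GRing.isZmodule.Build tens taddA taddC tadd0 taddN.

Fact tmulA : associative tmul.
Proof.
move=> x y z; apply: text => G b hb; rewrite !(tliftM hb) (tliftM).
  apply: eq_tlift => u v; rewrite (tliftM (balanced_mull hb u v)).
  apply: eq_tlift => u' v'; apply: eq_tlift => u'' v''.
  by rewrite !mulrA.
exact: balanced_tlift_mul.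
Qed.

Fact tmul1 : left_id t1 tmul.
Proof.
move=> x; apply: text => G b hb.
rewrite (tliftM hb) (tlift_pure _ _ (balanced_tlift_mul hb x)).
by apply: eq_tlift => u v; rewrite !mul1r.
Qed.

Fact tmulr1 : right_id t1 tmul.
Proof.
move=> x; apply: text => G b hb; rewrite (tliftM hb).
apply: eq_tlift => u v.
by rewrite (tlift_pure _ _ (balanced_mull hb u v)) !mulr1.
Qed.

Fact tmulDl : left_distributive tmul +%R.
Proof.
move=> x y z; apply: text => G b hb.
by rewrite (tliftD hb) !(tliftM hb) (tliftD (balanced_tlift_mul hb z)).
Qed.

Fact tmulDr : right_distributive tmul +%R.
Proof.
move=> x y z; apply: text => G b hb.
rewrite (tliftD hb) !(tliftM hb) -tlift_add; apply: eq_tlift => u v.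
by rewrite (tliftD (balanced_mull hb u v)).
Qed.

HB.instance Definition _ := GRing.Zmodule_isPzRing.Build tens
  tmulA tmul1 tmulr1 tmulDl tmulDr.

Fact tscaleA c d x : tscale c (tscale d x) = tscale (c * d) x.
Proof.
apply: text => G b hb; rewrite !(tliftZ hb) (tliftZ (balanced_scale hb c)).
by apply: eq_tlift => u v; rewrite scalerA.
Qed.
Fact tscale1 : left_id 1 tscale.
Proof.
move=> x; apply: text => G b hb; rewrite (tliftZ hb).
by apply: eq_tlift => u v; rewrite scale1r.
Qed.
Fact tscaleDr : right_distributive tscale +%R.
Proof.
move=> c x y; apply: text => G b hb; rewrite (tliftD hb) !(tliftZ hb).
by rewrite (tliftD (balanced_scale hb c)).
Qed.
Fact tscaleDl x : {morph tscale^~ x : c d / c + d}.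
Proof.
move=> c d; apply: text => G b hb; rewrite (tliftD hb) !(tliftZ hb).
rewrite -tlift_add; apply: eq_tlift => u v; rewrite scalerDl.
by case: hb => hl _ _; rewrite hl.
Qed.
HB.instance Definition _ := GRing.Zmodule_isLmodule.Build C tens
  tscaleA tscale1 tscaleDr tscaleDl.

Fact tscalerAl (c : C) x y : c *: (x * y) = (c *: x) * y.
Proof.
apply: text => G b hb; rewrite (tliftZ hb) !(tliftM hb).
rewrite (tliftM (balanced_scale hb c)) (tliftZ (balanced_tlift_mul hb y)).
apply: eq_tlift => u v; apply: eq_tlift => u' v'.
by rewrite sscalerAl.
Qed.
Fact tscalerAr (c : C) x y : c *: (x * y) = x * (c *: y).
Proof.
apply: text => G b hb; rewrite (tliftZ hb) !(tliftM hb).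
rewrite (tliftM (balanced_scale hb c)); apply: eq_tlift => u v.
rewrite (tliftZ (balanced_mull hb u v)); apply: eq_tlift => u' v'.
by rewrite sscalerAr.
Qed.
Fact tstarD : {morph tstar : x y / x + y}.
Proof.
move=> x y; apply: text => G b hb; rewrite (tliftD hb) !(tliftS hb).
by rewrite (tliftD (balanced_star hb)).
Qed.
Fact tstarZ (c : C) x : tstar (c *: x) = c^* *: tstar x.
Proof.
apply: text => G b hb; rewrite (tliftZ hb) !tliftS //.
rewrite ?(tliftZ (balanced_star hb)) //.
  by apply: eq_tlift => u v; rewrite starZ.
exact: balanced_scale.
Qed.

Lemma tlift_exch G (b : A -> B -> A -> B -> G) x y :
  tlift (fun u v => tlift (fun u' v' => b u v u' v') y) x =
  tlift (fun u' v' => tlift (fun u v => b u v u' v') x) y.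
Proof. exact: exchange_big. Qed.

Fact tstarM x y : tstar (x * y) = tstar y * tstar x.
Proof.
apply: text => G b hb; rewrite (tliftS hb) !(tliftM hb).
rewrite (tliftM (balanced_star hb)) (tliftS (balanced_tlift_mul hb _)).
rewrite tlift_exch; apply: eq_tlift => u v.
rewrite (tliftS (balanced_mull hb _ _)); apply: eq_tlift => u' v'.
by rewrite !starM.
Qed.
Fact tstarK : involutive tstar.
Proof.
move=> x; apply: text => G b hb.
rewrite (tliftS hb) (tliftS (balanced_star hb)).
by apply: eq_tlift => u v; rewrite !starK.
Qed.
HB.instance Definition _ := isStarAlgebra.Build C tens
  tmulA tmul1 tmulr1 tmulDl tmulDr
  tscalerAl tscalerAr tstarD tstarZ tstarM tstarK.

Lemma tpure_balanced : balanced tpure.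
Proof.
split=> [v u u'|u v v'|c u v]; apply: text => G b hb; have [hl hr hz] := hb.
- by rewrite (tliftD hb) !(tlift_pure _ _ hb) hl.
- by rewrite (tliftD hb) !(tlift_pure _ _ hb) hr.
- by rewrite !(tlift_pure _ _ hb) hz.
Qed.

Lemma tpureM a a' c c' : tpure a c * tpure a' c' = tpure (a * a') (c * c').
Proof.
apply: text => G b hb; rewrite (tliftM hb).
rewrite (tlift_pure _ _ (balanced_tlift_mul hb _)).
by rewrite (tlift_pure _ _ (balanced_mull hb a c)) (tlift_pure _ _ hb).
Qed.

Lemma tpureS a c : star (tpure a c) = tpure (star a) (star c).
Proof.
by apply: text => G b hb; rewrite (tliftS hb) !tlift_pure //;
  exact: balanced_star.
Qed.

Lemma tpureZ (c : C) a a' : c *: tpure a a' = tpure (c *: a) a'.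
Proof.
by apply: text => G b hb; rewrite (tliftZ hb) !tlift_pure //;
  exact: balanced_scale.
Qed.

Lemma tlift_morphism (D : starAlgType C) (b : A -> B -> D) :
  balanced b -> (forall c u v, b (c *: u) v = c *: b u v) -> b 1 1 = 1 ->
  (forall u u' v v', b (u * u') (v * v') = b u v * b u' v') ->
  (forall u v, b (star u) (star v) = star (b u v)) ->
  star_morphism (tlift b).
Proof.
move=> hb bZ b1 bM bS; apply: mk_star_morphism => [x y|c x|x y||x].
- exact: tliftD.
- rewrite [LHS]tliftZ // /tlift /bieval scaler_sumr.
  by apply: eq_bigr => z _.
- rewrite [LHS]tliftM // /tlift /bieval mulr_suml.
  apply: eq_bigr => z _; rewrite mulr_sumr.
  by apply: eq_bigr => w _.
- by rewrite [LHS]tlift1.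
- rewrite [LHS]tliftS // /tlift /bieval star_sum.
  by apply: eq_bigr => z _.
Qed.

End Tensor.

Notation "a ⊗ b" := (tpure a b) (at level 40, no associativity).

Definition tens_map (C : numClosedFieldType) (A B A' B' : starAlgType C)
    (f : A -> A') (g : B -> B') : tens A B -> tens A' B' :=
  tlift (fun a b => f a ⊗ g b).

Section TensMap.
Variables (C : numClosedFieldType) (A B A' B' : starAlgType C).
Variables (f : A -> A') (g : B -> B').
Hypotheses (hf : star_morphism f) (hg : star_morphism g).

Lemma tens_map_balanced : balanced (fun a b => f a ⊗ g b).
Proof.
have [tl tr tz] := @tpure_balanced C A' B'.
split=> [y x x'|x y y'|c x y].
- by rewrite (smD hf) tl.
- by rewrite (smD hg) tr.
- by rewrite (smZ hf) (smZ hg) tz.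
Qed.

Lemma tens_map_morphism : star_morphism (tens_map f g).
Proof.
apply: tlift_morphism => [|c x y||x x' y y'|x y].
- exact: tens_map_balanced.
- by rewrite (smZ hf) tpureZ.
- by rewrite (sm1 hf) (sm1 hg).
- by rewrite (smM hf) (smM hg) tpureM.
- by rewrite (smS hf) (smS hg) tpureS.
Qed.

Lemma tens_map_pure a b : tens_map f g (a ⊗ b) = f a ⊗ g b.
Proof. exact: (tlift_pure _ _ tens_map_balanced). Qed.

End TensMap.

Section TensTheory.
Context {C : numClosedFieldType} {A B : starAlgType C}.

Lemma tpureDl (a a' : A) (b : B) : (a + a') ⊗ b = a ⊗ b + a' ⊗ b.
Proof. by case: (tpure_balanced A B) => + _ _; apply. Qed.

Lemma tpureDr (a : A) (b b' : B) : a ⊗ (b + b') = a ⊗ b + a ⊗ b'.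
Proof. by case: (tpure_balanced A B) => _ + _; apply. Qed.

Lemma tpureZr (c : C) (a : A) (b : B) : a ⊗ (c *: b) = c *: (a ⊗ b).
Proof. by case: (tpure_balanced A B) => _ _ <-; rewrite tpureZ. Qed.

Lemma tpure0l (b : B) : (0 : A) ⊗ b = 0.
Proof. by rewrite -(scale0r (0 : A)) -tpureZ scale0r. Qed.

Lemma tpure0r (a : A) : a ⊗ (0 : B) = 0.
Proof. by rewrite -(scale0r (0 : B)) tpureZr scale0r. Qed.

Lemma tpure_suml I r (P : pred I) (F : I -> A) (b : B) :
  (\sum_(i <- r | P i) F i) ⊗ b = \sum_(i <- r | P i) F i ⊗ b.
Proof.
by apply: (big_morph (fun a => a ⊗ b)) => [x y|]; rewrite ?tpureDl ?tpure0l.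
Qed.

Lemma tpure_sumr I r (P : pred I) (F : I -> B) (a : A) :
  a ⊗ (\sum_(i <- r | P i) F i) = \sum_(i <- r | P i) a ⊗ F i.
Proof.
by apply: (big_morph (fun b => a ⊗ b)) => [x y|]; rewrite ?tpureDr ?tpure0r.
Qed.

End TensTheory.

Section FreeProduct.
Variables (C : numClosedFieldType) (A B : starAlgType C).

Definition free_prod_rel (D : starAlgType C) (f : A + B -> D) : Prop :=
  star_morphism (f \o inl) /\ star_morphism (f \o inr).

Definition free_prod : starAlgType C := universal (@free_prod_rel).

Definition free_inl (a : A) : free_prod := ugen (@free_prod_rel) (inl a).
Definition free_inr (b : B) : free_prod := ugen (@free_prod_rel) (inr b).

Lemma free_inl_morphism : star_morphism free_inl.
Proof.
apply: universal_morphism => D f Pf.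
suff -> : ulift f \o free_inl = f \o inl by case: Pf.
by apply: funext => a; rewrite /= ulift_gen.
Qed.

Lemma free_inr_morphism : star_morphism free_inr.
Proof.
apply: universal_morphism => D f Pf.
suff -> : ulift f \o free_inr = f \o inr by case: Pf.
by apply: funext => a; rewrite /= ulift_gen.
Qed.

End FreeProduct.
Arguments free_inl {C A} B a.
Arguments free_inr {C} A {B} b.

Section FreePower.
Variables (C : numClosedFieldType) (A : starAlgType C) (n : nat).

Definition free_pow_rel (D : starAlgType C) (f : 'I_n * A -> D) : Prop :=
  forall i, star_morphism (fun a => f (i, a)).

Definition free_pow : starAlgType C := universal (@free_pow_rel).

Definition free_in (i : 'I_n) (a : A) : free_pow := ugen (@free_pow_rel) (i, a).

Lemma free_in_morphism i : star_morphism (free_in i).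
Proof.
apply: universal_morphism => D f Pf.
suff -> : ulift f \o free_in i = fun a => f (i, a) by [].
by apply: funext => a; rewrite /= ulift_gen.
Qed.

End FreePower.

(* The quotient of B by the *-ideal generated by K; this is the two-sided ideal
   generated by K when K is closed under [star] up to sign, as in
   [wreath_commutator]. *)
Section Quotient.
Variables (C : numClosedFieldType) (B : starAlgType C) (K : B -> Prop).

Definition quot_rel (D : starAlgType C) (f : B -> D) : Prop :=
  star_morphism f /\ forall b, K b -> f b = 0.

Definition quot : starAlgType C := universal (@quot_rel).

Definition quot_pi (b : B) : quot := ugen (@quot_rel) b.

Lemma quot_pi_morphism : star_morphism quot_pi.
Proof.
apply: universal_morphism => D f Pf.
suff -> : ulift f \o quot_pi = f by case: Pf.
by apply: funext => a; rewrite /= ulift_gen.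
Qed.

Lemma quot_pi0 b : K b -> quot_pi b = 0.
Proof.
move=> Kb; apply: uext => D f Pf.
rewrite (ulift_gen Pf) (sm0 (ulift_morphism Pf)).
by case: Pf => _ ->.
Qed.

End Quotient.

Record magic (C : numClosedFieldType) (A : starAlgType C) (I : finType)
    (p : I -> I -> A) : Prop := Magic {
  magic_star : forall i j, star (p i j) = p i j;
  magic_idem : forall i j, p i j * p i j = p i j;
  magic_row : forall i, \sum_j p i j = 1;
  magic_col : forall i, \sum_j p j i = 1;
  magic_row_orth : forall i j k, j != k -> p i j * p i k = 0;
  magic_col_orth : forall i j k, j != k -> p j i * p k i = 0
}.

Section MagicTheory.
Context {C : numClosedFieldType}.

Lemma magic_morphism (A B : starAlgType C) (f : A -> B) (I : finType)
    (p : I -> I -> A) :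
  star_morphism f -> magic p -> magic (fun i j => f (p i j)).
Proof.
move=> hf [ps pi pr pc pro pco]; split=> [i j|i j|i|i|i j k jk|i j k jk].
- by rewrite -(smS hf) ps.
- by rewrite -(smM hf) pi.
- by rewrite -(sm_sum hf) pr (sm1 hf).
- by rewrite -(sm_sum hf) pc (sm1 hf).
- by rewrite -(smM hf) pro ?(sm0 hf).
- by rewrite -(smM hf) pco ?(sm0 hf).
Qed.

Lemma magic_universal X (P : forall A : starAlgType C, (X -> A) -> Prop)
    (I : finType) (p : I -> I -> universal P) :
  (forall (A : starAlgType C) (f : X -> A), P A f ->
     magic (fun i j => ulift f (p i j))) -> magic p.
Proof.
move=> h; split=> [i j|i j|i|i|i j k jk|i j k jk]; apply: uext => A f Pf;
  have hf := ulift_morphism Pf; have [ps pi pr pc pro pco] := h A f Pf.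
- by rewrite (smS hf) ps.
- by rewrite (smM hf) pi.
- by rewrite (sm_sum hf) pr (sm1 hf).
- by rewrite (sm_sum hf) pc (sm1 hf).
- by rewrite (smM hf) pro ?(sm0 hf).
- by rewrite (smM hf) pco ?(sm0 hf).
Qed.

Definition coprod (A : starAlgType C) (I : finType) (p : I -> I -> A)
  (i j : I) : tens A A := \sum_k p i k ⊗ p k j.

Lemma magic_coprod (A : starAlgType C) (I : finType) (p : I -> I -> A) :
  magic p -> magic (coprod p).
Proof.
move=> [ps pi pr pc pro pco].
have key i j i' j' : coprod p i j * coprod p i' j' =
    \sum_k \sum_l (p i k * p i' l) ⊗ (p k j * p l j').
  rewrite /coprod mulr_suml; apply: eq_bigr => k _; rewrite mulr_sumr.
  by apply: eq_bigr => l _; rewrite tpureM.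
have keyr i j j' : coprod p i j * coprod p i j' =
    \sum_k p i k ⊗ (p k j * p k j').
  rewrite key; apply: eq_bigr => k _; rewrite (bigD1 k) //= pi big1 ?addr0 //.
  by move=> l lk; rewrite pro 1?eq_sym // tpure0l.
split=> [i j|i j|i|i|i j k jk|i j k jk].
- by rewrite star_sum; apply: eq_bigr => k _; rewrite tpureS !ps.
- by rewrite keyr; apply: eq_bigr => k _; rewrite pi.
- rewrite exchange_big /= -[RHS]/(1 ⊗ 1) -{1}(pr i) tpure_suml.
  by apply: eq_bigr => k _; rewrite -tpure_sumr pr.
- rewrite exchange_big /= -[RHS]/(1 ⊗ 1) -{2}(pc i) tpure_sumr.
  by apply: eq_bigr => k _; rewrite -tpure_suml pc.
- by rewrite keyr big1 // => l _; rewrite pro // tpure0r.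
- rewrite key big1 // => l _; rewrite big1 // => m _.
  have [<-|lm] := eqVneq l m; first by rewrite pco // tpure0l.
  by rewrite pco // tpure0r.
Qed.

End MagicTheory.

(* The rows and columns of the fundamental representation are indexed by an
   arbitrary nonempty finite type.  The comultiplication is determined by
   [qcomultE], since [qfund] generates. *)
Record qpgroup (C : numClosedFieldType) := QPGroup {
  qalg : starAlgType C;
  qidx : finType;
  qfund : qidx -> qidx -> qalg;
  qcomult : qalg -> tens qalg qalg;
  qidx_gt0 : (0 < #|qidx|)%N;
  qfund_magic : magic qfund;
  qfund_generates : generates qfund;
  qcomult_morphism : star_morphism qcomult;
  qcomultE : forall i j, qcomult (qfund i j) = \sum_k qfund i k ⊗ qfund k j
}.

Definition qiso (C : numClosedFieldType) (X Y : qpgroup C) : Prop :=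
  exists f : qalg X -> qalg Y,
    [/\ star_morphism f, bijective f
      & forall a, qcomult (f a) = tens_map f f (qcomult a)].

Section Trivial.
Variable C : numClosedFieldType.

Let tfund (_ _ : unit) : C^o := 1.
Let tcomult (c : C^o) : tens C^o C^o := c ⊗ 1.

Fact trivial_magic : magic tfund.
Proof.
have cardU (F : unit -> C^o) : \sum_i F i = F tt.
  by rewrite (big_pred1 tt) // => -[].
by split=> [i j|i j|i|i|i [] []|i [] []] //=;
  rewrite ?cardU ?mulr1 //; apply: conjC1.
Qed.

Fact trivial_generates : generates tfund.
Proof.
move=> S hS Sp a; rewrite (_ : a = a *: (1 : C^o)).
  by apply: (subalgZ hS); apply: (Sp tt tt).
by rewrite /GRing.scale /= mulr1.
Qed.

Fact trivial_comult_morphism : star_morphism tcomult.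
Proof.
apply: mk_star_morphism => [a b|c a|a b||a] //.
- exact: tpureDl.
- by rewrite /tcomult tpureZ.
- by rewrite /tcomult tpureM mulr1.
- by rewrite /tcomult tpureS star1.
Qed.

Fact trivial_comultE i j : tcomult (tfund i j) = \sum_k tfund i k ⊗ tfund k j.
Proof. by rewrite (big_pred1 tt) // => -[]. Qed.

Fact trivial_idx_gt0 : (0 < #|{: unit}|)%N.
Proof. by rewrite card_unit. Qed.

Definition trivial_qpg : qpgroup C :=
  QPGroup trivial_idx_gt0 trivial_magic trivial_generates
    trivial_comult_morphism trivial_comultE.

End Trivial.

Section QSym.
Variables (C : numClosedFieldType) (n : nat).

Definition qsym_rel (A : starAlgType C) (f : 'I_n * 'I_n -> A) : Prop :=
  magic (fun i j => f (i, j)).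

Definition qsym_alg : starAlgType C := universal (@qsym_rel).

Definition qsym_fund (i j : 'I_n) : qsym_alg := ugen (@qsym_rel) (i, j).

Definition qsym_comult : qsym_alg -> tens qsym_alg qsym_alg :=
  ulift (fun ij => coprod qsym_fund ij.1 ij.2).

Fact qsym_magic : magic qsym_fund.
Proof.
apply: magic_universal => A f Pf.
suff -> : (fun i j => ulift f (qsym_fund i j)) = fun i j => f (i, j) by [].
by apply: funext => i; apply: funext => j; rewrite ulift_gen.
Qed.

Fact qsym_generates : generates qsym_fund.
Proof. by move=> S hS Sp; apply: universal_ind => // -[i j]; apply: Sp. Qed.

Fact qsym_comult_rel : qsym_rel (fun ij => coprod qsym_fund ij.1 ij.2).
Proof. exact: magic_coprod qsym_magic. Qed.

Fact qsym_comult_morphism : star_morphism qsym_comult.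
Proof. exact: ulift_morphism qsym_comult_rel. Qed.

Fact qsym_comultE i j :
  qsym_comult (qsym_fund i j) = \sum_k qsym_fund i k ⊗ qsym_fund k j.
Proof. by rewrite /qsym_comult (ulift_gen qsym_comult_rel). Qed.

Fact qsym_idx_gt0 : (0 < n)%N -> (0 < #|'I_n|)%N.
Proof. by rewrite card_ord. Qed.

Definition qsym (n_gt0 : (0 < n)%N) : qpgroup C :=
  QPGroup (qsym_idx_gt0 n_gt0) qsym_magic qsym_generates
    qsym_comult_morphism qsym_comultE.

End QSym.

Section QFree.
Variables (C : numClosedFieldType) (X Y : qpgroup C).

Let I : finType := (qidx X + qidx Y)%type.
Let A : starAlgType C := free_prod (qalg X) (qalg Y).
Let hl := free_inl_morphism (qalg X) (qalg Y).
Let hr := free_inr_morphism (qalg X) (qalg Y).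

Definition qfree_fund (i j : I) : A :=
  match i, j with
  | inl i, inl j => free_inl (qalg Y) (qfund i j)
  | inr i, inr j => free_inr (qalg X) (qfund i j)
  | _, _ => 0
  end.

Let comult_gen (z : qalg X + qalg Y) : tens A A :=
  match z with
  | inl a => tens_map (free_inl (qalg Y)) (free_inl (qalg Y)) (qcomult a)
  | inr b => tens_map (free_inr (qalg X)) (free_inr (qalg X)) (qcomult b)
  end.

Definition qfree_comult : A -> tens A A := ulift comult_gen.

Fact qfree_magic : magic qfree_fund.
Proof.
have [ps pi pr pc pro pco] := magic_morphism hl (qfund_magic X).
have [qs qi qr qc qro qco] := magic_morphism hr (qfund_magic Y).
split.
- by move=> [i|i] [j|j] /=; rewrite ?ps ?qs ?star0.
- by move=> [i|i] [j|j] /=; rewrite ?pi ?qi ?mulr0.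
- by move=> [i|i]; rewrite big_sumType /= ?pr ?qr big1 ?addr0 ?add0r.
- by move=> [i|i]; rewrite big_sumType /= ?pc ?qc big1 ?addr0 ?add0r.
- by move=> [i|i] [j|j] [k|k] jk /=; rewrite ?mulr0 ?mul0r ?pro ?qro.
- by move=> [i|i] [j|j] [k|k] jk /=; rewrite ?mulr0 ?mul0r ?pco ?qco.
Qed.

Fact qfree_generates : generates qfree_fund.
Proof.
move=> S hS Sp; apply: universal_ind => // -[a|b].
- apply: (qfund_generates (subalg_preim hS hl)) => i j.
  exact: (Sp (inl i) (inl j)).
- apply: (qfund_generates (subalg_preim hS hr)) => i j.
  exact: (Sp (inr i) (inr j)).
Qed.

Fact qfree_comult_rel : free_prod_rel comult_gen.
Proof.
split; apply: star_morphism_comp (qcomult_morphism _);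
  [exact: tens_map_morphism hl hl | exact: tens_map_morphism hr hr].
Qed.

Fact qfree_comult_morphism : star_morphism qfree_comult.
Proof. exact: ulift_morphism qfree_comult_rel. Qed.

Fact qfree_comultE i j :
  qfree_comult (qfree_fund i j) = \sum_k qfree_fund i k ⊗ qfree_fund k j.
Proof.
have hc := qfree_comult_morphism.
rewrite big_sumType /=.
case: i j => [i|i] [j|j] /=.
- rewrite [RHS]addrC big1 ?add0r => [|k _]; last by rewrite tpure0l.
  rewrite /qfree_comult (ulift_gen qfree_comult_rel) /= qcomultE.
  rewrite (sm_sum (tens_map_morphism hl hl)).
  by apply: eq_bigr => k _; rewrite (tens_map_pure hl hl).
- rewrite (sm0 hc) !big1 ?addr0 // => k _; first by rewrite tpure0l.
  by rewrite tpure0r.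
- rewrite (sm0 hc) !big1 ?addr0 // => k _; first by rewrite tpure0r.
  by rewrite tpure0l.
- rewrite big1 ?add0r => [|k _]; last by rewrite tpure0l.
  rewrite /qfree_comult (ulift_gen qfree_comult_rel) /= qcomultE.
  rewrite (sm_sum (tens_map_morphism hr hr)).
  by apply: eq_bigr => k _; rewrite (tens_map_pure hr hr).
Qed.

Fact qfree_idx_gt0 : (0 < #|I|)%N.
Proof. by rewrite card_sum addn_gt0 qidx_gt0. Qed.

Definition qfree : qpgroup C :=
  QPGroup qfree_idx_gt0 qfree_magic qfree_generates
    qfree_comult_morphism qfree_comultE.

End QFree.

Section QWreath.
Variables (C : numClosedFieldType) (X : qpgroup C) (n : nat).
Hypothesis n_gt0 : (0 < n)%N.

Let S : qpgroup C := qsym C n_gt0.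
Let B : starAlgType C := free_prod (free_pow (qalg X) n) (qalg S).
Let I : finType := ('I_n * qidx X)%type.

Let bnu (i : 'I_n) (a : qalg X) : B := free_inl (qalg S) (free_in i a).
Let bp (i j : 'I_n) : B := free_inr (free_pow (qalg X) n) (@qfund C S i j).

Definition wreath_commutator (b : B) : Prop :=
  exists (i j : 'I_n) (a : qalg X), b = bnu i a * bp i j - bp i j * bnu i a.

Definition wreath_alg : starAlgType C := quot wreath_commutator.

Let W := wreath_alg.

Definition wreath_nu (i : 'I_n) (a : qalg X) : W :=
  quot_pi wreath_commutator (bnu i a).
Definition wreath_p (i j : 'I_n) : W :=
  quot_pi wreath_commutator (bp i j).

Definition qwreath_fund (x y : I) : W :=
  wreath_nu x.1 (qfund x.2 y.2) * wreath_p x.1 y.1.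

Let hpi := quot_pi_morphism wreath_commutator.
Let hl := free_inl_morphism (free_pow (qalg X) n) (qalg S).
Let hr := free_inr_morphism (free_pow (qalg X) n) (qalg S).

Let hnu i : star_morphism (wreath_nu i).
Proof.
apply: (star_morphism_comp hpi); apply: (star_morphism_comp hl).
exact: free_in_morphism.
Qed.

Let hS : star_morphism
  (quot_pi wreath_commutator \o free_inr (free_pow (qalg X) n)).
Proof. exact: star_morphism_comp hpi hr. Qed.

Let pmagic : magic wreath_p.
Proof. exact: magic_morphism hS (qfund_magic S). Qed.

Let nu_p_comm i j a :
  wreath_nu i a * wreath_p i j = wreath_p i j * wreath_nu i a.
Proof.
apply/eqP; rewrite -subr_eq0 -!(smM hpi) -(smB hpi); apply/eqP.
by apply: quot_pi0; exists i, j, a.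
Qed.

Let wM i j k l k' l' i' j' : i = i' -> qwreath_fund (i, k) (j, l) *
    qwreath_fund (i', k') (j', l') =
  wreath_nu i (qfund k l * qfund k' l') * (wreath_p i j * wreath_p i' j').
Proof.
move=> <-; rewrite /qwreath_fund /= (smM (hnu i)) -!mulrA; congr (_ * _).
by rewrite !mulrA nu_p_comm.
Qed.

Fact qwreath_magic : magic qwreath_fund.
Proof.
have [ps pi pr pc pro pco] := pmagic.
have [us ui ur uc uro uco] := qfund_magic X.
split.
- move=> [i k] [j l]; rewrite /qwreath_fund /= starM ps -(smS (hnu i)) us.
  by rewrite nu_p_comm.
- by move=> [i k] [j l]; rewrite wM // ui pi.
- move=> [i k]; rewrite -(pair_bigA _ (fun j l => qwreath_fund (i, k) (j, l))).
  rewrite /qwreath_fund /= -[RHS](pr i); apply: eq_bigr => j _.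
  by rewrite -mulr_suml -(sm_sum (hnu i)) ur (sm1 (hnu i)) mul1r.
- move=> [i k]; rewrite -(pair_bigA _ (fun j l => qwreath_fund (j, l) (i, k))).
  rewrite /qwreath_fund /= -[RHS](pc i); apply: eq_bigr => j _.
  by rewrite -mulr_suml -(sm_sum (hnu j)) uc (sm1 (hnu j)) mul1r.
- move=> [i k] [j l] [j' l']; rewrite xpair_eqE negb_and => jl.
  rewrite wM //; case/orP: jl => jl; first by rewrite pro // mulr0.
  by rewrite uro // (sm0 (hnu i)) mul0r.
- move=> [i k] [j l] [j' l']; rewrite xpair_eqE => jl.
  have [jj|jj] := eqVneq j j'.
    rewrite wM // uco ?(sm0 (hnu j)) ?mul0r //.
    by move: jl; rewrite jj eqxx.
  rewrite /qwreath_fund /= (nu_p_comm j') -mulrA (mulrA (wreath_p j i)).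
  by rewrite pco // mul0r mulr0.
Qed.

Fact qwreath_generates : generates qwreath_fund.
Proof.
have [ps pi pr pc pro pco] := pmagic.
have [us ui ur uc uro uco] := qfund_magic X.
move=> T hT Tw.
have Tp i j : T (wreath_p i j).
  have [k _] : exists k : qidx X, true.
    by case/card_gt0P: (qidx_gt0 X) => k _; exists k.
  have -> : wreath_p i j = \sum_l qwreath_fund (i, k) (j, l).
    rewrite /qwreath_fund /= -mulr_suml -(sm_sum (hnu i)) ur.
    by rewrite (sm1 (hnu i)) mul1r.
  by apply: (subalg_sum hT).
have Tnu i a : T (wreath_nu i a).
  apply: (qfund_generates (subalg_preim hT (hnu i))) => k l /=.
  have -> : wreath_nu i (qfund k l) = \sum_j qwreath_fund (i, k) (j, l).
    by rewrite /qwreath_fund /= -mulr_sumr pr mulr1.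
  by apply: (subalg_sum hT).
apply: universal_ind => // b.
apply: (universal_ind (subalg_preim hT hpi)) => -[x|s].
- have := subalg_preim hT (star_morphism_comp hpi hl).
  by move/universal_ind; apply=> -[i a]; apply: Tnu.
- exact: (qfund_generates (subalg_preim hT hS)).
Qed.

(* On the i-th copy of the algebra of X the comultiplication is
   a |-> \sum_k (nu_i (a_1) p_ik) ⊗ nu_k (a_2) in Sweedler notation. *)
Let bmap (i : 'I_n) (a b : qalg X) : tens W W :=
  \sum_k (wreath_nu i a * wreath_p i k) ⊗ wreath_nu k b.

Let bmap_balanced i : balanced (bmap i).
Proof.
split=> [y u u'|u v v'|c u v]; rewrite /bmap -?big_split; apply: eq_bigr => k _.
- by rewrite (smD (hnu i)) mulrDl tpureDl.
- by rewrite (smD (hnu k)) tpureDr.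
- by rewrite (smZ (hnu i)) (smZ (hnu k)) -sscalerAl tpureZr tpureZ.
Qed.

Let bmap_morphism i : star_morphism (tlift (bmap i)).
Proof.
have [ps pi pr pc pro pco] := pmagic.
apply: tlift_morphism => [|c u v||u u' v v'|u v]; rewrite ?/bmap.
- exact: bmap_balanced.
- rewrite scaler_sumr; apply: eq_bigr => k _.
  by rewrite (smZ (hnu i)) -sscalerAl tpureZ.
- rewrite -[RHS]/(1 ⊗ 1) -{1}(pr i) tpure_suml.
  by apply: eq_bigr => k _; rewrite (sm1 (hnu i)) (sm1 (hnu k)) mul1r.
- rewrite mulr_suml; apply: eq_bigr => k _; rewrite mulr_sumr.
  have e l : wreath_nu i u * wreath_p i k * (wreath_nu i u' * wreath_p i l) =
      wreath_nu i (u * u') * (wreath_p i k * wreath_p i l).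
    rewrite (smM (hnu i)) -!mulrA; congr (_ * _).
    by rewrite !mulrA nu_p_comm.
  rewrite (bigD1 k) //= tpureM e pi (smM (hnu k)) big1 ?addr0 // => l lk.
  by rewrite tpureM e pro 1?eq_sym // mulr0 tpure0l.
- rewrite star_sum; apply: eq_bigr => k _.
  by rewrite tpureS starM ps -(smS (hnu i)) -(smS (hnu k)) nu_p_comm.
Qed.

Let wcp (i j : 'I_n) : tens W W := \sum_k wreath_p i k ⊗ wreath_p k j.

Let bmap_mul i j a b :
  bmap i a b * wcp i j =
  \sum_k (wreath_nu i a * wreath_p i k) ⊗ (wreath_nu k b * wreath_p k j).
Proof.
have [ps pi pr pc pro pco] := pmagic.
rewrite mulr_suml; apply: eq_bigr => k _; rewrite mulr_sumr.
rewrite (bigD1 k) //= big1 ?addr0 => [|l lk].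
  by rewrite tpureM -mulrA pi.
by rewrite tpureM -mulrA pro 1?eq_sym // mulr0 tpure0l.
Qed.

Let bmap_comm i j x : tlift (bmap i) x * wcp i j = wcp i j * tlift (bmap i) x.
Proof.
have [ps pi pr pc pro pco] := pmagic.
rewrite /tlift /bieval mulr_suml mulr_sumr; apply: eq_bigr => -[a b] _ /=.
rewrite bmap_mul mulr_suml; apply: eq_bigr => k _; rewrite mulr_sumr.
rewrite (bigD1 k) //= big1 ?addr0 => [|l lk].
  by rewrite tpureM !nu_p_comm mulrA pi.
by rewrite tpureM nu_p_comm mulrA pro 1?eq_sym // mul0r tpure0l.
Qed.

Let comult_gen_pow (z : 'I_n * qalg X) : tens W W :=
  tlift (bmap z.1) (qcomult z.2).

Let comult_gen_free (z : free_pow (qalg X) n + qalg S) : tens W W :=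
  match z with
  | inl x => ulift comult_gen_pow x
  | inr s =>
      tens_map (quot_pi wreath_commutator \o free_inr (free_pow (qalg X) n))
        (quot_pi wreath_commutator \o free_inr (free_pow (qalg X) n))
        (qcomult s)
  end.

Definition qwreath_comult : W -> tens W W := ulift (ulift comult_gen_free).

Let rel_pow : free_pow_rel comult_gen_pow.
Proof.
by move=> i; apply: star_morphism_comp (bmap_morphism i) (qcomult_morphism X).
Qed.

Let rel_free : free_prod_rel comult_gen_free.
Proof.
split; first exact: ulift_morphism rel_pow.
exact: star_morphism_comp (tens_map_morphism hS hS) (qcomult_morphism S).
Qed.

Let lift_nu i a : ulift comult_gen_free (bnu i a) = tlift (bmap i) (qcomult a).
Proof. by rewrite (ulift_gen rel_free) /= (ulift_gen rel_pow). Qed.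

Let lift_p i j : ulift comult_gen_free (bp i j) = wcp i j.
Proof.
rewrite (ulift_gen rel_free) /= qsym_comultE.
rewrite (sm_sum (tens_map_morphism hS hS)).
by apply: eq_bigr => k _; rewrite (tens_map_pure hS hS).
Qed.

Let rel_quot : quot_rel wreath_commutator (ulift comult_gen_free).
Proof.
have h := ulift_morphism rel_free; split=> // b [i [j [a ->]]].
by rewrite (smB h) !(smM h) lift_nu lift_p bmap_comm subrr.
Qed.

Fact qwreath_comult_morphism : star_morphism qwreath_comult.
Proof. exact: ulift_morphism rel_quot. Qed.

Fact qwreath_comultE x y :
  qwreath_comult (qwreath_fund x y) =
  \sum_z qwreath_fund x z ⊗ qwreath_fund z y.
Proof.
case: x y => [i k] [j l]; rewrite (smM qwreath_comult_morphism) /=.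
rewrite /qwreath_comult !(ulift_gen rel_quot) lift_nu lift_p qcomultE.
rewrite (sm_sum (bmap_morphism i)) mulr_suml.
rewrite -(pair_bigA _ (fun s m =>
  qwreath_fund (i, k) (s, m) ⊗ qwreath_fund (s, m) (j, l))) /=.
rewrite exchange_big; apply: eq_bigr => m _ /=.
by rewrite (tlift_pure _ _ (bmap_balanced i)) bmap_mul.
Qed.

Fact qwreath_idx_gt0 : (0 < #|I|)%N.
Proof. by rewrite card_prod card_ord muln_gt0 n_gt0 qidx_gt0. Qed.

Definition qwreath : qpgroup C :=
  QPGroup qwreath_idx_gt0 qwreath_magic qwreath_generates
    qwreath_comult_morphism qwreath_comultE.

End QWreath.

Record sgraph := SGraph {
  vertex :> finType;
  edge : rel vertex;
  edge_sym : symmetric edge;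
  edge_irrefl : irreflexive edge;
  vertex_gt0 : (0 < #|vertex|)%N
}.

Definition graph_iso (G H : sgraph) : Prop :=
  exists2 f : G -> H, bijective f & {mono f : x y / edge x y}.

Section GraphOperations.

Definition compl_edge (G : sgraph) : rel G :=
  [rel x y | (x != y) && ~~ edge x y].

Fact compl_edge_sym G : symmetric (@compl_edge G).
Proof. by move=> x y; rewrite /compl_edge /= eq_sym edge_sym. Qed.

Fact compl_edge_irrefl G : irreflexive (@compl_edge G).
Proof. by move=> x; rewrite /compl_edge /= eqxx. Qed.

Definition graph_compl (G : sgraph) : sgraph :=
  SGraph (@compl_edge_sym G) (@compl_edge_irrefl G) (vertex_gt0 G).

Variables (n : nat) (G : 'I_n.+1 -> sgraph).

Definition union_edge : rel {i : 'I_n.+1 & G i} :=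
  [rel x y | (tag x == tag y) && edge (tagged x) (tagged_as x y)].

Fact union_edge_sym : symmetric union_edge.
Proof.
move=> [i x] [j y]; rewrite /union_edge /= eq_sym.
have [e|//] := eqVneq j i; move: y; rewrite e => y.
by rewrite !tagged_asE edge_sym.
Qed.

Fact union_edge_irrefl : irreflexive union_edge.
Proof.
by move=> [i x]; rewrite /union_edge /= tagged_asE edge_irrefl andbF.
Qed.

Fact union_gt0 : (0 < #|{: {i : 'I_n.+1 & G i}}|)%N.
Proof.
have /card_gt0P[x _] := vertex_gt0 (G ord0).
by apply/card_gt0P; exists (Tagged (fun i => G i : Type) x).
Qed.

Definition graph_union : sgraph :=
  SGraph union_edge_sym union_edge_irrefl union_gt0.

End GraphOperations.

Definition is_tree (G : sgraph) : Prop :=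
  (forall x y : G, connect (@edge G) x y) /\
  (forall c : seq G, ucycle (@edge G) c -> (size c < 3)%N).

Inductive tree_cograph : sgraph -> Prop :=
| tree_cograph_tree G : is_tree G -> tree_cograph G
| tree_cograph_union n (G : 'I_n.+1 -> sgraph) :
    (forall i, tree_cograph (G i)) -> tree_cograph (graph_union G)
| tree_cograph_compl G : tree_cograph G -> tree_cograph (graph_compl G)
| tree_cograph_iso G H : graph_iso G H -> tree_cograph G -> tree_cograph H.

Section Qu.
Variables (C : numClosedFieldType) (G : sgraph).

Definition adj (x y : G) : C := (edge x y)%:R.

(* u Adj(G) = Adj(G) u *)
Definition adj_commutes (A : starAlgType C) (u : G -> G -> A) : Prop :=
  forall x y, \sum_z adj z y *: u x z = \sum_z adj x z *: u z y.

Definition Qu_rel (A : starAlgType C) (f : G * G -> A) : Prop :=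
  let u x y := f (x, y) in magic u /\ adj_commutes u.

Definition Qu_alg : starAlgType C := universal (@Qu_rel).

Definition Qu_fund (x y : G) : Qu_alg := ugen (@Qu_rel) (x, y).

Definition Qu_comult : Qu_alg -> tens Qu_alg Qu_alg :=
  ulift (fun xy => coprod Qu_fund xy.1 xy.2).

Fact Qu_magic : magic Qu_fund.
Proof.
apply: magic_universal => A f Pf.
suff -> : (fun i j => ulift f (Qu_fund i j)) = fun i j => f (i, j).
  by case: Pf.
by apply: funext => i; apply: funext => j; rewrite ulift_gen.
Qed.

Fact Qu_adj : adj_commutes Qu_fund.
Proof.
move=> x y; apply: uext => A f Pf; have hf := ulift_morphism Pf.
rewrite !(sm_sum hf); case: (Pf) => _ /(_ x y) e.
transitivity (\sum_z adj z y *: f (x, z)).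
  by apply: eq_bigr => z _; rewrite (smZ hf) ulift_gen.
by rewrite e; apply: eq_bigr => z _; rewrite (smZ hf) ulift_gen.
Qed.

Fact Qu_generates : generates Qu_fund.
Proof. by move=> S hS Sp; apply: universal_ind => // -[i j]; apply: Sp. Qed.

Fact Qu_comult_rel : Qu_rel (fun xy => coprod Qu_fund xy.1 xy.2).
Proof.
split; first exact: magic_coprod Qu_magic.
move=> x y; rewrite /coprod /=.
transitivity (\sum_k Qu_fund x k ⊗ (\sum_z adj z y *: Qu_fund k z)).
  under eq_bigr do rewrite scaler_sumr.
  rewrite exchange_big; apply: eq_bigr => k _ /=; rewrite tpure_sumr.
  by apply: eq_bigr => z _; rewrite tpureZr.
transitivity (\sum_k Qu_fund x k ⊗ (\sum_z adj k z *: Qu_fund z y)).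
  by apply: eq_bigr => k _; congr (_ ⊗ _); apply: Qu_adj.
rewrite (eq_bigr _ (fun k _ => tpure_sumr _ _ _ _)) exchange_big /=.
transitivity (\sum_z (\sum_k adj k z *: Qu_fund x k) ⊗ Qu_fund z y).
  apply: eq_bigr => z _; rewrite tpure_suml.
  by apply: eq_bigr => k _; rewrite tpureZr tpureZ.
transitivity (\sum_z (\sum_k adj x k *: Qu_fund k z) ⊗ Qu_fund z y).
  by apply: eq_bigr => z _; congr (_ ⊗ _); apply: Qu_adj.
rewrite (eq_bigr _ (fun k _ => tpure_suml _ _ _ _)) exchange_big.
apply: eq_bigr => k _ /=; rewrite scaler_sumr.
by apply: eq_bigr => z _; rewrite tpureZ.
Qed.

Fact Qu_comult_morphism : star_morphism Qu_comult.
Proof. exact: ulift_morphism Qu_comult_rel. Qed.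

Fact Qu_comultE x y :
  Qu_comult (Qu_fund x y) = \sum_z Qu_fund x z ⊗ Qu_fund z y.
Proof. by rewrite /Qu_comult (ulift_gen Qu_comult_rel). Qed.

Definition Qu : qpgroup C :=
  QPGroup (vertex_gt0 G) Qu_magic Qu_generates Qu_comult_morphism Qu_comultE.

End Qu.

Section Families.
Variable C : numClosedFieldType.
Implicit Types F : qpgroup C -> Prop.

(* Isomorphic quantum permutation groups are identified: a family is closed
   under isomorphism. *)
Record free_wreath_stable F : Prop := FreeWreathStable {
  stable_iso : forall X Y, qiso X Y -> F X -> F Y;
  stable_trivial : F (trivial_qpg C);
  stable_free : forall X Y, F X -> F Y -> F (qfree X Y);
  stable_wreath : forall X n (n_gt0 : (0 < n)%N), F X -> F (qwreath X n_gt0)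
}.

Definition smallest_free_wreath_stable F : Prop :=
  free_wreath_stable F /\
  forall F', free_wreath_stable F' -> forall X, F X -> F' X.

Definition Qu_family (K : sgraph -> Prop) (X : qpgroup C) : Prop :=
  exists2 G, K G & qiso X (Qu C G).

End Families.

(* Main.v *)
Require Import Defs.
From HB Require Import structures.
From mathcomp Require Import all_boot all_order all_algebra reals.
From mathcomp Require Import complex.
From mathcomp Require Import boolp zify.

(* A magic matrix u intertwining two graphs preserves every relation definable
   from the adjacency by counting: u x z * u y w = 0 unless R x y = S z w.  In
   particular it preserves distances, connectedness, and the set of medians
   (vertices minimizing the sum of distances), which in a tree is a clique.
   By induction on the order, a nonzero u between two tree-cographs forces them
   to be isomorphic: a disconnected graph is split into its components, a graph
   with disconnected complement is complemented, and in the remaining case the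
   graph or its complement is a tree, which is disconnected by cutting it at its
   medians and recording the cut in vertex colours.  The components of a
   tree-cograph thus mix only within isomorphism classes, so its quantum
   automorphism group is a free product of wreath products by quantum symmetric
   groups of smaller ones.  Conversely, cutting a tree between its medians gives
   a rooted forest with the same quantum automorphism group; rooted forests are
   stable under disjoint unions and copies, and hanging one on an inner vertex
   of a long path turns it back into a tree without changing the group. *)

Set Implicit Arguments.
Unset Strict Implicit.
Unset Printing Implicit Defensive.

Import GRing.Theory Num.Theory.

(** * Magic unitaries over a corner *)

Local Open Scope ring_scope.

(** The entries of u do not commute, so a vertex has no image that could be followed. Only counts
    can be compared: inserting a row or column sum between two entries turns a count in one graph
    into a count in the other. Acyclicity is not of this kind and is replaced by a bound of one on
    the number of neighbours not farther from a base point. Between two components u is magic only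
    in a corner, so rigidity has to be stated for row sums p other than 1, with p != 0 as the only
    condition that survives the induction. Cutting a tree does not lower its order; it disconnects
    it, and the induction is applied to the parts. In the converse direction, a free product needs
    two trees whose vertices cannot mix even when the two quantum groups are isomorphic; a longer
    path makes one of them larger. *)

Section PartialMagic.
Variables (C : numClosedFieldType) (A : starAlgType C) (V W : finType).
Implicit Types (p : A) (u : V -> W -> A).

(* Rows and columns sum to p instead of 1, so that restricting u to a pair of
   blocks gives again such a matrix without passing to the corner algebra. *)
Record pmagic p u : Prop := PMagic {
  pm_row : forall x z z', u x z * u x z' = if z == z' then u x z else 0;
  pm_col : forall x x' z, u x z * u x' z = if x == x' then u x z else 0;
  pm_rsum : forall x, \sum_z u x z = p;
  pm_csum : forall z, \sum_x u x z = p
}.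

(* A magic matrix commutes with an adjacency matrix iff it preserves the edge
   relation in this sense (adj_commutesP); unlike commutation, this condition
   makes sense for arbitrary relations and is stable under counting. *)
Definition pres u (T : eqType) (R : V -> V -> T) (S : W -> W -> T) : Prop :=
  forall x y z w, R x y != S z w -> u x z * u y w = 0.

Definition vpres u (T : eqType) (a : V -> T) (b : W -> T) : Prop :=
  forall x z, a x != b z -> u x z = 0.

(** Positive integers are invertible in [C]. Comparisons of unequal counts end here. *)
Lemma natr_scale_eq0 n (a : A) : a *+ n = 0 -> (n == 0)%N || (a == 0).
Proof.
rewrite -[a *+ n](scaler_nat n a) => h.
case: eqVneq => //= n0; apply/eqP; rewrite -[a]scale1r.
by rewrite -(@mulVf C n%:R) ?pnatr_eq0 // -scalerA h scaler0.
Qed.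

Section Fixed.
Context {p : A} {u : V -> W -> A} (hu : pmagic p u).

Lemma pm_idem x z : u x z * u x z = u x z.
Proof. by rewrite (pm_row hu) eqxx. Qed.

Lemma pm_mulr x z : u x z * p = u x z.
Proof.
rewrite -(pm_rsum hu x) mulr_sumr (bigD1 z) //= pm_idem big1 ?addr0 // => t tz.
by rewrite (pm_row hu) eq_sym (negPf tz).
Qed.

Lemma pm_mull x z : p * u x z = u x z.
Proof.
rewrite -(pm_rsum hu x) mulr_suml (bigD1 z) //= pm_idem big1 ?addr0 // => t tz.
by rewrite (pm_row hu) (negPf tz).
Qed.

Lemma pm_sum_row x : u x =1 (fun=> 0) -> p = 0.
Proof. by move=> h; rewrite -(pm_rsum hu x) big1. Qed.

Lemma pm_card : p *+ #|V| = p *+ #|W|.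
Proof.
transitivity (\sum_x \sum_z u x z).
  under eq_bigr do rewrite (pm_rsum hu).
  by rewrite sumr_const.
rewrite exchange_big /=; under eq_bigr do rewrite (pm_csum hu).
by rewrite sumr_const.
Qed.

(** Summing all entries by rows and by columns gives [pm_card], and distinct integer multiples of a
    nonzero element differ. *)
Lemma pm_eq_card : p != 0 -> #|V| = #|W|.
Proof.
move=> p0; have e := pm_card.
wlog: / (#|V| <= #|W|)%N.
  case: (leqP #|V| #|W|) => [le ->//|lt _].
  have := natr_scale_eq0 (n := (#|V| - #|W|)%N) (a := p).
  rewrite mulrnBr ?(ltnW lt) // e subrr => /(_ erefl).
  by rewrite (negPf p0) orbF subn_eq0 leqNgt lt.
rewrite leq_eqVlt => /orP[/eqP //|lt].
have := natr_scale_eq0 (n := (#|W| - #|V|)%N) (a := p).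
rewrite mulrnBr ?(ltnW lt) // e subrr => /(_ erefl).
by rewrite (negPf p0) orbF subn_eq0 leqNgt lt.
Qed.

Lemma pres_eq : pres u (fun x y => x == y) (fun z w => z == w).
Proof.
move=> x y z w; case: (eqVneq x y) => [<-|xy].
  by case: (eqVneq z w) => // zw _; rewrite (pm_row hu) (negPf zw).
by case: (eqVneq z w) => // <- _; rewrite (pm_col hu) (negPf xy).
Qed.

(** The free choice of [g] covers degrees, existential quantifiers and sums of distances. The
    product [u x z * u y w], multiplied by either count, is the same sum of triple products: a row
    sum or a column sum of [u] is inserted between its factors. Distinct counts therefore make it
    vanish. *)
Lemma pres_count (T1 T2 : eqType) (R1 : V -> V -> T1) (S1 : W -> W -> T1)
    (R2 : V -> V -> T2) (S2 : W -> W -> T2) (g : T1 -> T2 -> nat) :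
  pres u R1 S1 -> pres u R2 S2 ->
  pres u (fun x y => \sum_v g (R1 x v) (R2 v y))%N
         (fun z w => \sum_v g (S1 z v) (S2 v w))%N.
Proof.
move=> h1 h2 x y z w ne.
have key : (u x z * u y w) *+ (\sum_v g (R1 x v) (R2 v y)) =
           (u x z * u y w) *+ (\sum_v g (S1 z v) (S2 v w)).
  transitivity (\sum_v \sum_t (u x z * u v t * u y w) *+ g (R1 x v) (R2 v y)).
    rewrite -sumrMnr; apply: eq_bigr => v _; rewrite sumrMnl; congr (_ *+ _).
    by rewrite -mulr_suml -mulr_sumr (pm_rsum hu) pm_mulr.
  (* A triple product survives only if [R1 x v = S1 z t] and [R2 v y = S2 t w], so the weights agree
     term by term. *)
  transitivity (\sum_v \sum_t (u x z * u v t * u y w) *+ g (S1 z t) (S2 t w)).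
    apply: eq_bigr => v _; apply: eq_bigr => t _.
    case: (eqVneq (R1 x v) (S1 z t)) => [->|/h1 ->]; last first.
      by rewrite mul0r !mul0rn.
    case: (eqVneq (R2 v y) (S2 t w)) => [->//|/h2 e].
    by rewrite -mulrA e mulr0 !mul0rn.
  rewrite exchange_big -sumrMnr; apply: eq_bigr => t _.
  rewrite sumrMnl; congr (_ *+ _).
  by rewrite -mulr_suml -mulr_sumr (pm_csum hu) pm_mulr.
move: ne key; set a := _ * _; set m := bigop _ _ _; set m' := bigop _ _ _.
move: m m' => m n.
wlog lt : m n / (m < n)%N.
  move=> H; rewrite neq_ltn => /orP[lt|lt] e.
    by apply: (H m n lt _ e); rewrite neq_ltn lt.
  by apply: (H n m lt) => //; rewrite neq_ltn lt.
move=> _ e; have := natr_scale_eq0 (n := (n - m)%N) (a := a).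
rewrite mulrnBr ?(ltnW lt) // e subrr => /(_ erefl).
by rewrite subn_eq0 leqNgt lt /= => /eqP.
Qed.

(** If [S] never took the value [R x y], all products between the rows of [x] and [y] would vanish,
    and so would their sum [p * p = p]. This carries universal statements from one graph to the
    other. *)
Lemma pres_value_l (T : eqType) (R : V -> V -> T) S x y :
  p != 0 -> pres u R S -> exists z w, R x y = S z w.
Proof.
move=> p0 h; apply: contrapT => no; case/eqP: p0.
have -> : p = p * p.
  rewrite -{1}(pm_rsum hu x) -{1}(pm_rsum hu x) mulr_suml.
  by apply: eq_bigr => z _; rewrite pm_mulr.
rewrite -{1}(pm_rsum hu x) -(pm_rsum hu y) mulr_suml big1 // => z _.
rewrite mulr_sumr big1 // => w _; apply: h; apply/eqP => e.
by apply: no; exists z, w.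
Qed.

Lemma pres_value_r (T : eqType) (R : V -> V -> T) S z w :
  p != 0 -> pres u R S -> exists x y, R x y = S z w.
Proof.
move=> p0 h; apply: contrapT => no; case/eqP: p0.
have -> : p = p * p.
  rewrite -{1}(pm_csum hu z) -{1}(pm_csum hu z) mulr_suml.
  by apply: eq_bigr => x _; rewrite pm_mulr.
rewrite -{1}(pm_csum hu z) -(pm_csum hu w) mulr_suml big1 // => x _.
rewrite mulr_sumr big1 // => y _; apply: h; apply/eqP => e.
by apply: no; exists x, y.
Qed.

Lemma pm_entry_neq0 x : p != 0 -> exists z, u x z != 0.
Proof.
move=> p0; apply: contrapT => no; case/eqP: p0.
apply: (@pm_sum_row x) => z; apply/eqP/negPn/negP => h.
by apply: no; exists z.
Qed.

Lemma pres_vpres (T : eqType) (a : V -> T) (b : W -> T) :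
  pres u (fun x _ => a x) (fun z _ => b z) -> vpres u a b.
Proof. by move=> h x z ne; rewrite -pm_idem h. Qed.

End Fixed.

Lemma pres_map (T1 T2 T : eqType) (f : T1 -> T2 -> T) u
    (R1 : V -> V -> T1) S1 (R2 : V -> V -> T2) S2 :
  pres u R1 S1 -> pres u R2 S2 ->
  pres u (fun x y => f (R1 x y) (R2 x y)) (fun z w => f (S1 z w) (S2 z w)).
Proof.
move=> h1 h2 x y z w ne.
case: (eqVneq (R1 x y) (S1 z w)) => [e1|/h1//].
case: (eqVneq (R2 x y) (S2 z w)) => [e2|/h2//].
by rewrite e1 e2 eqxx in ne.
Qed.

Lemma pres_map1 (T1 T : eqType) (f : T1 -> T) u (R1 : V -> V -> T1) S1 :
  pres u R1 S1 -> pres u (fun x y => f (R1 x y)) (fun z w => f (S1 z w)).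
Proof. by move=> h; exact: (@pres_map _ _ _ (fun a _ =>
  f a) _ _ _ _ _ h h). Qed.

Lemma pres_const u (T : eqType) (c : T) : pres u (fun _ _ => c) (fun _ _ => c).
Proof. by move=> x y z w; rewrite eqxx. Qed.

Lemma vpres_l u (T : eqType) (a : V -> T) b :
  vpres u a b -> pres u (fun x _ => a x) (fun z _ => b z).
Proof. by move=> h x y z w ne; rewrite h ?mul0r. Qed.

Lemma vpres_r u (T : eqType) (a : V -> T) b :
  vpres u a b -> pres u (fun _ y => a y) (fun _ w => b w).
Proof. by move=> h x y z w ne; rewrite (h y) ?mulr0. Qed.

Lemma vpres_map (T1 T2 T : eqType) (f : T1 -> T2 -> T) u
    (a1 : V -> T1) b1 (a2 : V -> T2) b2 :
  vpres u a1 b1 -> vpres u a2 b2 ->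
  vpres u (fun x => f (a1 x) (a2 x)) (fun z => f (b1 z) (b2 z)).
Proof.
move=> h1 h2 x z ne.
case: (eqVneq (a1 x) (b1 z)) => [e1|/h1//].
case: (eqVneq (a2 x) (b2 z)) => [e2|/h2//].
by rewrite e1 e2 eqxx in ne.
Qed.

Lemma vpres_map1 (T1 T : eqType) (f : T1 -> T) u (a : V -> T1) b :
  vpres u a b -> vpres u (fun x => f (a x)) (fun z => f (b z)).
Proof. by move=> h; exact: (@vpres_map _ _ _ (fun a _ =>
  f a) _ _ _ _ _ h h). Qed.

Lemma vpres_count p u (T1 T2 : eqType) (R : V -> V -> T1) S
    (a : V -> T2) b (g : T1 -> T2 -> nat) :
  pmagic p u -> pres u R S -> vpres u a b ->
  vpres u (fun x => \sum_v g (R x v) (a v))%N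
          (fun z => \sum_v g (S z v) (b v))%N.
Proof.
move=> hu h1 h2; apply: (pres_vpres hu).
exact: (pres_count hu h1 (vpres_l h2)).
Qed.

End PartialMagic.

Arguments pres_count {C A V W p u} hu {T1 T2 R1 S1 R2 S2} g.
Arguments pres_map {C A V W T1 T2 T} f {u R1 S1 R2 S2}.
Arguments pres_map1 {C A V W T1 T} f {u R1 S1}.
Arguments pres_const {C A V W} u {T} c.
Arguments vpres_map {C A V W T1 T2 T} f {u a1 b1 a2 b2}.
Arguments vpres_count {C A V W p u T1 T2 R S a b} g.
Arguments vpres_map1 {C A V W T1 T} f {u a b}.

Section MagicPartial.
Variables (C : numClosedFieldType) (A : starAlgType C) (V : finType).

Lemma magic_pmagic (u : V -> V -> A) : magic u -> pmagic 1 u.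
Proof.
move=> [us ui ur uc uro uco]; split=> [x z z'|x x' z|//|//].
  by case: eqVneq => [<-|/uro].
by case: eqVneq => [<-|/uco].
Qed.

Lemma pmagic_magic (u : V -> V -> A) :
  (forall x y, star (u x y) = u x y) -> pmagic 1 u -> magic u.
Proof.
move=> us hu; split=> // [x y|x|x|x y z ne|x y z ne].
- exact: pm_idem hu x y.
- exact: pm_rsum hu x.
- exact: pm_csum hu x.
- by rewrite (pm_row hu) (negPf ne).
- by rewrite (pm_col hu) (negPf ne).
Qed.

End MagicPartial.

(** * Quantum permutation groups representing coloured graphs *)

Section Morphisms.
Variable C : numClosedFieldType.
Implicit Types A B D : starAlgType C.

Lemma star_morphism_id A : star_morphism (@id A).
Proof. exact: mk_star_morphism. Qed.

Lemma star_morphism_inv A B (f : A -> B) g :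
  star_morphism f -> cancel f g -> cancel g f -> star_morphism g.
Proof.
move=> hf fK gK; have fI := can_inj fK.
apply: mk_star_morphism => [a b|c a|a b||a]; apply: fI; rewrite !gK.
- by rewrite (smD hf) !gK.
- by rewrite (smZ hf) gK.
- by rewrite (smM hf) !gK.
- by rewrite (sm1 hf).
- by rewrite (smS hf) gK.
Qed.

Lemma generates_ext A B (I : Type) (v : I -> I -> A) (f g : A -> B) :
  star_morphism f -> star_morphism g -> generates v ->
  (forall i j, f (v i j) = g (v i j)) -> f =1 g.
Proof.
move=> hf hg gen e; apply: gen => //; split=> [|c a b|a b|a].
- by rewrite (sm1 hf) (sm1 hg).
- by rewrite (smD hf) (smD hg) (smZ hf) (smZ hg) => -> ->.
- by rewrite (smM hf) (smM hg) => -> ->.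
- by rewrite (smS hf) (smS hg) => ->.
Qed.

Lemma tens_sum A B (x : tens A B) :
  x = \sum_(z <- repr x) z.1 ⊗ z.2.
Proof.
apply: text => G b hb; rewrite {1}/tlift.
elim: (repr x) => [|z s IHs].
  by rewrite big_nil /bieval big_nil; rewrite [RHS](tlift0 hb).
rewrite /bieval !big_cons [RHS](tliftD hb) (tlift_pure _ _ hb).
by congr (_ + _); rewrite -IHs.
Qed.

Lemma tens_ext A B D (f g : tens A B -> D) :
  star_morphism f -> star_morphism g ->
  (forall a b, f (a ⊗ b) = g (a ⊗ b)) -> f =1 g.
Proof.
move=> hf hg e x; rewrite (tens_sum x) (sm_sum hf) (sm_sum hg).
by apply: eq_bigr.
Qed.

Lemma qiso_sym (X Y : qpgroup C) : qiso X Y -> qiso Y X.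
Proof.
move=> [f [hf [g fK gK] hc]]; have hg := star_morphism_inv hf fK gK.
exists g; split=> // [|b]; first by exists f.
rewrite -{2}(gK b) hc.
have /(_ (qcomult (g b))) /= -> // : tens_map g g \o tens_map f f =1 id.
apply: tens_ext; last by move=> a a'; rewrite /= !tens_map_pure // !fK.
  by apply: star_morphism_comp; apply: tens_map_morphism.
exact: star_morphism_id.
Qed.

Lemma qiso_trans (X Y Z : qpgroup C) : qiso X Y -> qiso Y Z -> qiso X Z.
Proof.
move=> [f [hf bf fc]] [g [hg bg gc]]; exists (g \o f); split.
- exact: star_morphism_comp.
- exact: bij_comp.
have h := star_morphism_comp hg hf.
move=> a; rewrite /= gc fc.
have /(_ (qcomult a)) /= -> // : tens_map g g \o tens_map f f =1 tens_map (g \o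
  f) (g \o f).
apply: tens_ext; last by move=> b b'; rewrite /= !tens_map_pure.
  by apply: star_morphism_comp; apply: tens_map_morphism.
exact: tens_map_morphism.
Qed.

End Morphisms.

(* Colours are sequences so that a vertex flag can be recorded by prepending. *)
Record cgraph := CGraph {
  cvert :> finType;
  cedge : rel cvert;
  ccol : cvert -> seq nat
}.

Definition cpres (C : numClosedFieldType) (A : starAlgType C) (G H : cgraph)
    (u : G -> H -> A) : Prop :=
  pres u (@cedge G) (@cedge H) /\ vpres u (@ccol G) (@ccol H).

Section IsQ.
Variable C : numClosedFieldType.
Implicit Types (X Y : qpgroup C) (G H : cgraph).

(* X is the quantum automorphism group of G up to isomorphism.  Stating this by
   a universal property, for an arbitrary generating family v, avoids building
   a quantum permutation group for every coloured graph met on the way. *)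
Definition is_Q X G : Prop := exists v : G -> G -> qalg X,
  [/\ magic v, cpres v, generates v,
      forall x y, qcomult (v x y) = coprod v x y
    & forall (A : starAlgType C) (u : G -> G -> A), magic u -> cpres u ->
      exists2 f : qalg X -> A, star_morphism f & forall x y, f (v x y) = u x y].

Lemma is_Q_unique X Y G : is_Q X G -> is_Q Y G -> qiso X Y.
Proof.
move=> [v [vm vp vg vc vu]] [w [wm wp wg wc wu]].
have [f hf fv] := vu _ w wm wp; have [g hg gw] := wu _ v vm vp.
exists f; split=> //.
  exists g.
    apply: (generates_ext (star_morphism_comp hg hf) (star_morphism_id _) vg).
    by move=> x y; rewrite /= fv gw.
  apply: (generates_ext (star_morphism_comp hf hg) (star_morphism_id _) wg).
  by move=> x y; rewrite /= gw fv.
have hff := tens_map_morphism hf hf.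
apply: (generates_ext (star_morphism_comp (qcomult_morphism Y) hf)
         (star_morphism_comp hff (qcomult_morphism X)) vg) => x y /=.
rewrite fv vc wc (sm_sum hff); apply: eq_bigr => k _.
by rewrite tens_map_pure // !fv.
Qed.

Lemma is_Q_qiso X Y G : qiso X Y -> is_Q X G -> is_Q Y G.
Proof.
move=> [f [hf [g fK gK] fc]] [v [vm vp vg vc vu]].
have hg := star_morphism_inv hf fK gK.
exists (fun x y => f (v x y)); split.
- exact: magic_morphism.
- split=> [x y z w ne|x z ne].
    by rewrite -(smM hf) (proj1 vp _ _ _ _ ne) (sm0 hf).
  by rewrite (proj2 vp _ _ ne) (sm0 hf).
- move=> S hS Sv b; rewrite -(gK b).
  exact: (vg _ (subalg_preim hS hf) Sv).
- move=> x y; rewrite fc vc (sm_sum (tens_map_morphism hf hf)).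
  by apply: eq_bigr => k _; rewrite tens_map_pure.
- move=> A u um up; have [h hh hv] := vu A u um up.
  exists (h \o g); first exact: star_morphism_comp.
  by move=> x y; rewrite /= fK hv.
Qed.

(** The universal property sees a graph only through the magic matrices that preserve it.
    Complements, cuts at medians and added flags are handled this way. *)
Lemma is_Q_equiv X (V : finType) e c e' c' :
  (forall (A : starAlgType C) (u : V -> V -> A), magic u ->
     @cpres C A (CGraph e c) (CGraph e c) u <->
     @cpres C A (CGraph e' c') (CGraph e' c') u) ->
  is_Q X (CGraph e c) -> is_Q X (CGraph e' c').
Proof.
move=> h [v [vm vp vg vc vu]]; exists v; split=> //; first exact/h.
by move=> A u um up; apply: vu => //; apply/h.
Qed.

Definition ciso G H : Prop := exists f : G -> H,
  [/\ bijective f, {mono f : x y / cedge x y}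
    & forall x, ccol (f x) = ccol x].

Lemma ciso_sym G H : ciso G H -> ciso H G.
Proof.
move=> [f [[g fK gK] fe fc]]; exists g; split; first by exists f.
  by move=> x y; rewrite -fe !gK.
by move=> x; rewrite -fc gK.
Qed.

Lemma ciso_trans G H K : ciso G H -> ciso H K -> ciso G K.
Proof.
move=> [f [fb fe fc]] [g [gb ge gc]]; exists (g \o f).
split=> [|x y|x] /=; first exact: bij_comp.
  by rewrite ge fe.
by rewrite gc fc.
Qed.

Lemma ciso_refl G : ciso G G.
Proof. by exists id; split=> //; exists id. Qed.

Lemma magic_reindex (A : starAlgType C) (V W : finType) (f : V -> W)
    (u : W -> W -> A) :
  bijective f -> magic u -> magic (fun x y => u (f x) (f y)).
Proof.
move=> fb [us ui ur uc uro uco].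
have onb : {on predT, bijective f} by apply: onW_bij.
split=> // [x|x|x y z ne|x y z ne].
- by rewrite -(ur (f x)) [RHS](reindex f).
- by rewrite -(uc (f x)) [RHS](reindex f).
- by rewrite uro // (bij_eq fb).
- by rewrite uco // (bij_eq fb).
Qed.

Lemma is_Q_ciso X G H : ciso G H -> is_Q X G -> is_Q X H.
Proof.
move=> [f [fb fe fc]] [v [vm vp vg vc vu]]; case: (fb) => g fK gK.
have gb : bijective g by exists f.
have onb : {on predT, bijective g} by apply: onW_bij.
have ge : {mono g : x y / cedge x y} by move=> x y; rewrite -fe !gK.
have gc x : ccol (g x) = ccol x by rewrite -fc gK.
exists (fun x y => v (g x) (g y)); split.
- exact: magic_reindex.
- split=> [x y z w ne|x z ne]; first by apply: (proj1 vp); rewrite !ge.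
  by apply: (proj2 vp); rewrite !gc.
- move=> S hS Sv; apply: vg => // x y; rewrite -(fK x) -(fK y); exact: Sv.
- by move=> x y; rewrite vc /coprod (reindex g).
- move=> A u um up.
  have [||h hh hv] := vu A (fun x y => u (f x) (f y)).
  + exact: magic_reindex.
  + split=> [x y z w ne|x z ne]; first by apply: (proj1 up); rewrite !fe.
    by apply: (proj2 up); rewrite !fc.
  by exists h => // x y; rewrite hv !gK.
Qed.

Lemma is_Q_trivial G : #|G| = 1%N -> is_Q (trivial_qpg C) G.
Proof.
move=> G1; have /card_gt0P[x0 _] : (0 < #|G|)%N by rewrite G1.
have G1' x : x = x0.
  by have /eqP := G1; rewrite eqn_leq => /andP[/card_le1_eqP/(_ x x0 isT isT)].
have sum1 (A : starAlgType C) (F : G -> A) : \sum_x F x = F x0.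
  by rewrite (big_pred1 x0) // => x; rewrite (G1' x) /= eqxx.
exists (fun _ _ => (1 : C^o)); split.
- split=> [||x|x|x y z|x y z]; rewrite ?sum1 //.
  + by move=> _ _; exact: conjC1.
  + by move=> _ _; rewrite mulr1.
  + by rewrite (G1' y) (G1' z) eqxx.
  + by rewrite (G1' y) (G1' z) eqxx.
- split=> [x y z w|x z]; first by rewrite (G1' x) (G1' y) (G1' z) (G1' w) eqxx.
  by rewrite (G1' x) (G1' z) eqxx.
- by move=> S hS Sv; apply: (trivial_generates hS) => i j; exact: (Sv x0 x0).
- by move=> x y; rewrite /coprod sum1.
- move=> A u um _; have u1 : u x0 x0 = 1 by rewrite -[RHS](magic_row um x0)
    sum1.
  exists (fun c : C^o => c *: (1 : A)); last first.
    by move=> x y; rewrite (G1' x) (G1' y) u1 scale1r.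
  apply: mk_star_morphism => [a b|a b|a b||a].
  + by rewrite scalerDl.
  + by rewrite scalerA.
  + by rewrite -sscalerAl mul1r scalerA.
  + by rewrite scale1r.
  + by rewrite starZ star1.
Qed.

End IsQ.

Definition cgraph_of (G : sgraph) : cgraph :=
  CGraph (@edge G) (fun _ => [::]).

Section QuIsQ.
Variables (C : numClosedFieldType) (G : sgraph).

Lemma adj_commutesP (A : starAlgType C) (u : G -> G -> A) : magic u ->
  adj_commutes u <-> pres u (@edge G) (@edge G).
Proof.
move=> um; have hu := magic_pmagic um; split=> [h x y z w ne|h x w].
  (* Multiplied by [u x z] on the left and [u y w] on the right, each side of the commutation
     relation keeps one term, with coefficient [adj z w] and [adj x y] respectively. *)
  have /(congr1 (fun a => u x z * a * u y w)) := h x w.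
  rewrite mulr_sumr mulr_sumr !mulr_suml (bigD1 z) //= big1 => [|t tz];
    last first.
    by rewrite -sscalerAr (pm_row hu) eq_sym (negPf tz) scaler0 mul0r.
  rewrite addr0 (bigD1 y) //= big1 => [|t ty]; last first.
    by rewrite -sscalerAr -sscalerAl -mulrA (pm_col hu) (negPf ty) mulr0
      scaler0.
  rewrite addr0 -!sscalerAr -!sscalerAl (pm_idem hu) -mulrA (pm_idem hu) /adj.
  by move: ne; do 2!case: edge; rewrite ?scale1r ?scale0r.
(* Insert the column sum of [w], exchange the coefficients by preservation, then remove the row sum
   of [x]. *)
transitivity (\sum_t \sum_s adj C t w *: (u x t * u s w)).
  apply: eq_bigr => t _.
  by rewrite -scaler_sumr -mulr_sumr (pm_csum hu) mulr1.
transitivity (\sum_t \sum_s adj C x s *: (u x t * u s w)).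
  apply: eq_bigr => t _; apply: eq_bigr => s _; rewrite /adj.
  by case: (eqVneq (edge x s) (edge t w)) => [->//|/h ->]; rewrite !scaler0.
rewrite exchange_big; apply: eq_bigr => s _.
by rewrite -scaler_sumr -mulr_suml (pm_rsum hu) mul1r.
Qed.

Lemma is_Q_Qu : is_Q (Qu C G) (cgraph_of G).
Proof.
exists (@Qu_fund C G); split.
- exact: Qu_magic.
- split=> [|x y]; last by rewrite eqxx.
  by apply/adj_commutesP; [exact: Qu_magic | exact: Qu_adj].
- exact: Qu_generates.
- by move=> x y; exact: Qu_comultE.
- move=> A u um [ue _].
  have Pf : Qu_rel (fun xy => u xy.1 xy.2) by split=> //; apply/adj_commutesP.
  by exists (ulift (fun xy => u xy.1 xy.2));
    [exact: ulift_morphism | move=> x y; rewrite ulift_gen].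
Qed.

End QuIsQ.

(** * Free products and disjoint unions *)

Section Sum.
Variables G H : cgraph.

Definition cadd_edge : rel (G + H)%type := fun x y =>
  match x, y with
  | inl x, inl y => cedge x y
  | inr x, inr y => cedge x y
  | _, _ => false
  end.

Definition cadd_col (x : G + H) : seq nat :=
  match x with inl x => ccol x | inr x => ccol x end.

Definition cadd : cgraph := CGraph cadd_edge cadd_col.

End Sum.

Section Diag.
Variables (C : numClosedFieldType) (A : starAlgType C) (V W : finType).
Variables (u : V -> V -> A) (v : W -> W -> A).

Definition diagu (x y : V + W) : A :=
  match x, y with
  | inl x, inl y => u x y
  | inr x, inr y => v x y
  | _, _ => 0
  end.

Lemma diagu_magic : magic u -> magic v -> magic diagu.
Proof.
move=> [ps pi pr pc pro pco] [qs qi qr qc qro qco]; split.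
- by move=> [i|i] [j|j] /=; rewrite ?ps ?qs ?star0.
- by move=> [i|i] [j|j] /=; rewrite ?pi ?qi ?mulr0.
- by move=> [i|i]; rewrite big_sumType /= ?pr ?qr big1 ?addr0 ?add0r.
- by move=> [i|i]; rewrite big_sumType /= ?pc ?qc big1 ?addr0 ?add0r.
- by move=> [i|i] [j|j] [k|k] jk /=; rewrite ?mulr0 ?mul0r ?pro ?qro.
- by move=> [i|i] [j|j] [k|k] jk /=; rewrite ?mulr0 ?mul0r ?pco ?qco.
Qed.

End Diag.

Section SumRestrict.
Variables (C : numClosedFieldType) (A : starAlgType C) (V W : finType).
Variable (u : V + W -> V + W -> A).
Hypotheses (um : magic u)
  (nomix : forall x y, u (inl x) (inr y) = 0 /\ u (inr y) (inl x) = 0).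

Lemma magic_inl : magic (fun x y => u (inl x) (inl y)).
Proof.
case: um => us ui ur uc uro uco.
split=> [x y|x y|x|x|x y z ne|x y z ne].
- by rewrite us.
- by rewrite ui.
- rewrite -(ur (inl x)) big_sumType /= [X in _ + X]big1 ?addr0 // => y _.
  by case: (nomix x y).
- rewrite -(uc (inl x)) big_sumType /= [X in _ + X]big1 ?addr0 // => y _.
  by case: (nomix x y).
- exact: uro.
- exact: uco.
Qed.

Lemma magic_inr : magic (fun x y => u (inr x) (inr y)).
Proof.
case: um => us ui ur uc uro uco.
split=> [x y|x y|x|x|x y z ne|x y z ne].
- by rewrite us.
- by rewrite ui.
- rewrite -(ur (inr x)) big_sumType /= [X in X + _]big1 ?add0r // => y _.
  by case: (nomix y x).
- rewrite -(uc (inr x)) big_sumType /= [X in X + _]big1 ?add0r // => y _.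
  by case: (nomix y x).
- exact: uro.
- exact: uco.
Qed.

End SumRestrict.

Section FreeIsQ.
Variables (C : numClosedFieldType) (X Y : qpgroup C) (G H : cgraph).

Lemma diagu_cpres (A : starAlgType C) (u : G -> G -> A) (v : H -> H -> A) :
  @cpres C A G G u -> @cpres C A H H v ->
  @cpres C A (cadd G H) (cadd G H) (diagu u v).
Proof.
move=> [ue uc] [ve vc]; split.
  move=> [x|x] [y|y] [z|z] [w|w] //=; rewrite ?mul0r ?mulr0 //.
    exact: ue.
  exact: ve.
by move=> [x|x] [y|y] //=; [exact: uc | exact: vc].
Qed.

(** Without mixing, a magic matrix on the disjoint union is block diagonal, that is, a pair of
    unrelated magic matrices, which is what a morphism out of the free product encodes. *)
Lemma is_Q_free :
  (forall (A : starAlgType C) (u : G + H -> G + H -> A), magic u ->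
     @cpres C A (cadd G H) (cadd G H) u ->
     forall x y, u (inl x) (inr y) = 0 /\ u (inr y) (inl x) = 0) ->
  is_Q X G -> is_Q Y H -> is_Q (qfree X Y) (cadd G H).
Proof.
move=> nomix [v [vm vp vg vc vu]] [w [wm wp wg wc wu]].
have hl := free_inl_morphism (qalg X) (qalg Y).
have hr := free_inr_morphism (qalg X) (qalg Y).
pose v' x y := free_inl (qalg Y) (v x y).
pose w' x y := free_inr (qalg X) (w x y).
have hcomp (B D : starAlgType C) (f : B -> D) (K : cgraph) (u : K -> K -> B) :
    star_morphism f -> cpres u -> @cpres C D K K (fun x y => f (u x y)).
  move=> hf [ue uc]; split=> [x y z t ne|x z ne].
    by rewrite -(smM hf) ue ?(sm0 hf).
  by rewrite uc ?(sm0 hf).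
exists (diagu v' w'); split.
- by apply: diagu_magic; apply: magic_morphism.
- by apply: diagu_cpres; apply: hcomp.
- move=> S hS Sp; apply: universal_ind => // -[a|b].
    apply: (vg _ (subalg_preim hS hl)) => i j.
    exact: (Sp (inl i) (inl j)).
  apply: (wg _ (subalg_preim hS hr)) => i j.
  exact: (Sp (inr i) (inr j)).
- have hc := @qfree_comult_morphism C X Y.
  rewrite /coprod => -[x|x] [y|y] /=; rewrite big_sumType /=.
  + rewrite [X in _ + X]big1 ?addr0 => [|k _]; last by rewrite tpure0l.
    rewrite /qfree_comult (ulift_gen (qfree_comult_rel X Y)) /= vc.
    rewrite (sm_sum (tens_map_morphism hl hl)).
    by apply: eq_bigr => k _; rewrite (tens_map_pure hl hl).
  + rewrite (sm0 hc) !big1 ?addr0 // => k _; first by rewrite tpure0l.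
    by rewrite tpure0r.
  + rewrite (sm0 hc) !big1 ?addr0 // => k _; first by rewrite tpure0r.
    by rewrite tpure0l.
  + rewrite [X in X + _]big1 ?add0r => [|k _]; last by rewrite tpure0l.
    rewrite /qfree_comult (ulift_gen (qfree_comult_rel X Y)) /= wc.
    rewrite (sm_sum (tens_map_morphism hr hr)).
    by apply: eq_bigr => k _; rewrite (tens_map_pure hr hr).
- move=> A u um up; have no := nomix A u um up.
  have [|f hf fv] := vu A _ (magic_inl um no).
    split=> [x y z t ne|x z ne].
      exact: (proj1 up (inl x) (inl y) (inl z) (inl t)).
    exact: (proj2 up (inl x) (inl z)).
  have [|g hg gw] := wu A _ (magic_inr um no).
    split=> [x y z t ne|x z ne].
      exact: (proj1 up (inr x) (inr y) (inr z) (inr t)).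
    exact: (proj2 up (inr x) (inr z)).
  pose F (z : qalg X + qalg Y) := match z with inl a => f a | inr b => g b end.
  have Frel : free_prod_rel F by [].
  exists (ulift F); first exact: ulift_morphism.
  move=> [x|x] [y|y] /=; rewrite ?(ulift_gen Frel) /= ?fv ?gw //.
    by rewrite (sm0 (ulift_morphism Frel)); case: (no x y).
  by rewrite (sm0 (ulift_morphism Frel)); case: (no y x).
Qed.

(** Rigid extra vertices only add the scalar entries 0 and 1, so the same algebra, still generated,
    has the universal property for the larger graph. *)
Lemma is_Q_fixed (W : finType) (e : rel (G + W)) (c : G + W -> seq nat) :
  let K := CGraph e c in
  (forall (A : starAlgType C) (u : G + W -> G + W -> A), magic u ->
     @cpres C A K K u ->
     (forall i j, u (inr i) (inr j) = (i == j)%:R) /\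
     @cpres C A G G (fun x y => u (inl x) (inl y))) ->
  (forall (A : starAlgType C) (u : G -> G -> A), magic u -> @cpres C A G G u ->
     @cpres C A K K (diagu u (fun i j => (i == j)%:R))) ->
  is_Q X G -> is_Q X K.
Proof.
move=> K hfix hext [v [vm vp vg vc vu]].
have dm (B : starAlgType C) : magic (fun i j : W => (i == j)%:R : B).
  have s1 (F : W -> B) i : \sum_j (i == j)%:R * F j = F i.
    rewrite (bigD1 i) //= eqxx mul1r big1 ?addr0 // => j ji.
    by rewrite eq_sym (negPf ji) mul0r.
  split=> [i j|i j|i|i|i j k jk|i j k jk].
  - by case: eqP; rewrite ?star1 ?star0.
  - by rewrite -natrM mulnb andbb.
  - by rewrite -[RHS](s1 (fun=> 1) i); apply: eq_bigr => j _; rewrite mulr1.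
  - rewrite -[RHS](s1 (fun=> 1) i); apply: eq_bigr => j _.
    by rewrite eq_sym mulr1.
  - rewrite -natrM mulnb; case: eqP => [->|_ //]; by rewrite (negPf jk).
  - rewrite -natrM mulnb; case: (eqVneq k i) jk => [->|_ _];
      last by rewrite andbF.
    by move/negPf ->.
exists (diagu v (fun i j => (i == j)%:R)); split.
- exact: diagu_magic.
- exact: hext.
- by move=> S hS Sv; apply: vg => // x y; exact: (Sv (inl x) (inl y)).
- have hc := qcomult_morphism X.
  rewrite /coprod => -[x|x] [y|y] /=; rewrite big_sumType /=.
  + by rewrite [X in _ + X]big1 ?addr0 ?vc // => k _; rewrite tpure0l.
  + rewrite (sm0 hc) !big1 ?addr0 // => k _; first by rewrite tpure0l.
    by rewrite tpure0r.
  + rewrite (sm0 hc) !big1 ?addr0 // => k _; first by rewrite tpure0r.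
    by rewrite tpure0l.
  + rewrite [X in X + _]big1 ?add0r => [|k _]; last by rewrite tpure0l.
    rewrite (bigD1 x) //= eqxx big1 ?addr0 => [|k]; last first.
      by rewrite eq_sym => /negPf ->; rewrite tpure0l.
    case: eqP => _; rewrite ?(sm1 hc) ?(sm0 hc) //.
    by rewrite tpure0r.
- move=> A u um up; have [f1 f2] := hfix A u um up.
  have u1 i : u (inr i) (inr i) = 1 by rewrite f1 eqxx.
  (* By orthogonality, a diagonal entry 1 annihilates the rest of its row and column. *)
  have z1 i (y : G) : u (inr i) (inl y) = 0.
    by rewrite -[LHS]mul1r -(u1 i) (magic_row_orth um).
  have z2 i (y : G) : u (inl y) (inr i) = 0.
    by rewrite -[LHS]mul1r -(u1 i) (magic_col_orth um).
  have [|f hf fv] := vu A _ (magic_inl um (fun x y =>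
    conj (z2 y x) (z1 y x))) => //.
  exists f => // -[x|x] [y|y] //=; rewrite ?z1 ?z2 ?(sm0 hf) // f1.
  by case: eqP; rewrite ?(sm1 hf) ?(sm0 hf).
Qed.

End FreeIsQ.

(** * Wreath products and disjoint copies *)

Definition ccopies (n : nat) (G : cgraph) : cgraph :=
  @CGraph ('I_n * G)%type
    (fun x y => (x.1 == y.1) && cedge x.2 y.2) (fun x => ccol x.2).

(** The projections [q i] remove the cross terms of a product. The comultiplication on one copy of
    the algebra in a wreath product has this shape. *)
Lemma star_morphism_partition (C : numClosedFieldType) (B D : starAlgType C)
    (I : finType) (f : I -> B -> D) (q : I -> D) :
  (forall i, star_morphism (f i)) ->
  (forall i, star (q i) = q i) -> (forall i, q i * q i = q i) ->
  (forall i j, i != j -> q i * q j = 0) -> \sum_i q i = 1 ->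
  (forall i b, f i b * q i = q i * f i b) ->
  star_morphism (fun b => \sum_i f i b * q i).
Proof.
move=> hf qs qi qo q1 qc; apply: mk_star_morphism => [a b|c a|a b||a].
- rewrite -big_split; apply: eq_bigr => i _.
  by rewrite (smD (hf i)) mulrDl.
- rewrite scaler_sumr; apply: eq_bigr => i _.
  by rewrite (smZ (hf i)) sscalerAl.
- rewrite mulr_suml; apply: eq_bigr => i _; rewrite mulr_sumr.
  rewrite (bigD1 i) //= big1 => [|j ji].
    rewrite (smM (hf i)) addr0 -!mulrA; congr (_ * _).
    by rewrite [RHS]mulrA -qc -mulrA qi.
  by rewrite qc -mulrA (mulrA (q i)) -(qc i) (qc j) -!mulrA (mulrA (q i))
     qo 1?eq_sym // mul0r mulr0.
- by rewrite -[RHS]q1; apply: eq_bigr => i _; rewrite (sm1 (hf i)) mul1r.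
- rewrite star_sum; apply: eq_bigr => i _.
  by rewrite starM qs -(smS (hf i)) qc.
Qed.

Section Wreath.
Variables (C : numClosedFieldType) (n : nat).
Hypothesis n_gt0 : (0 < n)%N.

Section WreathMagic.
Variables (A : starAlgType C) (G : cgraph).
Variables (w : 'I_n -> G -> G -> A) (p : 'I_n -> 'I_n -> A).
Hypotheses (wm : forall i, magic (w i)) (pm : magic p).
Hypothesis wp : forall i j k l, w i k l * p i j = p i j * w i k l.

Let wr (x y : 'I_n * G) := w x.1 x.2 y.2 * p x.1 y.1.

Let wrM i k j l i' k' j' l' : wr (i, k) (j, l) * wr (i', k') (j', l') =
  w i k l * (p i j * p i' j') * w i' k' l'.
Proof. by rewrite /wr /= (wp i' j') !mulrA. Qed.

Lemma wreath_magic : magic wr.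
Proof.
have hw i := magic_pmagic (wm i); have hp := magic_pmagic pm.
apply: pmagic_magic => [[i k] [j l]|].
  by rewrite /wr starM (magic_star pm) (magic_star (wm i)) wp.
split=> [[i k] [j l] [j' l']|[i k] [i' k'] [j l]|[i k]|[j l]].
- rewrite wrM (pm_row hp) xpair_eqE; case: eqP => [_|];
    last by rewrite mulr0 mul0r.
  rewrite wp -mulrA (pm_row (hw i)) /wr /=; case: eqP; rewrite ?mulr0 //.
- rewrite wrM (pm_col hp) xpair_eqE; case: eqP => [<-|];
    last by rewrite mulr0 mul0r.
  rewrite wp -mulrA (pm_col (hw i)) /wr /=; case: eqP; rewrite ?mulr0 //.
- rewrite -(pair_bigA _ (fun j l => wr (i, k) (j, l))) /wr /=.
  rewrite -(pm_rsum hp i); apply: eq_bigr => j _.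
  by rewrite -mulr_suml (pm_rsum (hw i)) mul1r.
- rewrite -(pair_bigA _ (fun i k => wr (i, k) (j, l))) /wr /=.
  rewrite -(pm_csum hp j); apply: eq_bigr => i _.
  by rewrite -mulr_suml (pm_csum (hw i)) mul1r.
Qed.

(** Written with [p i j * p i' j'] in the middle, the product vanishes unless
    [(i == i') = (j == j')], and edges occur only inside a copy. *)
Lemma wreath_cpres : (forall i, @cpres C A G G (w i)) ->
  @cpres C A (ccopies n G) (ccopies n G) wr.
Proof.
move=> wc; have hp := magic_pmagic pm; split.
  move=> [i k] [i' k'] [j l] [j' l'] /= ne; rewrite wrM.
  case: (eqVneq (i == i') (j == j')) => [e|/(pres_eq hp) ->]; last first.
    by rewrite mulr0 mul0r.
  move: ne; rewrite -e; case: (eqVneq i i') e => //= <- /esym/eqP <- ne.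
  rewrite (pm_idem hp) wp -mulrA (proj1 (wc i)) ?mulr0 //.
by move=> [i k] [j l] /= ne; rewrite /wr /= (proj2 (wc i)) ?mul0r.
Qed.

End WreathMagic.

Variable X : qpgroup C.
Let W := wreath_alg X n_gt0.
Let S := qsym C n_gt0.

Local Notation nu := (wreath_nu (X := X) n_gt0).
Local Notation wp := (wreath_p X n_gt0).

Lemma wreath_nu_morphism i : star_morphism (nu i).
Proof.
apply: (star_morphism_comp (quot_pi_morphism _)).
apply: (star_morphism_comp (free_inl_morphism _ _)).
exact: free_in_morphism.
Qed.

Lemma wreath_sym_morphism : star_morphism
  (quot_pi (@wreath_commutator C X n n_gt0) \o
   free_inr (free_pow (qalg X) n) (B := qalg S)).
Proof. exact: star_morphism_comp (quot_pi_morphism _) (free_inr_morphism _ _).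
  Qed.

Lemma wreath_p_magic : magic wp.
Proof. exact: magic_morphism wreath_sym_morphism (qfund_magic S). Qed.

Lemma wreath_nu_pC i j a : nu i a * wp i j = wp i j * nu i a.
Proof.
have hpi := quot_pi_morphism (@wreath_commutator C X n n_gt0).
apply/eqP; rewrite -subr_eq0 -!(smM hpi) -(smB hpi); apply/eqP.
by apply: quot_pi0; exists i, j, a.
Qed.

Lemma wreath_lift (D : starAlgType C) (f : 'I_n -> qalg X -> D)
    (p : 'I_n -> 'I_n -> D) :
  (forall i, star_morphism (f i)) -> magic p ->
  (forall i j a, f i a * p i j = p i j * f i a) ->
  exists g : W -> D, [/\ star_morphism g, forall i a, g (nu i a) = f i a
    & forall i j, g (wp i j) = p i j].
Proof.
move=> hf hp fp.
have r1 : free_pow_rel (fun ia => f ia.1 ia.2) by move=> i; exact: hf.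
have r2 : qsym_rel (fun ij => p ij.1 ij.2) by [].
pose F (z : free_pow (qalg X) n + qalg S) : D := match z with
  | inl x => ulift (fun ia => f ia.1 ia.2) x
  | inr s => ulift (fun ij => p ij.1 ij.2) s end.
have r3 : free_prod_rel F by split; apply: ulift_morphism.
have e1 i a : ulift F (free_inl (qalg S) (free_in i a)) = f i a.
  by rewrite (ulift_gen r3) /= (ulift_gen r1).
have e2 i j : ulift F (free_inr (free_pow (qalg X) n) (@qfund C S i j)) = p i j.
  by rewrite (ulift_gen r3) /= (ulift_gen r2).
have h3 := ulift_morphism r3.
have r4 : quot_rel (@wreath_commutator C X n n_gt0) (ulift F).
  split=> // b [i [j [a ->]]].
  by rewrite (smB h3) !(smM h3) e1 e2 fp subrr.
exists (ulift (ulift F)); split; first exact: ulift_morphism.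
- by move=> i a; rewrite (ulift_gen r4) e1.
- by move=> i j; rewrite (ulift_gen r4) e2.
Qed.

Lemma wreath_generates (T : W -> Prop) : star_subalgebra T ->
  (forall i a, T (nu i a)) -> (forall i j, T (wp i j)) -> forall b, T b.
Proof.
move=> hT Tnu Tp.
have hpi := quot_pi_morphism (@wreath_commutator C X n n_gt0).
have hl := free_inl_morphism (free_pow (qalg X) n) (qalg S).
apply: universal_ind => // b.
apply: (universal_ind (subalg_preim hT hpi)) => -[x|s].
- have := subalg_preim hT (star_morphism_comp hpi hl).
  by move/universal_ind; apply=> -[i a]; apply: Tnu.
- exact: (qfund_generates (subalg_preim hT wreath_sym_morphism)).
Qed.

Lemma qwreath_fund_row i k j :
  \sum_l qwreath_fund n_gt0 (i, k) (j, l) = wp i j :> W.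
Proof.
have e : \sum_l nu i (qfund k l) = 1 :> W.
  rewrite -(sm_sum (wreath_nu_morphism i)) -(sm1 (wreath_nu_morphism i)).
  by congr (nu i _); exact: magic_row (qfund_magic X) k.
transitivity ((\sum_l nu i (qfund k l)) * wp i j : W).
  by rewrite mulr_suml.
by rewrite e mul1r.
Qed.

Lemma qwreath_fund_col i k l :
  \sum_j qwreath_fund n_gt0 (i, k) (j, l) = nu i (qfund k l) :> W.
Proof.
transitivity (nu i (qfund k l) * (\sum_j wp i j) : W).
  by rewrite mulr_sumr.
by rewrite (magic_row wreath_p_magic) mulr1.
Qed.

(** The elements [wreath_p] and [wreath_nu] are partial row sums of the fundamental representation,
    so their comultiplication follows from [qwreath_comultE]. *)
Lemma wreath_comult_p i j :
  qcomult (q := qwreath X n_gt0) (wp i j) = \sum_k wp i k ⊗ wp k j.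
Proof.
have [k _] : exists k : qidx X, true.
  by case/card_gt0P: (qidx_gt0 X) => k _; exists k.
rewrite -(qwreath_fund_row i k j).
rewrite [LHS](sm_sum (qwreath_comult_morphism X n_gt0)).
rewrite (eq_bigr _ (fun l _ => qwreath_comultE n_gt0 (i, k) (j, l))).
rewrite exchange_big.
rewrite -(pair_bigA _ (fun s m => \sum_l
   qwreath_fund n_gt0 (i, k) (s, m) ⊗ qwreath_fund n_gt0 (s, m) (j, l))) /=.
apply: eq_bigr => s _.
transitivity (\sum_m qwreath_fund n_gt0 (i, k) (s, m) ⊗ wp s j).
  by apply: eq_bigr => m _; rewrite -tpure_sumr qwreath_fund_row.
by rewrite -tpure_suml qwreath_fund_row.
Qed.

Let q i s : tens W W := wp i s ⊗ 1.

Let q_comm i s (x : tens (qalg X) (qalg X)) :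
  tens_map (nu i) (nu s) x * q i s = q i s * tens_map (nu i) (nu s) x.
Proof.
have h := tens_map_morphism (wreath_nu_morphism i) (wreath_nu_morphism s).
rewrite (tens_sum x) (sm_sum h) mulr_suml mulr_sumr; apply: eq_bigr => z _.
rewrite (tens_map_pure (wreath_nu_morphism i) (wreath_nu_morphism s)).
by rewrite /q !tpureM mulr1 mul1r wreath_nu_pC.
Qed.

Lemma wreath_comult_nu i a :
  qcomult (q := qwreath X n_gt0) (nu i a) =
  \sum_s tens_map (nu i) (nu s) (qcomult a) * (wp i s ⊗ 1).
Proof.
have pm := wreath_p_magic; have hp := magic_pmagic pm.
have hc := qwreath_comult_morphism X n_gt0.
have h s := tens_map_morphism (wreath_nu_morphism i) (wreath_nu_morphism s).
have h1 : star_morphism (fun a => \sum_s tens_map (nu i) (nu s) (qcomult a) * q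
  i s).
  apply: (@star_morphism_partition _ _ _ _
    (fun s a => tens_map (nu i) (nu s) (qcomult a))) => [s|s|s|s t st||s b].
  - exact: star_morphism_comp (h s) (qcomult_morphism X).
  - by rewrite tpureS star1 (magic_star pm).
  - by rewrite tpureM mulr1 (pm_idem hp).
  - by rewrite tpureM (magic_row_orth pm) // tpure0l.
  - by rewrite -tpure_suml (magic_row pm).
  - exact: q_comm.
move: a; apply: (generates_ext (star_morphism_comp hc (wreath_nu_morphism i)) h1
  (qfund_generates (q := X))) => k l /=.
rewrite -qwreath_fund_col.
rewrite (sm_sum hc).
rewrite (eq_bigr _ (fun j _ => qwreath_comultE n_gt0 (i, k) (j, l))).
rewrite exchange_big.
rewrite -(pair_bigA _ (fun s m => \sum_j
   qwreath_fund n_gt0 (i, k) (s, m) ⊗ qwreath_fund n_gt0 (s, m) (j, l))) /=.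
apply: eq_bigr => s _; rewrite qcomultE (sm_sum (h s)) mulr_suml.
apply: eq_bigr => m _; rewrite -tpure_sumr.
rewrite (tens_map_pure (wreath_nu_morphism i) (wreath_nu_morphism s)).
by rewrite /q tpureM mulr1 qwreath_fund_col.
Qed.

Lemma wreath_comult_nu_p i j a :
  qcomult (q := qwreath X n_gt0) (nu i a * wp i j : W) =
  \sum_s tens_map (nu i) (nu s) (qcomult a) * (wp i s ⊗ wp s j).
Proof.
have pm := wreath_p_magic; have hp := magic_pmagic pm.
have -> : qcomult (q := qwreath X n_gt0) (nu i a * wp i j : W) =
    (\sum_s tens_map (nu i) (nu s) (qcomult a) * (wp i s ⊗ 1)) *
    (\sum_k wp i k ⊗ wp k j) :> tens W W.
  rewrite -wreath_comult_nu -wreath_comult_p.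
  exact: (smM (qwreath_comult_morphism X n_gt0)).
rewrite mulr_suml; apply: eq_bigr => s _.
rewrite mulr_sumr (bigD1 s) //= big1 => [|t ts]; last first.
  by rewrite -mulrA tpureM (magic_row_orth pm) 1?eq_sym // tpure0l mulr0.
by rewrite addr0 -mulrA tpureM mul1r (pm_idem hp).
Qed.

End Wreath.

Lemma sum_ccopies (V : nmodType) n G (F : ccopies n G -> V) :
  \sum_x F x = \sum_(i < n) \sum_(k : G) F (i, k).
Proof.
by rewrite (pair_bigA _ (fun i k => F (i, k))); apply: eq_bigr => -[].
Qed.

Section WreathIsQ.
Variables (C : numClosedFieldType) (X : qpgroup C) (n : nat) (G : cgraph).
Hypothesis n_gt0 : (0 < n)%N.

(** A magic matrix respecting the partition into copies factors as
    [u (i, k) (j, l) = w i k l * p i j] with commuting factors, and such a factorization is a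
    morphism out of the wreath product. *)
Lemma is_Q_wreath : (0 < #|G|)%N ->
  (forall (A : starAlgType C) (u : 'I_n * G -> 'I_n * G -> A), magic u ->
     @cpres C A (ccopies n G) (ccopies n G) u ->
     pres u (fun x y => x.1 == y.1) (fun x y => x.1 == y.1)) ->
  is_Q X G -> is_Q (qwreath X n_gt0) (ccopies n G).
Proof.
move=> /card_gt0P[k0 _] blk [v [vm vp vg vc vu]].
have hnu i := wreath_nu_morphism n_gt0 X i.
have pm := wreath_p_magic n_gt0 X; have hp := magic_pmagic pm.
have wm i : magic (fun k l => wreath_nu n_gt0 i (v k l)).
  exact: magic_morphism.
exists (fun x y => wreath_nu n_gt0 x.1 (v x.2 y.2) * wreath_p X n_gt0 x.1 y.1).
split.
- by apply: (wreath_magic wm pm) => i j k l; exact: wreath_nu_pC.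
- apply: (@wreath_cpres _ _ _ _ (fun i k l =>
    wreath_nu n_gt0 i (v k l)) _ pm) => [i j k l|i].
    exact: wreath_nu_pC.
  case: vp => ve vcc; split=> [x y z w ne|x z ne].
    by rewrite -(smM (hnu i)) ve ?(sm0 (hnu i)).
  by rewrite vcc ?(sm0 (hnu i)).
- move=> T hT Tw.
  have Tp i j : T (wreath_p X n_gt0 i j).
    have -> : wreath_p X n_gt0 i j =
        \sum_l wreath_nu n_gt0 i (v k0 l) * wreath_p X n_gt0 i j.
      by rewrite -mulr_suml -(sm_sum (hnu i)) (magic_row vm) (sm1 (hnu i))
        mul1r.
    by apply: (subalg_sum hT) => l _; exact: (Tw (i, k0) (j, l)).
  apply: wreath_generates => // i a.
  apply: (vg _ (subalg_preim hT (hnu i))) => k l /=.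
  have -> : wreath_nu n_gt0 i (v k l) =
      \sum_j wreath_nu n_gt0 i (v k l) * wreath_p X n_gt0 i j.
    by rewrite -mulr_sumr (magic_row pm) mulr1.
  by apply: (subalg_sum hT) => j _; exact: (Tw (i, k) (j, l)).
- move=> [i k] [j l] /=.
  have h s := tens_map_morphism (hnu i) (hnu s).
  transitivity (\sum_s \sum_m
    (wreath_nu n_gt0 i (v k m) * wreath_p X n_gt0 i s) ⊗
    (wreath_nu n_gt0 s (v m l) * wreath_p X n_gt0 s j)); last first.
    by rewrite pair_bigA.
  etransitivity; first exact: wreath_comult_nu_p.
  rewrite vc; apply: eq_bigr => s _.
  rewrite (sm_sum (h s)) mulr_suml.
  by apply: eq_bigr => m _; rewrite tens_map_pure // tpureM.
- move=> A u um up; have hu := magic_pmagic um.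
  have ub := blk A u um up.
  (* [p i j] sums one row of the block from copy [i] to copy [j]; [w i] forgets the target copy. The
     row [k0] is arbitrary, by [pE] and [pE']. *)
  pose p i j := \sum_l u (i, k0) (j, l).
  pose w i k l := \sum_j u (i, k) (j, l).
  have u0 i k j l i' k' j' l' : (i == i') != (j == j') ->
    u (i, k) (j, l) * u (i', k') (j', l') = 0 by move=> ne; exact: ub.
  (* When the full row of [(i, k')] is inserted, only its block [j] survives. Doing this on either
     side identifies the sums over the rows [k] and [k']. *)
  have rows i k k' j : \sum_l u (i, k) (j, l) =
      (\sum_l u (i, k) (j, l)) * (\sum_l u (i, k') (j, l)).
    rewrite -[LHS]mulr1 -(magic_row um (i, k')).
    rewrite sum_ccopies /=.
    rewrite mulr_sumr (bigD1 j) //= [X in _ + X]big1 ?addr0 // => j' jj'.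
    rewrite mulr_suml big1 // => l _; rewrite mulr_sumr big1 // => l' _.
    by apply: u0; rewrite eqxx [j == _]eq_sym (negPf jj').
  have rows' i k k' j : \sum_l u (i, k) (j, l) =
      (\sum_l u (i, k') (j, l)) * (\sum_l u (i, k) (j, l)).
    rewrite -[LHS]mul1r -(magic_row um (i, k')).
    rewrite sum_ccopies /=.
    rewrite mulr_suml (bigD1 j) //= [X in _ + X]big1 ?addr0 // => j' jj'.
    rewrite mulr_suml big1 // => l _; rewrite mulr_sumr big1 // => l' _.
    by apply: u0; rewrite eqxx (negPf jj').
  have pE i k j : \sum_l u (i, k) (j, l) = p i j.
    by rewrite /p (rows i k k0 j) -rows'.
  have pE' i j l : \sum_k u (i, k) (j, l) = p i j.
    set q := bigop _ _ _.
    have pq j' : p i j' * q = if j' == j then q else 0.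
      case: eqVneq => [->|ne]; last first.
        rewrite /p /q mulr_suml big1 // => l' _;
          rewrite mulr_sumr big1 // => k _.
        by apply: u0; rewrite eqxx (negPf ne).
      rewrite -[RHS]mul1r -(magic_row um (i, k0)).
      rewrite sum_ccopies /= [RHS]mulr_suml.
      rewrite [RHS](bigD1 j) //= [X in _ = _ + X]big1 ?addr0 // => j2 jj'.
      rewrite /q mulr_suml big1 // => l' _; rewrite mulr_sumr big1 // => k _.
      by apply: u0; rewrite eqxx (negPf jj').
    have <- : p i j * q = q by rewrite pq eqxx.
    rewrite -[RHS]mulr1 -(magic_col um (j, l)).
    rewrite sum_ccopies /= [RHS]mulr_sumr.
    rewrite [RHS](bigD1 i) //= [X in _ = _ + X]big1 ?addr0 // => i' ii'.
    rewrite /p mulr_suml big1 // => l' _; rewrite mulr_sumr big1 // => k _.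
    by apply: u0; rewrite eqxx [i == _]eq_sym (negPf ii').
  have wM i k l k' l' : w i k l * w i k' l' =
      \sum_j u (i, k) (j, l) * u (i, k') (j, l').
    rewrite mulr_suml; apply: eq_bigr => j _; rewrite mulr_sumr.
    rewrite (bigD1 j) //= big1 ?addr0 // => j' jj'.
    by apply: u0; rewrite eqxx [j == _]eq_sym (negPf jj').
  have wmag i : magic (w i).
    apply: pmagic_magic => [k l|].
      by rewrite star_sum; apply: eq_bigr => j _; rewrite (magic_star um).
    split=> [k l l'|k k' l|k|l].
    - rewrite wM; case: eqVneq => [<-|ne].
        by apply: eq_bigr => j _; rewrite (pm_idem hu).
      rewrite big1 // => j _.
      by rewrite (pm_row hu) xpair_eqE (negPf ne) andbF.
    - rewrite wM; case: eqVneq => [<-|ne].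
        by apply: eq_bigr => j _; rewrite (pm_idem hu).
      rewrite big1 // => j _.
      by rewrite (pm_col hu) xpair_eqE (negPf ne) andbF.
    - rewrite -(magic_row um (i, k)) exchange_big.
      by rewrite sum_ccopies.
    (* A column sum of [w i] is a sum of block sums, which [pE'] turns into the full row of
       [(i, k0)]. *)
    - rewrite -(magic_row um (i, k0)) exchange_big.
      transitivity (\sum_j p i j); first by apply: eq_bigr => j _; exact: pE'.
      by rewrite sum_ccopies.
  have pM i j i' j' : p i j * p i' j' =
      if (i == i') == (j == j') then p i j * p i' j' else 0.
    case: eqVneq => // ne; rewrite mulr_suml big1 // => l _.
    by rewrite mulr_sumr big1 // => l' _; exact: u0.
  have pid i j : p i j * p i j = p i j.
    rewrite {1}/p mulr_suml; apply: eq_bigr => l _; rewrite mulr_sumr.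
    rewrite (bigD1 l) //= (pm_idem hu) big1 ?addr0 // => l' ll'.
    by rewrite (pm_row hu) xpair_eqE eqxx eq_sym (negPf ll').
  have pmag : magic p.
    apply: pmagic_magic => [i j|].
      by rewrite star_sum; apply: eq_bigr => l _; rewrite (magic_star um).
    split=> [i j j'|i i' j|i|j].
    - by rewrite pM eqxx; case: (eqVneq j j') => [<-|//]; rewrite eqxx pid.
    - by rewrite pM eqxx; case: (eqVneq i i') => [<-|//]; rewrite eqxx pid.
    - rewrite -(magic_row um (i, k0)).
      by rewrite sum_ccopies.
    - rewrite -(magic_col um (j, k0)).
      transitivity (\sum_i \sum_k u (i, k) (j, k0)).
        by apply: eq_bigr => i _; rewrite pE'.
      by rewrite sum_ccopies.
  have wpres i : @cpres C A G G (w i).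
    split=> [k k' l l' ne|k l ne].
      rewrite wM big1 // => j _; apply: (proj1 up) => /=.
      by rewrite !eqxx.
    by rewrite /w big1 // => j _; apply: (proj2 up).
  have wpu i k l j : w i k l * p i j = u (i, k) (j, l).
    rewrite -(pE i k j) /w mulr_suml (bigD1 j) //= [X in _ + X]big1 ?addr0.
      rewrite mulr_sumr (bigD1 l) //= (pm_idem hu) big1 ?addr0 // => l' ll'.
      by rewrite (pm_row hu) xpair_eqE eqxx eq_sym (negPf ll').
    move=> j' jj'; rewrite mulr_sumr big1 // => l' _.
    by rewrite (pm_row hu) xpair_eqE (negPf jj').
  have pwu i k l j : p i j * w i k l = u (i, k) (j, l).
    rewrite -(pE i k j) /w mulr_sumr (bigD1 j) //= [X in _ + X]big1 ?addr0.
      rewrite mulr_suml (bigD1 l) //= (pm_idem hu) big1 ?addr0 // => l' ll'.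
      by rewrite (pm_row hu) xpair_eqE eqxx (negPf ll').
    move=> j' jj'; rewrite mulr_suml big1 // => l' _.
    by rewrite (pm_row hu) xpair_eqE eq_sym (negPf jj').
  have /choice[f hf] : forall i, exists f : qalg X -> A,
      star_morphism f /\ forall k l, f (v k l) = w i k l.
    by move=> i; have [f hf fv] := vu A _ (wmag i) (wpres i); exists f.
  (* On generators both products equal [u (i, k) (j, l)], and the elements commuting with the
     self-adjoint [p i j] form a star-subalgebra. *)
  have fp i j a : f i a * p i j = p i j * f i a.
    have hi := (hf i).1; move: a; apply: vg; last first.
      by move=> k l; rewrite (hf i).2 wpu pwu.
    have ps := magic_star pmag i j.
    split=> [|c a b ha hb|a b ha hb|a ha].
    - by rewrite (sm1 hi) mul1r mulr1.
    - by rewrite (smD hi) (smZ hi) mulrDl mulrDr hb -sscalerAl ha sscalerAr.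
    - by rewrite (smM hi) -mulrA hb !mulrA ha.
    - by rewrite (smS hi) -{1}ps -starM -ha starM ps.
  have [g [hg gnu gp]] := wreath_lift n_gt0 (fun i => (hf i).1) pmag fp.
  exists g => // -[i k] [j l] /=.
  by rewrite (smM hg) gnu gp (hf i).2 wpu.
Qed.

End WreathIsQ.

(** * Distances and trees *)

Local Open Scope nat_scope.

Section Distance.
Variables (V : finType) (e : rel V).

(** A walk may stall, which makes this monotone in [k]. Each level is an existential over a
    conjunction of two relations, the shape preserved by [pres_exists]. *)
Fixpoint reach k (x y : V) : bool :=
  if k is k'.+1 then [exists v, reach k' x v && ((v == y) || e v y)] else x ==
    y.

(* #|V| when y is not reachable from x *)
Definition dist x y := find (fun k => reach k x y) (iota 0 #|V|).

Lemma reachS k x v y : reach k x v -> e v y -> reach k.+1 x y.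
Proof. by move=> h evy /=; apply/existsP; exists v; rewrite h evy orbT. Qed.

Lemma reach_mono k m x y : k <= m -> reach k x y -> reach m x y.
Proof.
elim: m => [|m IHm]; first by rewrite leqn0 => /eqP ->.
rewrite leq_eqVlt => /orP[/eqP -> //|/IHm h /h {}h].
by rewrite /=; apply/existsP; exists y; rewrite h eqxx.
Qed.

Lemma reach_path x p : path e x p -> reach (size p) x (last x p).
Proof.
elim/last_ind: p => [|p y IHp] //=.
rewrite rcons_path last_rcons size_rcons => /andP[/IHp h eh].
exact: reachS h eh.
Qed.

Lemma reach_connect k x y : reach k x y -> connect e x y.
Proof.
elim: k y => [|k IHk] y; first by move/eqP ->.
case/existsP => v /andP[/IHk h /orP[/eqP <- //|evy]].
exact: connect_trans h (connect1 evy).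
Qed.

Lemma connect_reach x y : connect e x y -> exists2 k, k < #|V| & reach k x y.
Proof.
case/connectP => p ep ->; case/shortenP: ep => q eq uq _.
exists (size q); last exact: reach_path.
by have := max_card (mem (x :: q)); rewrite (card_uniqP uq).
Qed.

Lemma connectE x y : connect e x y = reach #|V| x y.
Proof.
apply/idP/idP; last exact: reach_connect.
by case/connect_reach => k lt; apply/reach_mono/ltnW.
Qed.

Lemma dist_max x y : dist x y <= #|V|.
Proof. by rewrite /dist -[X in _ <= X](size_iota 0) find_size. Qed.

Lemma dist_le k x y : reach k x y -> dist x y <= k.
Proof.
move=> h; rewrite leqNgt; apply/negP => lt.
have := before_find 0 lt; rewrite nth_iota ?add0n ?h //.
exact: leq_trans lt (dist_max _ _).
Qed.

Lemma connect_dist x y : connect e x y -> dist x y < #|V|.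
Proof. by case/connect_reach => k lt /dist_le le; apply: leq_ltn_trans lt. Qed.

Lemma dist_connect x y : dist x y < #|V| -> reach (dist x y) x y.
Proof.
move=> lt; have hh : has (fun k => reach k x y) (iota 0 #|V|).
  by rewrite has_find size_iota.
by have := nth_find 0 hh; rewrite -/(dist x y) nth_iota.
Qed.

Lemma reach_dist x y : connect e x y -> reach (dist x y) x y.
Proof. by move/connect_dist/dist_connect. Qed.

Lemma distxx x : dist x x = 0.
Proof. by apply/eqP; rewrite -leqn0; apply: dist_le; rewrite /= eqxx. Qed.

Lemma dist_eq0 x y : dist x y = 0 -> x = y.
Proof.
move=> d0; have : dist x y < #|V| by rewrite d0; apply/card_gt0P; exists x.
by move/dist_connect; rewrite d0 => /eqP.
Qed.

Lemma dist_step x v y : e v y -> dist x y <= (dist x v).+1.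
Proof.
move=> evy; have [lt|ge] := ltnP (dist x v) #|V|.
  exact: dist_le (reachS (dist_connect lt) evy).
exact: leq_trans (dist_max x y) (leqW ge).
Qed.

Lemma dist_pred x y : connect e x y -> x != y ->
  exists2 v, e v y & dist x y = (dist x v).+1.
Proof.
move=> /reach_dist; case d: (dist x y) => [|k] /=; first by move->.
case/existsP => v /andP[h /orP[/eqP vy|evy]] _.
  by move/dist_le: h; rewrite vy d ltnn.
exists v => //; have := dist_step x evy; have := dist_le h; rewrite d; lia.
Qed.

(** A potential growing by at most one along edges bounds distances from below; distances in the
    spine are computed with such potentials. *)
Lemma dist_lipschitz (h : V -> nat) x y : connect e x y ->
  (forall a b, e a b -> h b <= (h a).+1) -> h y <= h x + dist x y.
Proof.
move=> /reach_dist + hl; move: (dist x y) => k; elim: k y => [|k IHk] y /=.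
  by move/eqP ->; rewrite addn0.
case/existsP => v /andP[/IHk h1 /orP[/eqP <-|/hl h2]].
  by apply: leq_trans h1 _; rewrite leq_add2l.
by rewrite addnS; apply: leq_trans h2 _.
Qed.

End Distance.

Definition acyclic (V : finType) (e : rel V) :=
  forall c, ucycle e c -> size c < 3.

Definition connected (V : finType) (e : rel V) := forall x y, connect e x y.

Definition simple (V : finType) (e : rel V) := symmetric e /\ irreflexive e.

Lemma sub_acyclic (V : finType) (e e' : rel V) :
  subrel e' e -> acyclic e -> acyclic e'.
Proof.
move=> s ac c /andP[cc uc]; apply: ac; rewrite /ucycle uc andbT.
exact: sub_cycle cc.
Qed.

(** For the distance to a base point of a tree, [y] is the next vertex towards that point. Unlike
    acyclicity, this is a bound on a count. *)
Definition unique_lower (V : finType) (e : rel V) (h : V -> nat) :=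
  forall x y y', e x y -> e x y' -> h y <= h x -> h y' <= h x -> y = y'.

(** On a cycle of length at least 3, a vertex of maximal height has two distinct neighbours that are
    not higher. *)
Lemma height_acyclic (V : finType) (e : rel V) (h : V -> nat) :
  symmetric e -> unique_lower e h -> acyclic e.
Proof.
move=> es ul c /andP[cc uc]; rewrite ltnNge; apply/negP => c3.
have [x xc xmax] : exists2 x, x \in c & forall y, y \in c -> h y <= h x.
  case: c c3 {cc uc} => // z c _.
  have zc : z \in z :: c by rewrite mem_head.
  have [x xc xm] := @arg_maxnP V z (mem (z :: c)) h zc.
  by exists x.
have [i c' rc] := rot_to xc.
have := cc; rewrite -(rot_cycle i) rc.
have := uc; rewrite -(rot_uniq i) rc.
have cm y : (y \in c) = (y \in x :: c') by rewrite -rc mem_rot.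
have := c3; rewrite -(size_rot i) rc.
case: c' {rc} cm => [|y c'] // cm; case/lastP: c' cm => [|c' y'] // cm _.
rewrite /= rcons_path last_rcons mem_rcons in_cons negb_or.
move=> /andP[_ /andP[/andP[yy' _] _]] /andP[exy /andP[_ ey'x]].
case/eqP: yy'; apply: (ul x) => //; rewrite 1?es //.
  by apply: xmax; rewrite cm !inE eqxx orbT.
by apply: xmax; rewrite cm !inE mem_rcons mem_head !orbT.
Qed.

Section Trees.
Variables (V : finType) (e : rel V).
Hypotheses (esi : simple e) (ac : acyclic e) (co : connected e).
Let es : symmetric e := esi.1.
Let ei : irreflexive e := esi.2.

(** The relation deletes [x]: a path that avoids [x] between two of its neighbours would close up to
    a cycle through [x]. *)
Lemma acyclic_branch x y y' : e x y -> e x y' -> y != y' ->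
  ~~ connect [rel a b | [&& a != x, b != x & e a b]] y y'.
Proof.
move=> exy exy' yy'; apply/negP => /connectP[p ep ly'].
case/shortenP: ep ly' => q eq uq _ ly'.
have xq : x \notin q.
  have : all (predC1 x) q.
    clear uq ly' yy' exy; elim: q y eq => //= z q IHq t /andP[/and3P[_ -> _]].
    by move/IHq.
  by move/allP => h; apply/negP => /h /=; rewrite eqxx.
have epq : path e y q.
  by apply: sub_path eq => a b /and3P[].
have q0 : q != [::].
  by apply/eqP => q0; move: yy'; rewrite ly' q0 /= eqxx.
have /ac : ucycle e (x :: y :: q).
  rewrite /ucycle cons_uniq uq andbT /= exy rcons_path epq -ly' es exy' /=.
  rewrite inE negb_or xq andbT; apply/eqP => xy.
  by move: exy; rewrite xy ei.
by case: q q0 {eq uq ly' xq epq}.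
Qed.

Lemma tree_unique_lower w : unique_lower e (dist e w).
Proof.
move=> x y y' exy exy' dy dy'; apply/eqP/negPn/negP => yy'.
have /negP := acyclic_branch exy exy' yy'; apply.
set r := [rel a b | _].
have rs : symmetric r by move=> a b; rewrite /r /= es; case: (a != x);
  case: (b != x).
(* Going back along a geodesic from [w], all vertices before [z] are strictly closer to [w] than
   [x], so the deleted vertex is never met. *)
have key k z : dist e w z = k -> z != x -> k <= dist e w x -> connect r w z.
  elim: k z => [|k IHk] z.
    by move/dist_eq0 <-; rewrite connect0.
  move=> dz zx le; have [|v evz] := @dist_pred _ e w z (co w z).
    by apply/eqP => wz; move: dz; rewrite wz distxx.
  rewrite dz => -[dv].
  have vx : v != x by apply/eqP => vx; move: le; rewrite dv vx ltnn.
  apply: connect_trans (IHk v (esym dv) vx (ltnW le)) (connect1 _).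
  by rewrite /r /= vx zx evz.
have nx z : e x z -> z != x by move=> h; apply/eqP => zx; move: h;
  rewrite zx ei.
apply: (@connect_trans _ _ w).
  by rewrite (sym_connect_sym rs); apply: key dy => //; apply: nx.
by apply: key dy' => //; apply: nx.
Qed.

End Trees.

(** * Medians of a tree *)

Section Median.
Variables (V : finType) (e : rel V).

Definition dist_sum w := \sum_x dist e x w.

Definition median w := ~~ [exists y, dist_sum y < dist_sum w].

Lemma medianP w : reflect (forall y, dist_sum w <= dist_sum y) (median w).
Proof.
apply: (iffP idP) => [/existsPn h y|h]; first by rewrite leqNgt.
by apply/existsPn => y; rewrite -leqNgt.
Qed.

Lemma median_ex (x : V) : exists w, median w.
Proof.
have [w _ wm] := @arg_minnP V x predT dist_sum isT.
by exists w; apply/medianP => y; apply: wm.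
Qed.

Hypotheses (esi : simple e) (ac : acyclic e) (co : connected e).
Let es : symmetric e := esi.1.
Let ei : irreflexive e := esi.2.

(** From any [w], at most one of [y], [y'] is not farther than [x], so the distance to [w] is convex
    along [y], [x], [y']. The contribution of [w = x] makes the inequality strict. *)
Lemma dist_sum_convex x y y' : e x y -> e x y' -> y != y' ->
  (dist_sum x).*2 < dist_sum y + dist_sum y'.
Proof.
move=> exy exy' yy'; rewrite /dist_sum -addnn -!big_split /=.
have xy z : e x z -> z != x by move=> h; apply/eqP => zx; move: h;
  rewrite zx ei.
have pt w : dist e w x + dist e w x + (w == x) <= dist e w y + dist e w y'.
  case: (eqVneq w x) => [->|wx].
    have d1 z : e x z -> 0 < dist e x z.
      move=> exz; rewrite lt0n; apply/eqP => /dist_eq0 xz.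
      by move: (xy z exz); rewrite xz eqxx.
    by rewrite distxx; have := d1 _ exy; have := d1 _ exy'; lia.
  have d1 z : e x z -> dist e w x <= (dist e w z).+1.
    by move=> exz; apply: dist_step; rewrite es.
  have := @tree_unique_lower _ _ esi ac co w x y y' exy exy'.
  have := d1 _ exy; have := d1 _ exy'.
  case: (leqP (dist e w y) (dist e w x));
    case: (leqP (dist e w y') (dist e w x)); try lia.
  by move=> _ _ _ _ /(_ isT isT) h; rewrite h eqxx in yy'.
have : \sum_w (dist e w x + dist e w x + (w == x)) <=
       \sum_w (dist e w y + dist e w y') by apply: leq_sum => w _.
apply: leq_trans; rewrite [X in _ < X]big_split /= -[X in X < _]addn0.
by rewrite ltn_add2l (bigD1 x) //= eqxx.
Qed.

(** By strict convexity, the sum grows strictly along a path after a first step that does not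
    decrease it. *)
Lemma dist_sum_path x y p : path e x (y :: p) -> uniq [:: x, y & p] ->
  dist_sum x <= dist_sum y -> dist_sum y + (p != [::]) <= dist_sum (last y p).
Proof.
elim: p x y => [|z p IHp] x y /=; first by rewrite addn0.
move=> /and3P[exy eyz ep] /and4P[]; rewrite !inE !negb_or.
move=> /and3P[xy xz _] /andP[yz yp] zp up le.
have c : (dist_sum y).*2 < dist_sum x + dist_sum z.
  by apply: dist_sum_convex => //; rewrite es.
have := IHp y z; rewrite /= eyz ep inE negb_or yz yp zp up => /(_ isT isT).
by lia.
Qed.

(* A strictly convex function on a tree has pairwise adjacent minimizers. *)
Lemma median_clique a b : median a -> median b -> a != b -> e a b.
Proof.
move=> /medianP ma /medianP mb ab; have /connectP[p ep lb] := co a b.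
case/shortenP: ep lb => -[|y q] eq uq _ lb; first by rewrite lb eqxx in ab.
have := dist_sum_path eq uq (ma y); case: q eq lb {uq} => [|z q].
  by rewrite /= andbT => eay ->.
move=> _ lb /=; rewrite -[last z q]/(last a [:: y, z & q]) -lb.
by have := mb a; have := ma y; lia.
Qed.

End Median.

(* The flagged vertices are the roots: every other vertex has exactly one lower
   neighbour for the height h. *)
Definition rooted_forest (V : finType) (e : rel V) (fl : pred V) :=
  exists h : V -> nat, (forall x y, e x y -> h x != h y) /\
    forall x, #|[set y | e x y && (h y < h x)]| = ~~ fl x.

(** The height is the distance to the median [a]. Any other median is adjacent to [a], its only
    lower neighbour, and loses that edge; every other vertex keeps its parent. *)
Lemma tree_rooted (V : finType) (e : rel V) (a : V) :
  simple e -> acyclic e -> connected e -> median e a ->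
  rooted_forest (fun x y => e x y && ~~ (median e x && median e y)) (median e).
Proof.
move=> esi ac co ma; have [es ei] := esi.
have ul := @tree_unique_lower _ _ esi ac co a.
have lowdist x y : e x y -> dist e a y <= dist e a x -> dist e a y < dist e a x.
  move=> exy le; have xa : a != x.
    apply/eqP => ax; move: le; rewrite ax distxx leqn0 => /eqP/dist_eq0 xy.
    by move: exy; rewrite xy ei.
  have [v evx dv] := dist_pred (co a x) xa.
  have -> // : y = v; last by rewrite dv.
  by apply: (ul x) => //; rewrite 1?es // dv.
exists (dist e a); split=> [x y /andP[exy _]|x].
  apply/eqP => d.
  by have := lowdist x y exy; rewrite d leqnn ltnn => /(_ isT).
case: (boolP (median e x)) => mx /=.
  apply/eqP; rewrite cards_eq0; apply/eqP/setP => y; rewrite !inE.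
  case: (eqVneq a x) => [->|ax]; first by rewrite distxx ltn0 andbF.
  have eax := median_clique esi ac co ma mx ax.
  apply/negP => /andP[/andP[exy /negP nm]] lt; apply: nm; suff -> : y = a by [].
  by apply: (ul x) => //; rewrite 1?es // ?distxx // ltnW.
have xa : a != x by apply/eqP => ax; rewrite -ax ma in mx.
have [v evx dv] := dist_pred (co a x) xa.
apply/eqP/cards1P; exists v; apply/setP => y; rewrite !inE andbT.
apply/andP/eqP => [[exy lt]|->]; last by rewrite es evx dv.
by apply: (ul x) => //; rewrite 1?es // ?dv // ltnW // -dv.
Qed.

Lemma rooted_unique_lower (V : finType) (e : rel V) fl h :
  (forall x y, e x y -> h x != h y) ->
  (forall x, #|[set y | e x y && (h y < h x)]| = ~~ fl x :> nat) ->
  unique_lower e h.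
Proof.
move=> hne hc x y y' exy exy' le le'.
have lt z : e x z -> h z <= h x -> h z < h x.
  by move=> exz; rewrite leq_eqVlt eq_sym (negPf (hne _ _ exz)).
have c1 : #|[set y | e x y && (h y < h x)]| <= 1 by rewrite hc; case: (fl x).
by move/card_le1_eqP: c1; apply; rewrite inE ?exy ?exy' lt.
Qed.

Lemma rooted_tree (V : finType) (e : rel V) (r : V) :
  simple e -> rooted_forest e (pred1 r) -> acyclic e /\ connected e.
Proof.
move=> [es ei] [h [hne hc]]; have ul := rooted_unique_lower hne hc.
split; first exact: height_acyclic es ul.
have key n x : h x <= n -> connect e x r.
  elim: n x => [|n IHn] x le.
    case: (eqVneq x r) => [->//|xr].
    have : 0 < #|[set y | e x y && (h y < h x)]| by rewrite hc /= xr.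
    by case/card_gt0P => y; rewrite inE => /andP[_]; move: le; lia.
  case: (eqVneq x r) => [->//|xr].
  have : 0 < #|[set y | e x y && (h y < h x)]| by rewrite hc /= xr.
  case/card_gt0P => y; rewrite inE => /andP[exy lt].
  apply: connect_trans (connect1 exy) (IHn y _); move: le lt; lia.
move=> x y; apply: connect_trans (key _ x (leqnn _)) _.
by rewrite (sym_connect_sym es); apply: key.
Qed.

(** * Definable relations are preserved *)

Local Open Scope ring_scope.

Section Transfer.
Variables (C : numClosedFieldType) (A : starAlgType C) (V W : finType).
Variables (p : A) (u : V -> W -> A).
Hypothesis hu : pmagic p u.

Lemma eq_pres (T : eqType) (R R' : V -> V -> T) (S S' : W -> W -> T) :
  pres u R S -> R =2 R' -> S =2 S' -> pres u R' S'.
Proof. by move=> h e e' x y z w; rewrite -e -e'; apply: h. Qed.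

Lemma eq_vpres (T : eqType) (a a' : V -> T) (b b' : W -> T) :
  vpres u a b -> a =1 a' -> b =1 b' -> vpres u a' b'.
Proof. by move=> h e e' x z; rewrite -e -e'; apply: h. Qed.

Lemma pres_vpres_r (T : eqType) (a : V -> T) (b : W -> T) :
  pres u (fun _ y => a y) (fun _ w => b w) -> vpres u a b.
Proof. by move=> h x z ne; rewrite -(pm_idem hu) h. Qed.

Lemma exists_sum (X : finType) (P : pred X) : [exists v,
  P v] = (0 < \sum_v P v)%N.
Proof.
apply/existsP/idP => [[v Pv]|]; first by rewrite (bigD1 v) //= Pv.
apply: contraTP => no; rewrite big1 // => v _.
by case: (boolP (P v)) => // Pv; case: no; exists v.
Qed.

(** An existential quantifier is the positivity of a count. *)
Lemma pres_exists (R1 R2 : V -> V -> bool) (S1 S2 : W -> W -> bool) :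
  pres u R1 S1 -> pres u R2 S2 ->
  pres u (fun x y => [exists v, R1 x v && R2 v y])
         (fun z w => [exists v, S1 z v && S2 v w]).
Proof.
move=> h1 h2.
apply: (eq_pres (pres_map1 (fun n => 0 < n)%N
  (pres_count hu (fun a b => a && b : nat) h1 h2))).
  by move=> x y; rewrite exists_sum.
by move=> x y; rewrite exists_sum.
Qed.

Lemma vpres_exists (R : V -> V -> bool) (S : W -> W ->
  bool) (a : pred V) (b : pred W) :
  pres u R S -> vpres u a b ->
  vpres u (fun x => [exists v, R x v && a v]) (fun z => [exists v,
    S z v && b v]).
Proof. by move=> h1 h2; apply: (pres_vpres hu);
  exact: pres_exists h1 (vpres_l h2). Qed.

Lemma pm_zero : p = 0 -> forall x z, u x z = 0.
Proof. by move=> p0 x z; rewrite -(pm_mulr hu) p0 mulr0. Qed.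

Lemma pres_zero (T : eqType) (R : V -> V -> T) (S : W -> W -> T) : p = 0 ->
  pres u R S.
Proof. by move=> /pm_zero u0 x y z w _; rewrite u0 mul0r. Qed.

Variables (e : rel V) (e' : rel W).
Hypothesis he : pres u e e'.

Lemma pres_reach k : pres u (reach e k) (reach e' k).
Proof.
elim: k => [|k IHk]; first exact: (pres_eq hu).
exact: pres_exists IHk (pres_map orb (pres_eq hu) he).
Qed.

Lemma pres_connect : pres u (connect e) (connect e').
Proof.
have [p0|p0] := eqVneq p 0; first exact: pres_zero.
(* [connectE] bounds the number of steps by the order, so the two orders must agree; for [p = 0]
   they may differ, but then all entries vanish. *)
have c := pm_eq_card hu p0.
by apply: (eq_pres (@pres_reach #|V|)) => x y; rewrite connectE ?c.
Qed.

Lemma pres_dist : pres u (dist e) (dist e').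
Proof.
have [p0|p0] := eqVneq p 0; first exact: pres_zero.
have c := pm_eq_card hu p0.
move=> x y z w ne; have [k] : exists k, reach e k x y != reach e' k z w.
  apply: contrapT => no; case/eqP: ne; rewrite /dist c.
  by apply: eq_find => k; apply/eqP/negPn/negP => h; apply: no; exists k.
exact: pres_reach.
Qed.

Lemma vpres_dist_sum : vpres u (dist_sum e) (dist_sum e').
Proof.
apply: pres_vpres_r.
exact: (pres_count hu (fun _ n => n) (pres_const u tt) pres_dist).
Qed.

Lemma vpres_median : vpres u (median e) (median e').
Proof.
apply: (vpres_map1 negb).
have h : pres u (fun x y => dist_sum e y < dist_sum e x)%N
                (fun x y => dist_sum e' y < dist_sum e' x)%N.
  have := pres_map (fun m n => n < m)%N (vpres_l vpres_dist_sum) (vpres_r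
    vpres_dist_sum).
  exact.
have := @vpres_exists _ _ predT predT h.
rewrite /=; move=> H; apply: (eq_vpres (H _)) => [x z|x|x]; rewrite ?eqxx //.
  by apply: eq_existsb => y; rewrite andbT.
by apply: eq_existsb => y; rewrite andbT.
Qed.

Lemma unique_lower_count (X : finType) (r : rel X) (h : X ->
  nat) : symmetric r ->
  unique_lower r h <-> forall x, (\sum_v ((h v <= h x) && r v x) <= 1)%N.
Proof.
have cE (P : pred X) : (\sum_v P v)%N = #|P|.
  by rewrite -sum1_card [RHS]big_mkcond /=; apply: eq_bigr => v _;
    rewrite unfold_in; case: (P v).
move=> rs; split=> [ul x|c x y y' xy xy' le le'].
  rewrite cE; apply/card_le1_eqP => y y'; rewrite !unfold_in.
  by move=> /andP[le xy] /andP[le' xy']; apply: (ul x) => //; rewrite rs.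
have := c x; rewrite cE => /card_le1_eqP; apply; rewrite unfold_in.
  by rewrite le' rs.
by rewrite le rs.
Qed.

(** The count to be bounded is taken within a radius that depends on the pair. It is preserved for
    each fixed radius [k], and so is the distance, so [k] may be specialized to the distance. *)
Lemma unique_lower_transfer : p != 0 -> symmetric e -> symmetric e' ->
  (forall w, unique_lower e (dist e w)) -> forall w,
    unique_lower e' (dist e' w).
Proof.
move=> p0 es es' ul w; apply/(unique_lower_count _ es') => x.
pose N (X : finType) (r : rel X) k w x :=
  (\sum_v ((dist r w v <= k) && r v x))%N.
have hN k : pres u (N V e k) (N W e' k).
  exact: (pres_count hu (fun d b => (d <= k)%N && b : nat) pres_dist he).
have h : pres u (fun w x => N V e (dist e w x) w x) (fun w x =>
  N W e' (dist e' w x) w x).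
  move=> a b c d; case: (eqVneq (dist e a b) (dist e' c d)) => [->|ne _].
    exact: hN.
  exact: pres_dist.
have [a [b eN]] := pres_value_r hu w x p0 h.
have := (unique_lower_count (dist e a) es).1 (ul a) b.
by rewrite -[X in (X <= _)%N]/(N V e (dist e a b) a b) eN.
Qed.

Lemma connected_transfer : p != 0 -> connected e <-> connected e'.
Proof.
move=> p0; split=> co x y.
  by have [a [b <-]] := pres_value_r hu x y p0 pres_connect.
by have [a [b ->]] := pres_value_l hu x y p0 pres_connect.
Qed.

End Transfer.

(** * Complements and cuts at medians *)

Definition compl_rel (V : finType) (e : rel V) : rel V :=
  fun x y => (x != y) && ~~ e x y.

Definition ccompl (G : cgraph) : cgraph :=
  CGraph (compl_rel (@cedge G)) (@ccol G).

(* A tree is cut at its medians: between them when there are several, around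
   the median when it is unique.  The colours make the cut reversible. *)
Definition split_median (G : cgraph) : cgraph :=
  let m := median (@cedge G) in
  CGraph (fun x y => cedge x y && ~~ (m x && m y)) (fun x =>
    (m x : nat) :: ccol x).

Definition isolate_median (G : cgraph) : cgraph :=
  let m := median (@cedge G) in
  CGraph (fun x y => cedge x y && ~~ (m x || m y))
    (fun x => [:: m x : nat, [exists v, cedge x v && m v] : nat & ccol x]).

Lemma compl_relK (V : finType) (e : rel V) : irreflexive e ->
  compl_rel (compl_rel e) =2 e.
Proof.
move=> ei x y; rewrite /compl_rel; case: eqVneq => [->|] /=; rewrite ?ei //.
by rewrite negbK.
Qed.

Section CgraphTransfer.
Variables (C : numClosedFieldType) (A : starAlgType C) (G H : cgraph).
Variables (p : A) (u : G -> H -> A).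
Hypothesis hu : pmagic p u.

Lemma cpres_compl : cpres u -> @cpres C A (ccompl G) (ccompl H) u.
Proof.
move=> [he hc]; split=> //=.
exact: (pres_map (fun a b => ~~ a && ~~ b) (pres_eq hu) he).
Qed.

Lemma cpres_complK : irreflexive (@cedge G) -> irreflexive (@cedge H) ->
  @cpres C A (ccompl G) (ccompl H) u -> cpres u.
Proof.
move=> gi hi [he hc]; split=> //=.
exact: (eq_pres (pres_map (fun a b => ~~ a && ~~ b) (pres_eq hu) he)
  (compl_relK gi) (compl_relK hi)).
Qed.

Lemma cpres_split : cpres u -> @cpres C A (split_median G) (split_median H) u.
Proof.
move=> [he hc]; have hm := vpres_median hu he; split=> /=.
  have h2 := pres_map andb (vpres_l hm) (vpres_r hm).
  exact: (pres_map (fun a b => a && ~~ b) he h2).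
exact: (vpres_map (fun (a : bool) s => (a : nat) :: s) hm hc).
Qed.

Let vpres_head : forall (G' : G -> seq nat) H',
  vpres u G' H' -> vpres u (fun x => head 0%N (G' x)) (fun x =>
    head 0%N (H' x)).
Proof. by move=> G' H' h; apply: (vpres_map1 (head 0%N)). Qed.

Let vpres_behead : forall (G' : G -> seq nat) H',
  vpres u G' H' -> vpres u (fun x => behead (G' x)) (fun x => behead (H' x)).
Proof. by move=> G' H' h; apply: (vpres_map1 behead). Qed.

Let clique (K : cgraph) := forall a b : K, median (@cedge K) a ->
  median (@cedge K) b -> a != b -> cedge a b.

(** The lost edges join exactly the pairs of distinct medians, by the clique hypothesis. The first
    colour records which vertices were medians, so the original edges are a Boolean combination of
    preserved data. *)
Lemma cpres_splitK : irreflexive (@cedge G) -> irreflexive (@cedge H) ->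
  clique G -> clique H ->
  @cpres C A (split_median G) (split_median H) u -> cpres u.
Proof.
move=> gi hi cG cH [he hc]; split; last exact: vpres_behead hc.
have hm : vpres u (median (@cedge G)) (median (@cedge H)).
  apply: (eq_vpres (vpres_map1 (fun n : nat =>
    n == 1%N) (vpres_head hc))) => x /=;
    by case: median.
have h2 := pres_map andb (vpres_l hm) (vpres_r hm).
have h3 := pres_map (fun a b => ~~ a && b) (pres_eq hu) h2.
have rec (K : cgraph) : irreflexive (@cedge K) -> clique K -> forall x y : K,
    (cedge x y && ~~ (median (@cedge K) x && median (@cedge K) y)) ||
    ((x != y) && (median (@cedge K) x && median (@cedge K) y)) = cedge x y.
  move=> ki cK x y; case: (eqVneq x y) => [->|xy]; first by rewrite ki.
  case: (boolP (median _ x)) => mx; case: (boolP (median _ y)) => my /=;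
    rewrite ?andbT ?andbF ?orbF //=.
  by rewrite cK.
exact: (eq_pres (pres_map orb he h3) (rec G gi cG) (rec H hi cH)).
Qed.

Lemma cpres_isolate : cpres u -> @cpres C A (isolate_median G) (isolate_median
  H) u.
Proof.
move=> [he hc]; have hm := vpres_median hu he; split=> /=.
  have h2 := pres_map orb (vpres_l hm) (vpres_r hm).
  exact: (pres_map (fun a b => a && ~~ b) he h2).
have ha := vpres_exists hu he hm.
apply: (vpres_map (fun (a : bool) s => (a : nat) :: s) hm).
exact: (vpres_map (fun (a : bool) s => (a : nat) :: s) ha hc).
Qed.

Let single (K : cgraph) := exists a : K, forall x,
  median (@cedge K) x = (x == a).

(** The lost edges all meet the unique median, and the second colour marks its neighbours. *)
Lemma cpres_isolateK : simple (@cedge G) -> simple (@cedge H) ->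
  single G -> single H ->
  @cpres C A (isolate_median G) (isolate_median H) u -> cpres u.
Proof.
move=> gsi hsi cG cH [he hc]; split; last exact: vpres_behead (vpres_behead hc).
have hm : vpres u (median (@cedge G)) (median (@cedge H)).
  apply: (eq_vpres (vpres_map1 (fun n : nat =>
    n == 1%N) (vpres_head hc))) => x /=;
    by case: median.
have ha : vpres u (fun x => [exists v, cedge x v && median (@cedge G) v])
                  (fun x => [exists v, cedge x v && median (@cedge H) v]).
  apply: (eq_vpres (vpres_map1 (fun n : nat =>
    n == 1%N) (vpres_head (vpres_behead hc)))) => x /=;
    by case: [exists v, _].
have h2 := pres_map andb (vpres_l hm) (vpres_r ha).
have h3 := pres_map andb (vpres_l ha) (vpres_r hm).
have rec (K : cgraph) : simple (@cedge K) -> single K -> forall x y : K,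
    let m := median (@cedge K) in
    (cedge x y && ~~ (m x || m y)) ||
    ((m x && [exists v, cedge y v && m v]) ||
     ([exists v, cedge x v && m v] && m y)) = cedge x y.
  move=> [ks ki] [a ha'] x y /=.
  have aE z : [exists v, cedge z v && median (@cedge K) v] = cedge z a.
    apply/existsP/idP => [[v /andP[zv]]|za]; last by exists a;
      rewrite za ha' eqxx.
    by rewrite ha' => /eqP <-.
  rewrite !aE !ha'; case: (eqVneq x a) => [->|xa] /=.
    by rewrite andbF ks orFb; case: eqVneq => [->|_];
      rewrite ?ki ?andbT ?andbF ?orbF.
  by case: (eqVneq y a) => [->|ya] /=; rewrite ?andbF ?andbT ?orbF.
exact: (eq_pres (pres_map orb he (pres_map orb h2 h3)) (rec G gsi cG) (rec H
  hsi cH)).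
Qed.

End CgraphTransfer.

(** * Hereditary class and connected components *)

Local Open Scope nat_scope.

Lemma surj_inj_bij (T U : Type) (f : T -> U) :
  injective f -> (forall y, exists x, f x = y) -> bijective f.
Proof.
move=> fI /choice[g gK]; exists g; last exact: gK.
by move=> x; apply: fI; rewrite gK.
Qed.

(* Quantifying over all embeddings f makes the class hereditary, hence closed
   under connected components. *)
Definition tree_like (V : finType) (e : rel V) : Prop :=
  simple e /\
  forall (U : finType) (f : U -> V), injective f ->
    connected (relpre f e) -> connected (relpre f (compl_rel e)) ->
    acyclic (relpre f e) \/ acyclic (relpre f (compl_rel e)).

Lemma relpre_acyclic (U V : finType) (f : U -> V) (e : rel V) :
  injective f -> acyclic e -> acyclic (relpre f e).
Proof.
move=> fI ac c /andP[cc uc]; rewrite -(size_map f); apply: ac.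
by rewrite /ucycle cycle_map cc map_inj_uniq.
Qed.

Lemma eq_acyclic (V : finType) (e e' : rel V) : e =2 e' -> acyclic e ->
  acyclic e'.
Proof. by move=> ee; apply: sub_acyclic => x y; rewrite ee. Qed.

Lemma eq_connected (V : finType) (e e' : rel V) : e =2 e' -> connected e ->
  connected e'.
Proof. by move=> ee co x y; rewrite -(eq_connect ee). Qed.

Lemma compl_rel_simple (V : finType) (e : rel V) : simple e ->
  simple (compl_rel e).
Proof.
move=> [es ei]; split=> x; first by move=> y; rewrite /compl_rel eq_sym es.
by rewrite /compl_rel eqxx.
Qed.

Lemma relpre_simple (U V : finType) (f : U -> V) (e : rel V) :
  simple e -> simple (relpre f e).
Proof. by move=> [es ei]; split=> [x y|x] /=. Qed.

Lemma tree_like_compl (V : finType) (e : rel V) :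
  tree_like e -> tree_like (compl_rel e).
Proof.
move=> [esi h]; split; first exact: compl_rel_simple.
have ei := esi.2; move=> U f fI.
have cc : relpre f (compl_rel (compl_rel e)) =2 relpre f e.
  by move=> x y; apply: compl_relK.
move=> co1 /(eq_connected cc) co2; case: (h U f fI co2 co1) => [a|a];
  last by left.
by right; apply: eq_acyclic a => x y; rewrite cc.
Qed.

Lemma tree_like_relpre (U V : finType) (f : U -> V) (e : rel V) :
  injective f -> tree_like e -> tree_like (relpre f e).
Proof.
move=> fI [esi h]; split; first exact: relpre_simple.
move=> U' g gI.
have cc : relpre g (compl_rel (relpre f e)) =2 relpre (f \o g) (compl_rel e).
  by move=> x y; rewrite /= /compl_rel /= (inj_eq fI).
move=> co1 /(eq_connected cc) co2.
case: (h U' (f \o g) (inj_comp fI gI) co1 co2) => [a|a]; first by left.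
by right; apply: eq_acyclic a => x y; rewrite cc.
Qed.

Lemma acyclic_tree_like (V : finType) (e : rel V) :
  simple e -> acyclic e -> tree_like e.
Proof. by move=> esi ac; split=> // U f fI _ _; left;
  apply: relpre_acyclic. Qed.

(** * Induced subgraphs and unions of components *)

Section Induced.
Variable G : cgraph.
Hypothesis gsi : simple (@cedge G).
Let gs : symmetric (@cedge G) := gsi.1.
Let cs : connect_sym (@cedge G) := sym_connect_sym gs.

Definition ind (S : {set G}) : cgraph :=
  @CGraph {x | x \in S} (relpre val (@cedge G)) (fun x => ccol (val x)).

Definition component (x : G) : {set G} := [set y | connect (@cedge G) x y].

Lemma card_ind (S : {set G}) : #|ind S| = #|S|.
Proof. by rewrite card_sig. Qed.

Definition cclosed (S : {set G}) :=
  forall x y, x \in S -> connect (@cedge G) x y -> y \in S.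

Lemma component_closed x : cclosed (component x).
Proof. by move=> y z; rewrite !inE; apply: connect_trans. Qed.

Lemma connect_ind (S : {set G}) (x y : ind S) : cclosed S ->
  connect (@cedge G) (val x) (val y) -> connect (@cedge (ind S)) x y.
Proof.
move=> cS /connectP[p ep lp]; elim: p x ep lp => [|z p IHp] x /=.
  by move=> _ /val_inj ->; apply: connect0.
move=> /andP[xz ep] lp; have zS : z \in S.
  exact: cS (valP x) (connect1 xz).
apply: (@connect_trans _ _ (exist _ z zS)); last exact: IHp.
exact: connect1.
Qed.

Lemma component_connected x : connected (@cedge (ind (component x))).
Proof.
move=> [y yx] [z zx]; apply: connect_ind => /=; first exact: component_closed.
by move: yx zx; rewrite !inE => yx; apply: connect_trans; rewrite cs.
Qed.

Definition unsplit_set (S : {set G}) (x : cadd (ind S) (ind (~: S))) : G :=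
  match x with inl x => val x | inr x => val x end.

Arguments unsplit_set : clear implicits.

Lemma ciso_split (S : {set G}) : cclosed S ->
  [/\ bijective (unsplit_set S),
      {mono (unsplit_set S) : x y / cedge x y}
    & forall x, ccol (unsplit_set S x) = ccol x].
Proof.
move=> cS; split.
- apply: surj_inj_bij.
    move=> [x|x] [y|y] /= e; first by congr inl; apply: val_inj.
    + by have := valP y; rewrite inE (_ : val y = val x) ?(valP x).
    + by have := valP x; rewrite inE (_ : val x = val y) ?(valP y).
    + by congr inr; apply: val_inj.
  move=> y; case: (boolP (y \in S)) => yS; first by exists (inl (exist _ y yS)).
  have yS' : y \in ~: S by rewrite inE.
  by exists (inr (exist _ y yS')).
- move=> [x|x] [y|y] //=; apply/negP => xy.
    by have := valP y; rewrite inE (cS _ _ (valP x) (connect1 xy)).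
  by have := valP x; rewrite inE (cS _ (val x) (valP y)) // connect1 // gs.
- by case.
Qed.

Lemma ciso_copies (K0 : cgraph) (S : {set G}) : cclosed S ->
  (forall x, x \in S -> ciso K0 (ind (component x))) ->
  exists n, ciso (ccopies n K0) (ind S).
Proof.
move=> cS isoK.
(* One representative for each component inside [S]; these index the copies. *)
pose R := [set x in S | fingraph.root (@cedge G) x == x].
have Rc x y : x \in R -> y \in R -> connect (@cedge G) x y -> x = y.
  rewrite !inE => /andP[_ /eqP <-] /andP[_ /eqP <-].
  by rewrite -(fingraph.root_connect cs) !(fingraph.root_root cs) => /eqP.
have hgx : forall i : 'I_#|R|, exists g : K0 -> ind (component (enum_val i)),
    [/\ bijective g, {mono g : x y / cedge x y} & forall x,
      ccol (g x) = ccol x].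
  by move=> i; apply: isoK; have := enum_valP i; rewrite inE => /andP[].
pose g i := projT1 (cid (hgx i)); have hg i := projT2 (cid (hgx i)).
have con (x : 'I_#|R| * K0) : connect (@cedge G) (enum_val x.1) (val (g x.1
  x.2)).
  by have := valP (g x.1 x.2); rewrite inE.
have Ri (i : 'I_#|R|) : enum_val i \in R by exact: enum_valP.
have RS x : x \in R -> x \in S by rewrite inE => /andP[].
have fS (x : 'I_#|R| * K0) : val (g x.1 x.2) \in S by exact: cS (RS _ (Ri x.1))
  (con x).
have same x y : connect (@cedge G) (val (g x.1 x.2)) (val (g y.1 y.2)) ->
  x.1 = y.1.
  move=> h; apply: enum_val_inj; apply: Rc => //.
  apply: connect_trans (con x) (connect_trans h _); rewrite cs; exact: con.
exists #|R|, (fun x => exist _ (val (g x.1 x.2)) (fS x)); split.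
- apply: surj_inj_bij.
    move=> x y /(congr1 val) /= e.
    have {}same : x.1 = y.1 by apply: same; rewrite [val _]e connect0.
    case: x y e same => [i k] [j l] /= e ij; move: e; rewrite -ij => /val_inj.
    by have [/bij_inj gI _ _] := hg i; move/gI ->.
  move=> [y yS]; have ry : fingraph.root (@cedge G) y \in R.
    rewrite inE (fingraph.root_root cs) eqxx andbT; apply: cS yS _;
      exact: connect_root.
  pose i := enum_rank_in ry (fingraph.root (@cedge G) y).
  have ei : enum_val i = fingraph.root (@cedge G) y by rewrite enum_rankK_in.
  have yc : y \in component (enum_val i) by rewrite inE ei cs connect_root.
  have [[g' _ gK] _ _] := hg i; exists (i, g' (exist _ y yc)).
  by apply: val_inj; exact: (congr1 val (gK _)).
- move=> [i k] [j l] /=; case: eqVneq => [<-|ij] /=.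
    by have [_ gm _] := hg i; exact: (gm k l).
  apply/negP => h; case/eqP: ij.
  exact: (same (i, k) (j, l) (connect1 h)).
- by move=> [i k] /=; have [_ _ gc] := hg i; exact: (gc k).
Qed.

End Induced.
Arguments unsplit_set {G} S x.

Local Open Scope ring_scope.

(** * Blocks of a magic matrix *)

Section Blocks.
Variables (C : numClosedFieldType) (A : starAlgType C).

Section PmagicBlock.
Variables (V W : finType) (p : A) (u : V -> W -> A).
Hypothesis hu : pmagic p u.

Lemma pmagic_sub (S : {set V}) (T : {set W}) q :
  (forall x, x \in S -> \sum_(z in T) u x z = q) ->
  (forall z, z \in T -> \sum_(x in S) u x z = q) ->
  pmagic q (fun (x : {x | x \in S}) (z : {z | z \in T}) => u (val x) (val z)).
Proof.
move=> hr hc; split=> [x z z'|x x' z|x|z].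
- by rewrite (pm_row hu) (inj_eq val_inj).
- by rewrite (pm_col hu) (inj_eq val_inj).
- by rewrite -(big_sub T (u (val x))) hr ?(valP x).
- by rewrite -(big_sub S (u^~ (val z))) hc ?(valP z).
Qed.

Lemma pmagic_sub_closed (S : {set V}) (T : {set W}) :
  (forall x z, (x \in S) != (z \in T) -> u x z = 0) ->
  pmagic p (fun (x : {x | x \in S}) (z : {z | z \in T}) => u (val x) (val z)).
Proof.
move=> h; apply: pmagic_sub => [x xS|z zT].
  rewrite -(pm_rsum hu x) big_mkcond; apply: eq_bigr => z _.
  by case: ifP => // zT; rewrite h // xS zT.
rewrite -(pm_csum hu z) big_mkcond; apply: eq_bigr => x _.
by case: ifP => // xS; rewrite h // xS zT.
Qed.

(* The blocks of x0 and z0 form a magic matrix in the corner cut out by the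
   common value q of their row and column sums. *)
Lemma pmagic_block (E : rel V) (E' : rel W) x0 z0 :
  symmetric E -> transitive E -> symmetric E' -> transitive E' ->
  pres u E E' -> E x0 x0 -> E' z0 z0 -> u x0 z0 != 0 ->
  exists2 q, q != 0 & pmagic q
    (fun (x : {x | x \in [set x | E x0 x]}) (z : {z | z \in [set z | E' z0 z]})
      =>
       u (val x) (val z)).
Proof.
move=> Es Et E's E't hE Ex Ez u0.
pose P x := \sum_(z in [set z | E' z0 z]) u x z.
pose Q z := \sum_(x in [set x | E x0 x]) u x z.
have PM x : P x * p = P x.
  by rewrite mulr_suml; apply: eq_bigr => z _; rewrite (pm_mulr hu).
have MP x : p * P x = P x.
  by rewrite mulr_sumr; apply: eq_bigr => z _; rewrite (pm_mull hu).
have MQ z : p * Q z = Q z.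
  by rewrite mulr_sumr; apply: eq_bigr => x _; rewrite (pm_mull hu).
(* Insert the row sum of [x']: as [E x x'], a product with [z] in the class of [z0] survives only
   for [t] in that class. With [PP'], block row sums are constant on a class. *)
have PP x x' : E x x' -> P x = P x * P x'.
  move=> xx'; rewrite -{1}PM -(pm_rsum hu x') mulr_suml [RHS]mulr_suml.
  apply: eq_bigr => z; rewrite inE => zz; rewrite !mulr_sumr.
  rewrite [LHS](bigID (fun t => t \in [set z | E' z0 z])) /= [X in _ + X]big1
    ?addr0 //.
  move=> t; rewrite inE => nt; apply: hE; rewrite xx'.
  by apply: contra nt => /eqP/esym; apply: E't.
have PP' x x' : E x x' -> P x' = P x * P x'.
  move=> xx'; rewrite -{1}MP -(pm_rsum hu x) mulr_suml.
  rewrite [LHS](bigID (fun t => t \in [set z | E' z0 z])) /= [X in _ + X]big1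
    ?addr0.
    by rewrite [RHS]mulr_suml.
  move=> t; rewrite inE => nt; rewrite mulr_sumr big1 // => z;
    rewrite inE => zz.
  apply: hE; rewrite xx'; apply: contra nt => /eqP/esym.
  by rewrite E's; apply: E't.
have Peq x : E x0 x -> P x = P x0 by move=> xx; rewrite (PP' x0 x xx) -PP.
have PQ z : E' z0 z -> P x0 = P x0 * Q z.
  move=> zz; rewrite -{1}PM -(pm_csum hu z) mulr_suml [RHS]mulr_suml.
  apply: eq_bigr => t; rewrite inE => tt; rewrite !mulr_sumr.
  rewrite [LHS](bigID (fun t => t \in [set x | E x0 x])) /= [X in _ + X]big1
    ?addr0 //.
  move=> x; rewrite inE => nx; apply: hE; rewrite (negPf nx).
  by rewrite (E't z0) // E's.
have PQ' z : E' z0 z -> Q z = P x0 * Q z.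
  move=> zz; rewrite -{1}MQ -(pm_rsum hu x0) mulr_suml.
  rewrite [LHS](bigID (fun t => t \in [set z | E' z0 z])) /= [X in _ + X]big1
    ?addr0.
    by rewrite [RHS]mulr_suml.
  move=> t; rewrite inE => nt; rewrite mulr_sumr big1 // => x;
    rewrite inE => xx.
  apply: hE; rewrite xx; apply: contra nt => /eqP/esym.
  by rewrite E's => h; apply: E't zz h.
exists (P x0).
  (* Left multiplication by [P x0] fixes [u x0 z0], so [P x0] cannot vanish. *)
  apply: contra u0 => /eqP P0; have : P x0 * u x0 z0 = 0 by rewrite P0 mul0r.
  rewrite mulr_suml (bigD1 z0) ?inE //= (pm_idem hu) big1 ?addr0 => [->//|z].
  by move=> /andP[_ zz]; rewrite (pm_row hu) (negPf zz).
apply: pmagic_sub => [x|z]; rewrite inE; first exact: Peq.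
by move=> zz; rewrite -/(Q z) (PQ' z zz) -PQ.
Qed.

End PmagicBlock.

Variables (G H : cgraph) (p : A) (u : G -> H -> A).
Hypothesis hu : pmagic p u.

Lemma cpres_sub (S : {set G}) (T : {set H}) : cpres u ->
  @cpres C A (ind S) (ind T) (fun x z => u (val x) (val z)).
Proof.
by move=> [he hc]; split=> [x y z w|x z]; [exact: he | exact: hc].
Qed.

End Blocks.

Lemma ciso_cadd G1 G2 H1 H2 : ciso G1 H1 -> ciso G2 H2 ->
  ciso (cadd G1 G2) (cadd H1 H2).
Proof.
move=> [f [[f' fK fK'] fe fc]] [g [[g' gK gK'] ge gc]].
exists (fun x => match x with inl x => inl (f x) | inr x => inr (g x) end);
  split.
- exists (fun x => match x with inl x => inl (f' x) | inr x => inr (g' x) end).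
    by move=> [x|x]; rewrite ?fK ?gK.
  by move=> [x|x]; rewrite ?fK' ?gK'.
- by move=> [x|x] [y|y] /=; rewrite ?fe ?ge.
- by move=> [x|x] /=; rewrite ?fc ?gc.
Qed.

Lemma ciso_card G H : ciso G H -> #|G| = #|H|.
Proof. by move=> [f [fb _ _]]; apply: bij_eq_card fb. Qed.

(** * Isomorphisms as permutation matrices *)

Section CisoPres.
Variables (C : numClosedFieldType) (G H : cgraph) (f : G -> H).
Hypothesis fb : bijective f.

Definition perm_magic (x : G) (z : H) : C^o := (f x == z)%:R.

Lemma perm_pmagic : pmagic (1 : C^o) perm_magic.
Proof.
have s1 (X : finType) (F : X -> C^o) (P : pred X) a :
    (forall x, P x = (x == a)) -> \sum_x (P x)%:R = 1 :> C^o.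
  move=> Pa; rewrite (bigD1 a) //= Pa eqxx big1 ?addr0 // => x xa.
  by rewrite Pa (negPf xa).
have fI := bij_inj fb; rewrite /perm_magic.
split=> [x z z'|x x' z|x|z].
- rewrite -natrM mulnb; case: (eqVneq z z') => [<-|zz]; first by rewrite andbb.
  by case: eqP => //= ->; rewrite (negPf zz).
- rewrite -natrM mulnb; case: (eqVneq x x') => [<-|xx]; first by rewrite andbb.
  by case: eqP => //= <-; rewrite (inj_eq fI) eq_sym (negPf xx).
- by apply: (s1 _ (fun=> 0) _ (f x)) => z; rewrite eq_sym.
- case: fb => g fK gK; apply: (s1 _ (fun=> 0) _ (g z)) => x.
  by rewrite -(inj_eq fI) gK.
Qed.

(** Since 1 is nonzero in [C], preservation by a permutation matrix is the classical notion. Undoing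
    a complement or a cut is thus proved once, for matrices, and also holds for isomorphisms. *)
Lemma perm_cpres : {mono f : x y / cedge x y} /\ (forall x,
  ccol (f x) = ccol x) <->
  cpres perm_magic.
Proof.
rewrite /perm_magic; split=> [[fe fc]|[he hc]].
  split=> [x y z w|x z]; rewrite -?natrM ?mulnb.
    case: (eqVneq (f x) z) => // <-; case: (eqVneq (f y) w) => // <-.
    by rewrite fe eqxx.
  by case: (eqVneq (f x) z) => // <-; rewrite fc eqxx.
have n1 : (1 : C^o) != 0 by exact: oner_neq0.
split=> [x y|x].
  apply/eqP/negPn/negP; rewrite eq_sym => /he.
  by rewrite !eqxx mulr1 => /eqP; rewrite (negPf n1).
apply/eqP/negPn/negP; rewrite eq_sym => /hc.
by rewrite eqxx => /eqP; rewrite (negPf n1).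
Qed.

End CisoPres.

(* A bijection is a magic matrix with entries in C. *)
Lemma ciso_reflect (C : numClosedFieldType) (V W : finType) e c e' c' d k d' k'
  :
  (forall u : V -> W -> C^o, pmagic (1 : C^o) u ->
     @cpres C C^o (CGraph e' c') (CGraph d' k') u ->
     @cpres C C^o (CGraph e c) (CGraph d k) u) ->
  ciso (@CGraph V e' c') (@CGraph W d' k') -> ciso (CGraph e c) (CGraph d k).
Proof.
move=> h [f [fb fe fc]]; exists f.
have h1 := perm_pmagic C (G := CGraph e c) (H := CGraph d k) fb.
have /(h _ h1) h2 := (perm_cpres C (G := CGraph e' c') (H := CGraph d' k') f).1
  (conj fe fc).
by have [] := (perm_cpres C (G := CGraph e c) (H := CGraph d k) f).2 h2.
Qed.

(** * Superrigidity *)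

Lemma component_eq (G : cgraph) (x y : G) : simple (@cedge G) ->
  connect (@cedge G) x y -> component x = component y.
Proof.
move=> [gs _] xy; apply/setP => z; rewrite !inE.
exact: (same_connect (sym_connect_sym gs) xy z).
Qed.

Lemma card_component_lt (G : cgraph) (x : G) : simple (@cedge G) ->
  ~ connected (@cedge G) -> (#|ind (component x)| < #|G|)%N.
Proof.
move=> [gs _] nc; rewrite card_ind -cardsT; apply: proper_card.
rewrite properT; apply/eqP => cT; apply: nc => y z.
have cx w : connect (@cedge G) x w.
  by have := in_setT w; rewrite -cT inE.
by apply: connect_trans (cx z); rewrite (sym_connect_sym gs).
Qed.

Lemma tree_like_ind (G : cgraph) (S : {set G}) :
  tree_like (@cedge G) -> tree_like (@cedge (ind S)).
Proof. exact: tree_like_relpre val_inj. Qed.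

(** The reference component lies in [G] but the set is taken in [H], so that one isomorphism type of
    components can be compared in both graphs. *)
Definition twins (G H : cgraph) (x0 : G) : {set H} :=
  [set y | `[< ciso (ind (component x0)) (ind (component y)) >]].

Lemma twins_closed (G H : cgraph) (x0 : G) : simple (@cedge H) ->
  cclosed (twins H x0).
Proof. by move=> hsi x y; rewrite !inE => h /(component_eq hsi) <-. Qed.

Lemma twins_copies (G H : cgraph) (x0 : G) : simple (@cedge H) ->
  exists n, ciso (ccopies n (ind (component x0))) (ind (twins H x0)).
Proof.
move=> hsi; apply: ciso_copies => //; first exact: twins_closed.
by move=> x; rewrite inE => /asboolP.
Qed.

Lemma card_ccopies n G : #|ccopies n G| = (n * #|G|)%N.
Proof. by rewrite card_prod card_ord. Qed.

Section Superrigid.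
Variables (C : numClosedFieldType) (A : starAlgType C).

(** The algebra is fixed while [p] varies, because blocks between components have their own [p]. *)
Definition rigid_below n := forall (G H : cgraph) (p : A) (u : G -> H -> A),
  (#|G| < n)%N -> tree_like (@cedge G) -> tree_like (@cedge H) ->
  p != 0 -> pmagic p u -> cpres u -> ciso G H.

Section Step.
Variables (G H : cgraph).
Hypothesis IH : rigid_below #|G|.
Hypotheses (tG : tree_like (@cedge G)) (tH : tree_like (@cedge H)).

(** By [pmagic_block], a nonzero entry gives a magic matrix with nonzero corner between the two
    components; disconnectedness makes the component of [x] smaller than [G]. *)
Lemma component_ciso (p : A) (u : G -> H -> A) : pmagic p u -> cpres u ->
  ~ connected (@cedge G) ->
  forall x z, u x z != 0 -> ciso (ind (component x)) (ind (component z)).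
Proof.
move=> hu hp nc x z u0; have [gsi hsi] := (tG.1, tH.1).
have [q q0 hq] := pmagic_block hu (sym_connect_sym gsi.1) (@connect_trans _ _)
  (sym_connect_sym hsi.1) (@connect_trans _ _) (pres_connect hu hp.1)
  (connect0 _ _) (connect0 _ _) u0.
pose u' (a : ind (component x)) (b : ind (component z)) := u (val a) (val b).
have h1 : cpres u' by exact: cpres_sub.
exact: (@IH _ _ q u' (card_component_lt x gsi nc) (tree_like_ind _ tG)
  (tree_like_ind _ tH) q0 hq h1).
Qed.

Lemma twins_mixing (p : A) (u : G -> H -> A) : pmagic p u -> cpres u ->
  ~ connected (@cedge G) ->
  forall (x0 : G) x z, (x \in twins G x0) != (z \in twins H x0) -> u x z = 0.
Proof.
move=> hu hp nc x0 x z ne; apply/eqP/negPn/negP => u0; case/negP: ne.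
have i := component_ciso hu hp nc u0; rewrite !inE; apply/eqP/asbool_equiv_eq.
by split=> h; apply: ciso_trans h _ => //; apply: ciso_sym.
Qed.

(** The components of one isomorphism type are matched with those of the same type in [H]. Equal
    orders force equal numbers of copies, and the rest of [G] is smaller. *)
Lemma disconnected_ciso (p : A) (u : G -> H -> A) : p != 0 -> pmagic p u ->
  cpres u -> ~ connected (@cedge G) -> ciso G H.
Proof.
move=> p0 hu hp nc; have [gsi hsi] := (tG.1, tH.1).
have [x0 _] : exists x : G, true.
  by apply: contrapT => no; apply: nc => x; case: no; exists x.
have mix := twins_mixing hu hp nc (x0 := x0).
set S := twins G x0 in mix *; set T := twins H x0 in mix *.
have hST := pmagic_sub_closed hu mix.
have [n isoS] := twins_copies x0 gsi; have [m isoT] := twins_copies x0 hsi.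
have x0S : x0 \in S by rewrite inE; apply/asboolP/ciso_refl.
have nm : n = m.
  have := pm_eq_card hST p0.
  rewrite -[LHS](ciso_card isoS) -[RHS](ciso_card isoT) !card_ccopies => /eqP.
  rewrite eqn_pmul2r => [/eqP //|].
  by rewrite card_ind; apply/card_gt0P; exists x0; rewrite inE connect0.
have i1 : ciso (ind S) (ind T).
  by apply: ciso_trans (ciso_sym isoS) _; rewrite nm.
have mixC x z : (x \in ~: S) != (z \in ~: T) -> u x z = 0.
  by rewrite !in_setC => ne; apply: mix; apply: contra ne => /eqP ->.
have i2 : ciso (ind (~: S)) (ind (~: T)).
  pose u' (a : ind (~: S)) (b : ind (~: T)) := u (val a) (val b).
  have h1 : cpres u' by exact: cpres_sub.
  apply: (@IH _ _ p u' _ (tree_like_ind _ tG) (tree_like_ind _ tH) p0 _ h1).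
    rewrite card_ind -cardsT; apply: proper_card.
    by rewrite properT; apply/eqP => e; have := in_setT x0; rewrite -e inE x0S.
  exact: (pmagic_sub_closed hu mixC).
have sG : ciso (cadd (ind S) (ind (~: S))) G.
  by exists (unsplit_set S); apply: ciso_split => //; exact: (twins_closed gsi).
have sH : ciso (cadd (ind T) (ind (~: T))) H.
  by exists (unsplit_set T); apply: ciso_split => //; exact: (twins_closed hsi).
exact: ciso_trans (ciso_sym sG) (ciso_trans (ciso_cadd i1 i2) sH).
Qed.

End Step.
End Superrigid.

Section MedianCases.
Variable G : cgraph.
Hypotheses (gsi : simple (@cedge G)) (ac : acyclic (@cedge G)).

Lemma split_tree_like : tree_like (@cedge (split_median G)).
Proof.
apply: acyclic_tree_like; last by apply: sub_acyclic ac => x y /andP[].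
by split=> [x y|x] /=; rewrite ?gsi.2 // gsi.1 andbC [X in ~~ X]andbC andbC.
Qed.

Lemma isolate_tree_like : tree_like (@cedge (isolate_median G)).
Proof.
apply: acyclic_tree_like; last by apply: sub_acyclic ac => x y /andP[].
by split=> [x y|x] /=; rewrite ?gsi.2 // gsi.1 orbC.
Qed.

(** A path remaining between two medians would form a cycle with the removed edge joining them. *)
Lemma split_disconnected a b : connected (@cedge G) ->
  median (@cedge G) a -> median (@cedge G) b -> a != b ->
  ~ connected (@cedge (split_median G)).
Proof.
move=> co ma mb ab /(_ a b)/connectP[p ep lb].
have eab := median_clique gsi ac co ma mb ab.
case/shortenP: ep lb => q eq uq _ lb.
have eq' : path (@cedge G) a q by apply: sub_path eq => x y /andP[].
have /ac : ucycle (@cedge G) (a :: q).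
  by rewrite /ucycle uq andbT /= rcons_path eq' -lb gsi.1 eab.
case: q eq lb {uq eq'} => [|y [|z q]] //= => [_ e|/andP[/andP[_ h] _] e _].
  by rewrite e eqxx in ab.
by rewrite -e ma mb in h.
Qed.

Lemma isolate_disconnected a : (1 < #|G|)%N -> median (@cedge G) a ->
  ~ connected (@cedge (isolate_median G)).
Proof.
move=> G1 ma co; have [b ab] : exists b : G, b != a.
  have : (0 < #|predC1 a|)%N by rewrite cardC1 -subn1 subn_gt0.
  by case/card_gt0P => b; rewrite inE; exists b.
have /connectP[[|y p]] := co a b; first by move=> _ /= ba;
  rewrite ba eqxx in ab.
by rewrite /= ma orTb andbF.
Qed.

End MedianCases.

Definition single_median (G : cgraph) :=
  exists a : G, forall x, median (@cedge G) x = (x == a).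

Lemma median_cases (G : cgraph) (x0 : G) :
  single_median G \/
  exists a b : G, [/\ median (@cedge G) a, median (@cedge G) b & a != b].
Proof.
have [a ma] := median_ex (@cedge G) x0.
case: (pselect (exists2 b, median (@cedge G) b & a != b)) => [[b mb ab]|no].
  by right; exists a, b.
left; exists a => x; apply/idP/eqP => [mx|->//]; apply/eqP/negPn/negP => xa.
by apply: no; exists x; rewrite // eq_sym.
Qed.

Section Superrigidity.
Variables (C : numClosedFieldType) (A : starAlgType C).

Section Pair.
Variables (G H : cgraph) (p : A) (u : G -> H -> A).
Hypotheses (p0 : p != 0) (hu : pmagic p u) (hp : cpres u).

Lemma small_ciso : (#|G| <= 1)%N -> irreflexive (@cedge G) ->
  irreflexive (@cedge H) -> ciso G H.
Proof.
move=> G1 gi hi; have c := pm_eq_card hu p0.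
have [f hf] := choice (fun x => pm_entry_neq0 hu x p0).
have H1 : (#|H| <= 1)%N by rewrite -c.
have Geq (x y : G) : x = y by move/card_le1_eqP: G1; apply.
have Heq (x y : H) : x = y by move/card_le1_eqP: H1; apply.
exists f; split.
- by apply: inj_card_bij; [move=> x y _; exact: Geq | rewrite c].
- by move=> x y; rewrite (Geq x y) gi hi.
- move=> x; apply/eqP; rewrite eq_sym; apply/negPn/negP => /hp.2 e.
  by have := hf x; rewrite e eqxx.
Qed.

(** Restricted to the medians of both graphs, [u] is still magic with the same nonzero [p], so there
    are equally many. *)
Lemma single_median_transfer : single_median G -> single_median H.
Proof.
move=> [a ha]; have hm := vpres_median hu hp.1.
have [z0 uz] := pm_entry_neq0 hu a p0; exists z0.
have mz x z : u x z != 0 -> median (@cedge H) z = median (@cedge G) x.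
  move=> u0; apply/eqP; rewrite eq_sym; apply/negPn/negP => /hm e.
  by rewrite e eqxx in u0.
have hmS x z : (x \in [set x | median (@cedge G) x]) !=
               (z \in [set z | median (@cedge H) z]) -> u x z = 0.
  by rewrite !in_set; apply: hm.
have cm : #|ind [set x | median (@cedge G) x]| = #|ind [set x | median (@cedge
  H) x]|.
  exact: pm_eq_card (pmagic_sub_closed hu hmS) p0.
have /eqP/cards1P[z1 e1] : #|[set x | median (@cedge H) x]| = 1%N.
  rewrite -card_ind -cm card_ind; apply/eqP/cards1P; exists a.
  by apply/setP => x; rewrite in_set in_set1 ha.
have m1 z : median (@cedge H) z = (z == z1) by rewrite -in_set1 -e1 in_set.
move=> z; rewrite m1; congr (_ == _).
by apply/eqP; rewrite eq_sym -m1 (mz _ _ uz) ha.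
Qed.

Hypothesis IH : rigid_below A #|G|.

(** The cut graph has order [#|G|] but is disconnected, so rigidity below [#|G|] is enough. Only
    simplicity of [H] is assumed: connectedness and acyclicity come from [G], the latter through
    [unique_lower_transfer]. *)
Lemma tree_ciso : simple (@cedge G) -> acyclic (@cedge G) ->
  connected (@cedge G) -> (1 < #|G|)%N -> simple (@cedge H) -> ciso G H.
Proof.
move=> gsi gac gco G1 hsi.
have hco : connected (@cedge H) by apply/(connected_transfer hu hp.1).
have cGH := pm_eq_card hu p0.
have /card_gt0P[x0 _] : (0 < #|G|)%N by exact: ltnW.
have /card_gt0P[z0 _] : (0 < #|H|)%N by rewrite -cGH ltnW.
have hac : acyclic (@cedge H).
  apply: (@height_acyclic _ _ (dist (@cedge H) z0)); first exact: hsi.1.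
  apply: (unique_lower_transfer hu hp.1 p0 gsi.1 hsi.1) => w.
  exact: (@tree_unique_lower _ _ gsi gac gco w).
case: (median_cases x0) => [sG|[a [b [ma mb ab]]]].
  have sH := single_median_transfer sG; have [a ha] := sG.
  have i : ciso (isolate_median G) (isolate_median H).
    apply: (@disconnected_ciso _ _ (isolate_median G) (isolate_median H)
      IH (isolate_tree_like gsi gac) (isolate_tree_like hsi hac) p u p0 hu).
      exact: (cpres_isolate hu hp).
    by apply: (isolate_disconnected (a := a) G1); rewrite ha.
  case: (G) (H) i gsi hsi sG sH => [V e c] [W e' c'] i gsi hsi sG sH.
  apply: (ciso_reflect (C := C)) i => v hv;
    exact: (cpres_isolateK gsi hsi sG sH).
have i : ciso (split_median G) (split_median H).
  apply: (@disconnected_ciso _ _ (split_median G) (split_median H)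
    IH (split_tree_like gsi gac) (split_tree_like hsi hac) p u p0 hu).
    exact: (cpres_split hu hp).
  exact: (split_disconnected gsi gac gco ma mb ab).
have cG := @median_clique _ _ gsi gac gco.
have cH := @median_clique _ _ hsi hac hco.
case: (G) (H) i gsi hsi cG cH => [V e c] [W e' c'] i gsi hsi cG cH.
apply: (ciso_reflect (C := C)) i => v hv;
  apply: (@cpres_splitK _ _ (CGraph e c) (CGraph e' c') _ _ hv) => //.
  exact: gsi.2.
exact: hsi.2.
Qed.

End Pair.

Lemma ciso_compl G H : irreflexive (@cedge G) -> irreflexive (@cedge H) ->
  ciso (ccompl G) (ccompl H) -> ciso G H.
Proof.
case: G H => [V e c] [W e' c'] gi hi.
by apply: (ciso_reflect (C := C)) => v hv;
  exact: (@cpres_complK _ _ (CGraph e c) (CGraph e' c') _ _ hv gi hi).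
Qed.

Theorem superrigidity n : rigid_below A n.
Proof.
elim: n => [|n IHn] G H p u //; rewrite ltnS leq_eqVlt => /orP[/eqP cG|];
  last exact: IHn.
rewrite -cG in IHn; move=> tG tH p0 hu hp; have [gsi hsi] := (tG.1, tH.1).
(* Isolating the median of a one-vertex graph would not disconnect it. *)
have [G1|G1] := leqP #|G| 1; first exact: small_ciso p0 hu hp G1 gsi.2 hsi.2.
case: (pselect (connected (@cedge G))) => [co|nc]; last first.
  exact: (disconnected_ciso IHn tG tH p0 hu hp nc).
have hpc := cpres_compl hu hp.
have tGc := tree_like_compl tG; have tHc := tree_like_compl tH.
case: (pselect (connected (@cedge (ccompl G)))) => [coc|nc]; last first.
  apply: ciso_compl; [exact: gsi.2|exact: hsi.2|].
  exact: (@disconnected_ciso _ _ (ccompl G) (ccompl H) IHn tGc tHc p u p0 hu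
    hpc nc).
(* The graph and its complement are both connected, so [tree_like] at the identity embedding makes
   one of them a tree. *)
have [ac|ac] := tG.2 _ id (@inj_id _) co coc.
  exact: (tree_ciso p0 hu hp IHn gsi ac co G1 hsi).
apply: ciso_compl; [exact: gsi.2|exact: hsi.2|].
exact: (@tree_ciso (ccompl G) (ccompl H) p u p0 hu hpc IHn tGc.1 ac coc G1
  tHc.1).
Qed.

End Superrigidity.

(** * Decomposition of the quantum automorphism groups *)

Section Decompose.
Variable C : numClosedFieldType.

Lemma cpres_reindex (A : starAlgType C) (G H : cgraph) (f : G -> H)
    (u : H -> H -> A) :
  {mono f : x y / cedge x y} -> (forall x, ccol (f x) = ccol x) ->
  cpres u -> @cpres C A G G (fun x y => u (f x) (f y)).
Proof.
move=> fe fc [he hc]; split=> [x y z w ne|x z ne].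
  by apply: he; rewrite !fe.
by apply: hc; rewrite !fc.
Qed.

Lemma is_Q_split (X Y : qpgroup C) (G : cgraph) (S : {set G}) :
  simple (@cedge G) -> cclosed S ->
  (forall (A : starAlgType C) (u : G -> G -> A), magic u -> cpres u ->
     forall x z, (x \in S) != (z \in S) -> u x z = 0) ->
  is_Q X (ind S) -> is_Q Y (ind (~: S)) -> is_Q (qfree X Y) G.
Proof.
move=> gsi cS mix qX qY.
have [fb fe fc] := ciso_split gsi cS; set f := unsplit_set S in fb fe fc.
have iso : ciso (cadd (ind S) (ind (~: S))) G by exists f.
apply: (is_Q_ciso iso); apply: (is_Q_free _ qX qY) => A u um up x y.
case: (fb) => g' fK gK.
have gb' : bijective g' by exists f.
have ge' : {mono g' : x y / cedge x y} by move=> a b; rewrite -fe !gK.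
have gc' a : ccol (g' a) = ccol a by rewrite -fc gK.
have wm := magic_reindex gb' um; have wp := cpres_reindex ge' gc' up.
have xS := valP x; have yS : val y \notin S by have := valP y; rewrite inE.
have e1 : g' (val x) = inl x := fK (inl x).
have e2 : g' (val y) = inr y := fK (inr y).
split.
  by have := mix A _ wm wp (val x) (val y); rewrite e1 e2; apply;
    rewrite xS (negPf yS).
by have := mix A _ wm wp (val y) (val x); rewrite e1 e2; apply;
  rewrite xS (negPf yS).
Qed.

Lemma connect_ccopies n (K : cgraph) : connected (@cedge K) ->
  connect (@cedge (ccopies n K)) =2 (fun x y => x.1 == y.1).
Proof.
move=> co [i k] [j l] /=; apply/idP/eqP => [/connectP[p ep lp]|<-].
  elim: p i k ep lp => [|[i' k'] p IHp] i k /=; first by move=> _ [->].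
  by move=> /andP[/andP[/eqP -> _] ep] /(IHp _ _ ep).
have /connectP[p ep ->] := co k l.
apply/connectP; exists [seq (i, k) | k <- p];
  last by rewrite (last_map (pair i)).
elim: p k ep => //= k' p IHp k /andP[kk ep].
by rewrite eqxx kk; apply: IHp.
Qed.

Lemma is_Q_copies (X : qpgroup C) n (n0 : (0 < n)%N) (K : cgraph) :
  (0 < #|K|)%N -> connected (@cedge K) ->
  is_Q X K -> is_Q (qwreath X n0) (ccopies n K).
Proof.
move=> K0 co; apply: is_Q_wreath => // A u um up.
have h := pres_connect (magic_pmagic um) up.1.
exact: (eq_pres h (connect_ccopies co) (connect_ccopies co)).
Qed.

Variable F : qpgroup C -> Prop.
Hypothesis hF : free_wreath_stable F.

Definition realized n := forall G : cgraph, tree_like (@cedge G) ->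
  (0 < #|G| < n)%N -> exists2 X, F X & is_Q X G.

(** The components isomorphic to that of [x0] are copies of one connected graph and give the wreath
    product; superrigidity keeps them apart from the others, which gives the free product. *)
Lemma disconnected_realized (G : cgraph) : realized #|G| ->
  tree_like (@cedge G) -> (0 < #|G|)%N -> ~ connected (@cedge G) ->
  exists2 X, F X & is_Q X G.
Proof.
move=> IH tG /card_gt0P[x0 _] nc; have gsi := tG.1.
have [n iso] := twins_copies x0 gsi; set S := twins G x0 in iso.
have cS : cclosed S := twins_closed gsi.
have x0S : x0 \in S by rewrite inE; apply/asboolP/ciso_refl.
have K0 : (0 < #|ind (component x0)|)%N.
  by rewrite card_ind; apply/card_gt0P; exists x0; rewrite inE connect0.
have [|X0 FX0 qX0] := IH _ (tree_like_ind (component x0) tG).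
  by rewrite K0 card_component_lt.
have n0 : (0 < n)%N.
  case: n iso => // /ciso_card; rewrite card_ccopies mul0n card_ind =>
    /esym/eqP.
  by rewrite cards_eq0 => /eqP S0; rewrite S0 inE in x0S.
have FX1 := stable_wreath hF n0 FX0.
have qX1 : is_Q (qwreath X0 n0) (ind S).
  apply: (is_Q_ciso iso); apply: is_Q_copies => //.
  exact: component_connected.
have mix : forall (A : starAlgType C) (u : G -> G -> A), magic u -> cpres u ->
    forall x z, (x \in S) != (z \in S) -> u x z = 0.
  move=> A u um up; have hu := magic_pmagic um.
  exact: (twins_mixing (@superrigidity C A #|G|) tG tG hu up nc).
(* If all components are isomorphic there is no second factor, and the induction hypothesis only
   speaks of nonempty graphs. *)
case: (set_0Vmem (~: S)) => [SC0|[y yS]].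
  exists (qwreath X0 n0) => //; apply: (is_Q_ciso _ qX1).
  have ST x : x \in S by apply/negPn/negP => xS; have := in_set0 x;
    rewrite -SC0 inE xS.
  exists val; split=> //; apply: surj_inj_bij; first exact: val_inj.
  by move=> x; exists (exist _ x (ST x)).
have [|X2 FX2 qX2] := IH _ (tree_like_ind (~: S) tG).
  rewrite !card_ind -cardsT; apply/andP; split; first by apply/card_gt0P;
    exists y.
  apply: proper_card; rewrite properT; apply/eqP => e.
  by have := in_setT x0; rewrite -e inE x0S.
exists (qfree (qwreath X0 n0) X2); first exact: stable_free.
exact: (is_Q_split gsi cS mix qX1 qX2).
Qed.

Lemma is_Q_compl (X : qpgroup C) (G : cgraph) : simple (@cedge G) ->
  is_Q X (ccompl G) -> is_Q X G.
Proof.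
case: G => V e c gsi; apply: is_Q_equiv => A u um; have hu := magic_pmagic um.
split; last exact: (cpres_compl (G := CGraph e c) (H := CGraph e c) hu).
exact: (@cpres_complK _ _ (CGraph e c) (CGraph e c) _ _ hu gsi.2 gsi.2).
Qed.

Lemma is_Q_split_median (X : qpgroup C) (G : cgraph) : simple (@cedge G) ->
  acyclic (@cedge G) -> connected (@cedge G) ->
  is_Q X (split_median G) <-> is_Q X G.
Proof.
case: G => V e c gsi ac co; have cl := @median_clique _ _ gsi ac co.
suff h (A : starAlgType C) (u : V -> V -> A) : magic u ->
    @cpres C A (CGraph e c) (CGraph e c) u <->
      @cpres C A (split_median (CGraph e c)) (split_median (CGraph e c)) u.
  split; first by apply: is_Q_equiv => A u um; split; move/(h A u um).
  by apply: is_Q_equiv => A u um; split; move/(h A u um).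
move=> um; have hu := magic_pmagic um; split.
  exact: (@cpres_split _ _ (CGraph e c) (CGraph e c) _ _ hu).
exact: (@cpres_splitK _ _ (CGraph e c) (CGraph e c) _ _ hu gsi.2 gsi.2 cl cl).
Qed.

Lemma is_Q_isolate_median (X : qpgroup C) (G : cgraph) : simple (@cedge G) ->
  single_median G ->
  is_Q X (isolate_median G) -> is_Q X G.
Proof.
case: G => V e c gsi sm; apply: is_Q_equiv => A u um;
  have hu := magic_pmagic um.
split; first exact: (cpres_isolateK gsi gsi sm sm).
exact: (@cpres_isolate _ _ (CGraph e c) (CGraph e c) _ _ hu).
Qed.

Lemma tree_realized (G : cgraph) : realized #|G| -> simple (@cedge G) ->
  acyclic (@cedge G) -> connected (@cedge G) -> (1 < #|G|)%N ->
  exists2 X, F X & is_Q X G.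
Proof.
move=> IH gsi ac co G1; have G0 := ltnW G1; have /card_gt0P[x0 _] := G0.
case: (median_cases x0) => [sG|[a [b [ma mb ab]]]].
  have [X FX qX] : exists2 X, F X & is_Q X (isolate_median G).
    apply: (@disconnected_realized (isolate_median G) IH (isolate_tree_like gsi
      ac) G0).
    by have [a ha] := sG; apply: (isolate_disconnected (a := a) G1); rewrite ha.
  by exists X => //; exact: is_Q_isolate_median.
have [X FX qX] : exists2 X, F X & is_Q X (split_median G).
  apply: (@disconnected_realized (split_median G) IH (split_tree_like gsi ac)
    G0).
  exact: (split_disconnected gsi ac co ma mb ab).
by exists X => //; apply/is_Q_split_median.
Qed.

Theorem tree_like_realized n : realized n.
Proof.
elim: n => [|n IHn] G tG; first by rewrite ltn0 andbF.
move=> /andP[G0]; rewrite ltnS leq_eqVlt => /orP[/eqP cG|lt]; last first.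
  by apply: IHn => //; rewrite G0.
rewrite -cG in IHn; have gsi := tG.1.
move: (G0); rewrite leq_eqVlt => /orP[/eqP G1|G1].
  exists (trivial_qpg C); first exact: stable_trivial.
  exact: is_Q_trivial.
case: (pselect (connected (@cedge G))) => [co|nc];
  last exact: disconnected_realized.
have tGc := tree_like_compl tG.
suff [X FX qX] : exists2 X, F X & is_Q X G \/ is_Q X (ccompl G).
  by exists X => //; case: qX => // /(is_Q_compl gsi).
case: (pselect (connected (@cedge (ccompl G)))) => [coc|nc]; last first.
  have [X FX qX] := @disconnected_realized (ccompl G) IHn tGc G0 nc.
  by exists X => //; right.
have [ac|ac] := tG.2 _ id (@inj_id _) co coc.
  by have [X FX qX] := tree_realized IHn gsi ac co G1; exists X => //; left.
have [X FX qX] := @tree_realized (ccompl G) IHn tGc.1 ac coc G1.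
by exists X => //; right.
Qed.

End Decompose.

(** * Tree-cographs *)

Local Open Scope nat_scope.

Lemma eq_tree_like (V : finType) (e e' : rel V) : e =2 e' -> tree_like e ->
  tree_like e'.
Proof.
move=> ee; suff -> : e = e' by [].
by apply: funext => x; apply: funext => y; exact: ee.
Qed.

Lemma sgraph_simple (G : sgraph) : simple (@edge G).
Proof. by split; [exact: edge_sym | exact: edge_irrefl]. Qed.

(** A connected induced subgraph of a disjoint union lies in a single summand. *)
Lemma union_tree_like n (G : 'I_n.+1 -> sgraph) :
  (forall i, tree_like (@edge (G i))) -> tree_like (@edge (graph_union G)).
Proof.
move=> h; split; first exact: sgraph_simple.
move=> U f fI co coc.
have [u0|U0] := pselect (exists u : U, True); last first.
  by left => -[|u c] // _; case: U0; exists u.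
case: u0 => u0 _; pose i := tag (f u0).
have tagE u : tag (f u) = i.
  have /connectP[p ep ->] := co u0 u; rewrite /i.
  elim: p u0 ep {i} => //= v p IHp w /andP[/andP[/eqP e _] ep].
  by rewrite (IHp v ep) e.
have /choice[g gE] : forall u, exists x : G i,
  f u = Tagged (fun i => G i : Type) x.
  by move=> u; have := tagE u; case: (f u) => j x /= e; subst j; exists x.
have gI : injective g by move=> u v e; apply: fI; rewrite !gE e.
have e1 : relpre f (@edge (graph_union G)) =2 relpre g (@edge (G i)).
  by move=> u v /=; rewrite !gE /union_edge /= eqxx tagged_asE.
have e2 : relpre f (compl_rel (@edge (graph_union G))) =2
          relpre g (compl_rel (@edge (G i))).
  move=> u v; rewrite /= /compl_rel (inj_eq fI) -(inj_eq gI); congr (_ && ~~ _).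
  exact: e1.
have [ac|ac] := (h i).2 U g gI (eq_connected e1 co) (eq_connected e2 coc).
  by left; apply: eq_acyclic ac => u v; rewrite e1.
by right; apply: eq_acyclic ac => u v; rewrite e2.
Qed.

Lemma tree_cograph_tree_like G : tree_cograph G -> tree_like (@edge G).
Proof.
elim=> {G} [G [co ac]|n G _ h|G _ h|G H [f [g fK gK] fe] _ h].
- exact: acyclic_tree_like (sgraph_simple G) ac.
- exact: union_tree_like.
- exact: tree_like_compl h.
- apply: eq_tree_like (tree_like_relpre (can_inj gK) h) => x y /=.
  by rewrite -fe !gK.
Qed.

(** * Attaching a spine to a rooted forest *)

Section DistSym.
Variables (V : finType) (e : rel V).
Hypothesis es : symmetric e.

Lemma reach_trans k l x y z : reach e k x y -> reach e l y z ->
  reach e (k + l) x z.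
Proof.
elim: l z => [|l IHl] z xy; first by rewrite addn0 => /eqP <-.
case/existsP => v /andP[/(IHl _ xy) h yz]; rewrite addnS /=.
by apply/existsP; exists v; rewrite h yz.
Qed.

Lemma reach1 x y : e x y -> reach e 1 x y.
Proof. by move=> xy; apply/existsP; exists x; rewrite /= eqxx xy orbT. Qed.

Lemma reach_sym k x y : reach e k x y -> reach e k y x.
Proof.
elim: k y => [|k IHk] y; first by rewrite /= eq_sym.
case/existsP => v /andP[/IHk h vy]; rewrite -add1n.
apply: reach_trans h; case/orP: vy => [/eqP ->|vy].
  by apply: (@reach_mono _ _ 0) => //=.
by apply: reach1; rewrite es.
Qed.

Lemma dist_sym x y : dist e x y = dist e y x.
Proof. by apply: eq_find => k; apply/idP/idP; exact: reach_sym. Qed.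

End DistSym.

Section Spine.
Variables (V : finType) (e : rel V) (fl : pred V) (M : nat).
Hypotheses (esi : simple e) (rf : rooted_forest e fl).

(* The vertex M of the path 0, ..., 2M+1 is joined to all flagged vertices.  The
   two arms have the different lengths M and M+1, so the path is rigid once M
   exceeds the order of the forest. *)
Definition spine_edge : rel (V + 'I_(M.*2.+2))%type := fun x y =>
  match x, y with
  | inl x, inl y => e x y
  | inr i, inr j => (i.+1 == j) || (j.+1 == i)
  | inl x, inr i => fl x && (i == M :> nat)
  | inr i, inl x => fl x && (i == M :> nat)
  end.

Let W : finType := (V + 'I_(M.*2.+2))%type.
Let D := M.*2.+1.

Lemma spine_simple : simple spine_edge.
Proof.
split=> [[x|i] [y|j]|[x|i]] //=; first exact: esi.1.
- by rewrite orbC.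
- exact: esi.2.
- by rewrite orbb; apply/negP => /eqP; lia.
Qed.

Definition spine (k : nat) : W := inr (inord k).

Lemma spineE (i : 'I_(M.*2.+2)) : inr i = spine i.
Proof. by rewrite /spine inord_val. Qed.

Let spine_val k : k <= D -> (inord k : 'I_(M.*2.+2)) = k :> nat.
Proof. by move=> kD; rewrite inordK. Qed.

Lemma spine_eq k l : k <= D -> l <= D -> (spine k == spine l) = (k == l).
Proof. by move=> kD lD; rewrite -[LHS]/(inord k == inord l) -val_eqE /=
  !spine_val. Qed.

Lemma spine_edgeE i j : i <= D -> j <= D ->
  spine_edge (spine i) (spine j) = (i.+1 == j) || (j.+1 == i).
Proof. by move=> iD jD; rewrite /= !spine_val. Qed.

Let r := spine M.
Let MD : M <= D. Proof. by rewrite /D; lia. Qed.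

Lemma spine_rooted : rooted_forest spine_edge (pred1 r).
Proof.
have [h [hne hc]] := rf.
(* On the path this is the absolute value of [i - M], by truncated subtraction; the forest is raised
   by one above its new root. *)
pose H (x : W) := match x with inl x => (h x).+1 | inr i =>
  (i - M) + (M - i) end.
exists H; split=> [[x|i] [y|j]|[x|i]] /=.
- by rewrite eqSS; exact: hne.
- by move=> /andP[_ /eqP ->]; lia.
- by move=> /andP[_ /eqP ->]; lia.
- by move=> /orP[]/eqP e1; apply/eqP; lia.
- case: (boolP (fl x)) (hc x) => flx /= hx; apply/eqP/cards1P.
    exists r; apply/setP => -[y|j]; rewrite !inE /=.
      rewrite ltnS; apply/negP => /andP[xy lt].
      have : y \in [set y | e x y && (h y < h x)] by rewrite inE xy lt.
      by move/eqP: hx; rewrite cards_eq0 => /eqP ->; rewrite inE.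
    apply/andP/eqP => [[/eqP jM _]|[->]]; first by rewrite spineE jM.
    by rewrite spine_val // eqxx subnn.
  move/eqP/cards1P: hx => [v hv]; exists (inl v); apply/setP => -[y|j];
    rewrite !inE /=.
    rewrite ltnS -[RHS]/(y == v) -(in_set1 y v) -hv inE.
    by [].
  by [].
- rewrite -[inr i == r]/(i == inord M) -val_eqE /= spine_val //.
  case: (ltngtP i M) => iM /=.
  + apply/eqP/cards1P; exists (spine i.+1); apply/setP => -[y|j];
      rewrite !inE /=.
      by rewrite andbF.
    rewrite -[RHS]/(j == inord i.+1) -val_eqE /= spine_val;
      last by rewrite /D; lia.
    by apply/andP/eqP => [[/orP[]/eqP]|]; lia.
  + apply/eqP/cards1P; exists (spine i.-1); apply/setP => -[y|j];
      rewrite !inE /=.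
      by rewrite andbF.
    have := ltn_ord i; rewrite -[X in _ ->
      _ = X]/(j == inord i.-1) -val_eqE /= => iD.
    rewrite spine_val; last by rewrite /D; lia.
    by apply/andP/eqP => [[/orP[]/eqP]|]; lia.
  + apply/eqP; rewrite cards_eq0; apply/eqP/setP => -[y|j]; rewrite !inE /= iM.
      by rewrite subnn ltn0 andbF.
    by rewrite subnn ltn0 andbF.
Qed.

Lemma spine_tree : acyclic spine_edge /\ connected spine_edge.
Proof. exact: rooted_tree spine_simple spine_rooted. Qed.

Let co : connected spine_edge := spine_tree.2.
Let es : symmetric spine_edge := spine_simple.1.

Lemma spine_reach i k : i + k <= D -> reach spine_edge k (spine i) (spine (i +
  k)).
Proof.
elim: k => [|k IHk] ik; first by rewrite addn0 /=.
apply: (@reachS _ _ _ _ (spine (i + k))); first by apply: IHk; lia.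
by rewrite spine_edgeE ?addnS ?eqxx //; lia.
Qed.

(** A flagged vertex is reached in fewer than [#|V|] steps, and one more step leads to the root. *)
Lemma forest_reach x : reach spine_edge #|V| (inl x) r.
Proof.
have [h [hne hc]] := rf.
have [y fy xy] : exists2 y, fl y & connect e x y.
  have [n] := ubnP (h x); elim: n x => // n IHn x lt.
  case: (boolP (fl x)) (hc x) => flx /= hx; first by exists x.
  have : 0 < #|[set y | e x y && (h y < h x)]| by rewrite hx.
  case/card_gt0P => y; rewrite inE => /andP[xy lt'].
  have [|z fz yz] := IHn y; first by lia.
  by exists z => //; apply: connect_trans (connect1 xy) yz.
have [k kV xyk] := connect_reach xy.
apply: (reach_mono kV); apply: (@reachS _ _ _ _ (inl y)).
  elim: {kV} k y {fy xy} xyk => [|k IHk] y /=; first by move/eqP ->.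
  case/existsP => v /andP[/IHk h1 vy]; apply/existsP; exists (inl v).
  by rewrite h1.
by rewrite /= fy spine_val //=.
Qed.

Lemma spine_dist i j : i <= j -> j <= D ->
  dist spine_edge (spine i) (spine j) = j - i.
Proof.
move=> ij jD; apply/eqP; rewrite eqn_leq; apply/andP; split.
  by apply: dist_le; have := @spine_reach i (j - i); rewrite subnKC //; apply.
(* Collapsing the forest onto vertex [M] of the path stretches no edge, so the forest offers no
   shortcut. *)
pose g (x : W) := match x with inl _ => M | inr i => val i end.
have := @dist_lipschitz _ _ g (spine i) (spine j) (co _ _).
rewrite /= !spine_val //; last exact: leq_trans ij jD.
move=> H; have {}H := H _; rewrite leq_subLR; apply: H.
by move=> [x|k] [y|l] //=; [move=> /andP[_ /eqP ->]|move=> /andP[_ /eqP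
  ->]|move=> /orP[]/eqP]; lia.
Qed.

Lemma spine0_dist x : M < dist spine_edge (spine 0) (inl x).
Proof.
pose g (x : W) := match x with inl _ => M.+1 | inr i => val i end.
have := @dist_lipschitz _ _ g (spine 0) (inl x) (co _ _).
rewrite /= spine_val // add0n; apply.
by move=> [y|k] [z|l] //=; [move=> /andP[_ /eqP ->]|move=> /andP[_ /eqP
  ->]|move=> /orP[]/eqP]; lia.
Qed.

Lemma spineD_dist x : M.+1 < dist spine_edge (spine D) (inl x).
Proof.
pose g (x : W) := match x with inl _ => M.+2 | inr i => D - val i end.
have := @dist_lipschitz _ _ g (spine D) (inl x) (co _ _).
rewrite /= spine_val // subnn add0n; apply.
move=> [y|k] [z|l] //=; [move=> /andP[_ /eqP ->]|move=> /andP[_ /eqP ->]|move=>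
  /orP[]/eqP]; rewrite /D; lia.
Qed.

Hypothesis VM : #|V| < M.

(** From a forest vertex the root is within [#|V|] steps and every path vertex within [#|V| + M.+1],
    which is less than [D] because [#|V| < M]. *)
Lemma forest_dist x y : dist spine_edge (inl x) y < D.
Proof.
case: y => [y|i].
  apply: (@leq_ltn_trans (#|V| + #|V|)); last by rewrite /D; lia.
  apply: dist_le; apply: reach_trans (forest_reach x) _.
  apply: reach_sym => //; exact: forest_reach.
rewrite spineE; have iD : i <= D by rewrite -ltnS.
apply: (@leq_ltn_trans (#|V| + M.+1)); last by rewrite /D; lia.
apply: dist_le; apply: reach_trans (forest_reach x) _.
case: (leqP M i) => Mi.
  apply: (@reach_mono _ _ (i - M)); first by rewrite /D in iD; lia.
  by have := @spine_reach M (i - M); rewrite subnKC //; apply.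
apply: (@reach_mono _ _ (M - i)); first by lia.
apply: reach_sym => //; have := @spine_reach i (M - i);
  rewrite subnKC ?(ltnW Mi) //.
exact.
Qed.

Let d := dist spine_edge.

(* All of these are definable from the adjacency by counting (the conjunction
   with true keeps the shape required by vpres_exists), and they determine
   every vertex of the path. *)
Definition spine_end x := [exists y, (d x y == D) && true].
Definition end_dist x := \sum_y (spine_end y * d x y).
Definition on_spine x := end_dist x == D.
Definition spine_root x :=
  on_spine x && [exists y, spine_edge x y && ~~ on_spine y].
Definition spine_start x := spine_end x && [exists y,
  (d x y == M) && spine_root y].
Definition spine_pos x := \sum_y (spine_start y * d x y).

(** The distance [D] is attained only between the two ends; pairs involving the forest are closer by
    [forest_dist]. *)
Lemma spine_endE x : spine_end x = (x == spine 0) || (x == spine D).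
Proof.
apply/existsP/orP => [[y]|]; last first.
  move=> [] /eqP ->; [exists (spine D)|exists (spine 0)]; rewrite andbT.
    by rewrite /d spine_dist // subn0.
  by rewrite /d dist_sym // spine_dist // subn0.
rewrite andbT => /eqP dxy.
case: x dxy => [x|i]; first by have := forest_dist x y; rewrite /d => + e1;
  rewrite -e1 ltnn.
case: y => [y|j] dij.
  by have := forest_dist y (inr i); rewrite dist_sym // -/d dij ltnn.
have iD : i <= D by rewrite -ltnS.
have jD : j <= D by rewrite -ltnS.
move: dij; rewrite !spineE !spine_eq // /d.
case: (leqP i j) => ij; first by rewrite spine_dist // => e1; left; apply/eqP;
  lia.
by rewrite dist_sym // spine_dist // ?(ltnW ij) // => e1; right; apply/eqP; lia.
Qed.

Lemma end_distE x : end_dist x = d x (spine 0) + d x (spine D).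
Proof.
rewrite /end_dist (bigD1 (spine 0)) //= spine_endE eqxx mul1n.
rewrite (bigD1 (spine D)) /=; last by rewrite spine_eq.
rewrite spine_endE eqxx orbT mul1n big1 ?addn0 // => y /andP[y0 yD].
by rewrite spine_endE (negPf y0) (negPf yD).
Qed.

(** On the path the distances to the two ends add up to [D]; from a forest vertex they are at least
    [M.+1] and [M.+2]. *)
Lemma on_spineE x : on_spine x = if x is inr _ then true else false.
Proof.
rewrite /on_spine end_distE /d; case: x => [x|i].
  rewrite !(dist_sym es (inl x)); have := spine0_dist x; have := spineD_dist x.
  by rewrite /D; lia.
have iD : i <= D by rewrite -ltnS.
by rewrite spineE dist_sym // !spine_dist //; apply/eqP; lia.
Qed.

Hypothesis V0 : 0 < #|V|.

Lemma spine_rootE x : spine_root x = (x == r).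
Proof.
have [h [hne hc]] := rf.
rewrite /spine_root on_spineE; case: x => [x|i] //=;
  rewrite -[RHS]/(i == inord M) -val_eqE /= spine_val //.
apply/existsP/eqP => [[[y|j]]|iM].
- by rewrite on_spineE /= andbT => /andP[_ /eqP].
- by rewrite on_spineE andbF.
have /card_gt0P[x0 _] := V0.
(* A vertex of minimal height has no lower neighbour, hence is flagged and adjacent to the root. *)
have [y _ ymin] := @arg_minnP V x0 predT h isT.
exists (inl y); rewrite on_spineE /= iM eqxx andbT andbT.
apply/negPn/negP => nfy; have := hc y; rewrite nfy /= => /eqP/cards1P[z hz].
have : z \in [set z] by rewrite inE.
by rewrite -hz inE ltnNge ymin // andbF.
Qed.

(** The unequal arms tell the ends apart: end 0 is at distance [M] from the root, the other at
    [M.+1]. *)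
Lemma spine_startE x : spine_start x = (x == spine 0).
Proof.
have ex z : [exists y, (d z y == M) && spine_root y] = (d z r == M).
  apply/existsP/idP => [[y]|h]; last by exists r; rewrite h spine_rootE eqxx.
  by rewrite spine_rootE => /andP[h /eqP <-].
rewrite /spine_start spine_endE ex; case: (eqVneq x (spine 0)) => [->|x0] /=.
  by rewrite /d spine_dist // subn0 eqxx.
case: (eqVneq x (spine D)) => [->|//] /=.
by rewrite /d dist_sym // spine_dist //; apply/negP => /eqP; rewrite /D; lia.
Qed.

Lemma spine_posE (i : 'I_(M.*2.+2)) : spine_pos (inr i) = i.
Proof.
rewrite /spine_pos (bigD1 (spine 0)) //= spine_startE eqxx mul1n big1 =>
  [|y y0].
  have iD : i <= D by rewrite -ltnS.
  by rewrite addn0 /d dist_sym // spineE spine_dist // ?subn0 // inord_val.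
by rewrite spine_startE (negPf y0).
Qed.

End Spine.

(** * Trees realize every member of the family *)

Local Open Scope ring_scope.

Definition flag_graph (V : finType) (e : rel V) (fl : pred V) : cgraph :=
  CGraph e (fun x => [:: fl x : nat]).

Section ConeQ.
Variables (C : numClosedFieldType) (V : finType) (e : rel V) (fl : pred V) (M :
  nat).
Hypotheses (esi : simple e) (rf : rooted_forest e fl).
Hypotheses (V0 : (0 < #|V|)%N) (VM : (#|V| < M)%N).

Let se : rel (V + 'I_(M.*2.+2)) := spine_edge e fl (M := M).

Lemma spine_invariants (A : starAlgType C)
    (u : V + 'I_(M.*2.+2) -> V + 'I_(M.*2.+2) -> A) :
  magic u -> pres u se se ->
  [/\ vpres u (on_spine e fl (M := M)) (on_spine e fl (M := M)),
      vpres u (spine_root e fl (M := M)) (spine_root e fl (M := M))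
    & vpres u (spine_pos e fl (M := M)) (spine_pos e fl (M := M))].
Proof.
move=> um he; have hu := magic_pmagic um.
(* Each fact below mirrors a piece of the definitions from [spine_end] to [spine_pos]. *)
have hd := pres_dist hu he.
have hT : vpres u predT predT by move=> x z; rewrite eqxx.
have hE := vpres_exists hu (pres_map1 (fun n => n == M.*2.+1) hd) hT.
have hs := vpres_count (fun (k : nat) (b : bool) => b * k)%N hu hd hE.
have hS := vpres_map1 (fun n => n == M.*2.+1) hs.
have hr := vpres_map andb hS (vpres_exists hu he (vpres_map1 negb hS)).
have h0 := vpres_map andb hE (vpres_exists hu (pres_map1 (fun n =>
  n == M) hd) hr).
have hp := vpres_count (fun (k : nat) (b : bool) => b * k)%N hu hd h0.
by split.
Qed.

(** Positions along the path are preserved and distinct, which fixes the path pointwise; the flags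
    are recovered as adjacency to the root. *)
Lemma is_Q_spine (X : qpgroup C) :
  is_Q X (flag_graph e fl) -> is_Q X (CGraph se (fun=> [::])).
Proof.
apply: is_Q_fixed => A u um up.
  have [hS hr hp] := spine_invariants um up.1; have hu := magic_pmagic um.
  have zero i t : inr i != t -> u (inr i) t = 0.
    case: t => [x|j] ne; first by apply: hS; rewrite !on_spineE.
    by apply: hp; rewrite !spine_posE.
  split=> [i j|].
    case: (eqVneq i j) => [<-|ij]; last by rewrite zero.
    rewrite -(magic_row um (inr i)) (bigD1 (inr i)) //= big1 ?addr0 // => t ti.
    by rewrite zero // eq_sym.
  split=> [x y z w ne|x z]; first exact: up.1.
  have h1 := vpres_exists hu up.1 hr; rewrite /= => ne; apply: h1.
  have ex y : [exists v, se (inl y) v && spine_root e fl (M := M) v] = fl y.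
    apply/existsP/idP => [[v]|fy].
      rewrite spine_rootE // => /andP[h /eqP vr]; move: h; rewrite vr /=.
      by case/andP.
    exists (spine V M M); rewrite spine_rootE // eqxx andbT /= fy inordK ?eqxx
      //.
    lia.
  by rewrite !ex; move: ne; case: (fl x); case: (fl z).
case: up => ue uc; split=> [|x y]; last by rewrite eqxx.
have uf x z : fl x != fl z -> u x z = 0.
  by move=> ne; apply: uc; move: ne; rewrite /=; case: (fl x); case: (fl z).
move=> [x|i] [y|j] [z|k] [w|l] //=; rewrite ?mul0r ?mulr0 //.
- exact: ue.
- case: (eqVneq j l) => [<-|]; last by rewrite mulr0.
  by case: (eqVneq (fl x) (fl z)) => [->|/uf ->]; rewrite ?eqxx ?mul0r.
- case: (eqVneq i k) => [<-|]; last by rewrite mul0r.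
  by case: (eqVneq (fl y) (fl w)) => [->|/uf ->]; rewrite ?eqxx ?mulr0.
- case: (eqVneq i k) => [<-|]; last by rewrite mul0r.
  by case: (eqVneq j l) => [<-|]; rewrite ?mulr0 ?eqxx.
Qed.

(** The root is already definable, so marking it changes nothing; once marked, the tree is again a
    rooted forest, ready for unions and copies. *)
Lemma is_Q_spine_flag (X : qpgroup C) :
  is_Q X (CGraph se (fun=> [::])) -> is_Q X (flag_graph se (pred1 (spine V M
    M))).
Proof.
apply: is_Q_equiv => A u um; split=> -[he hc]; split=> // x z; rewrite ?eqxx //.
have [_ hr _] := spine_invariants um he.
move=> ne; apply: hr; rewrite !spine_rootE //.
by apply: contra ne => /eqP /= ->.
Qed.

End ConeQ.

Section TreeFamily.
Variable C : numClosedFieldType.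
Implicit Types X Y : qpgroup C.

Lemma forest_is_Q_tree X (V : finType) (e : rel V) (fl : pred V) N :
  simple e -> rooted_forest e fl -> (0 < #|V|)%N -> is_Q X (flag_graph e fl) ->
  exists (T : sgraph) (r : T), [/\ is_tree T, (N < #|T|)%N,
    rooted_forest (@edge T) (pred1 r),
    is_Q X (cgraph_of T) & is_Q X (flag_graph (@edge T) (pred1 r))].
Proof.
(* Exceeding [#|V|] makes the path rigid, exceeding [N] gives the tree the required order. *)
move=> esi rf V0 q; pose M := (#|V| + N).+1.
have VM : (#|V| < M)%N by rewrite ltnS leq_addr.
have [ss si] := @spine_simple _ _ fl M esi.
have T0 : (0 < #|{: V + 'I_(M.*2.+2)}|)%N by rewrite card_sum addn_gt0 V0.
pose T := SGraph ss si T0; exists T, (spine V M M).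
have [ac co] := @spine_tree _ _ _ M esi rf.
have qT : is_Q X (cgraph_of T) by exact: is_Q_spine.
split=> //; last exact: is_Q_spine_flag.
  by rewrite card_sum card_ord /M; lia.
exact: spine_rooted.
Qed.

(** The median cut alone may be disconnected; the spine makes it connected, with one root and as
    large as desired, as unions and copies require. *)
Lemma tree_is_Q_forest X (T : sgraph) N : is_tree T -> is_Q X (cgraph_of T) ->
  exists (T' : sgraph) (r : T'), [/\ (N < #|T'|)%N, connected (@edge T'),
    rooted_forest (@edge T') (pred1 r)
    & is_Q X (flag_graph (@edge T') (pred1 r))].
Proof.
move=> [co ac] q; have gsi := sgraph_simple T.
have /card_gt0P[x0 _] := vertex_gt0 T.
have [a ma] := median_ex (@edge T) x0.
(* As [cgraph_of] has empty colours, the colours of the cut are the flags of a [flag_graph]. *)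
have /is_Q_split_median q' := q.
have rf := tree_rooted gsi ac co ma.
have [|T' [r [[co' _] TN rT _ qT]]] :=
  forest_is_Q_tree N _ rf (vertex_gt0 T) (q' gsi ac co).
  exact: (@split_tree_like (cgraph_of T) gsi ac).1.
by exists T', r.
Qed.

Lemma rooted_sum (V W : finType) (e : rel V) (e' : rel W) fl fl' :
  rooted_forest e fl -> rooted_forest e' fl' ->
  rooted_forest (@cadd_edge (flag_graph e fl) (flag_graph e' fl'))
    (fun x => match x with inl x => fl x | inr x => fl' x end).
Proof.
move=> [h [hne hc]] [k [kne kc]].
exists (fun x => match x with inl x => h x | inr x => k x end).
split=> [[x|x] [y|y] //=|[x|x]]; [exact: hne|exact: kne| |].
- rewrite -hc -(card_imset _ (@inl_inj V W)); apply: eq_card => -[y|y].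
    by rewrite !inE mem_imset ?inE //; exact: inl_inj.
  by rewrite !inE /=; apply/esym/imsetP => -[].
- rewrite -kc -(card_imset _ (@inr_inj V W)); apply: eq_card => -[y|y].
    by rewrite !inE /=; apply/esym/imsetP => -[].
  by rewrite !inE mem_imset ?inE //; exact: inr_inj.
Qed.

Lemma rooted_copies n (V : finType) (e : rel V) fl :
  rooted_forest e fl ->
  rooted_forest (@cedge (ccopies n (flag_graph e fl))) (fun x => fl x.2).
Proof.
move=> [h [hne hc]]; exists (fun x => h x.2);
  split=> [[i x] [j y] /andP[_]|[i x]] /=.
  exact: hne.
have pI : injective (pair i : V -> 'I_n * V) by move=> a b [].
rewrite -hc -(card_imset _ pI); apply: eq_card => -[j y]; rewrite inE /=.
case: (eqVneq i j) => [<-|ij] /=; first by rewrite mem_imset // inE.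
by apply/esym/imsetP => -[z _ [ji _]]; rewrite ji eqxx in ij.
Qed.

Lemma connect_cadd (G H : cgraph) : connected (@cedge G) ->
  connected (@cedge H) ->
  connect (@cedge (cadd G H)) =2 (fun x y => match x, y with
    | inl _, inl _ => true | inr _, inr _ => true | _, _ => false end).
Proof.
move=> cG cH; have inv x y : connect (@cedge (cadd G H)) x y ->
    (if x is inl _ then true else false) = (if y is inl _ then true else false).
  move=> /connectP[p ep ->]; elim: p x ep => //= z p IHp x /andP[xz /IHp <-].
  by case: x z xz => [x|x] [z|z].
move=> [x|x] [y|y].
- have /connectP[p ep ->] := cG x y.
  by apply/connectP; exists (map inl p); rewrite ?last_map // path_map.
- by apply/negP => /inv.
- by apply/negP => /inv.
- have /connectP[p ep ->] := cH x y.
  by apply/connectP; exists (map inr p); rewrite ?last_map // path_map.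
Qed.

(* Summands of different sizes cannot mix. *)
Lemma is_Q_sum X Y (G H : cgraph) : connected (@cedge G) ->
  connected (@cedge H) ->
  (#|G| < #|H|)%N -> is_Q X G -> is_Q Y H -> is_Q (qfree X Y) (cadd G H).
Proof.
move=> cG cH lt; apply: is_Q_free => A u um up; have hu := magic_pmagic um.
have hc := pres_connect hu up.1.
pose size (x : cadd G H) := (\sum_y connect (@cedge (cadd G H)) x y)%N.
have hT : vpres u (fun=> tt) (fun=> tt) by move=> x z; rewrite eqxx.
have hs : vpres u size size.
  exact: (vpres_count (fun (b : bool) (_ : unit) => b : nat) hu hc hT).
have sl x : size (inl x) = #|G|.
  rewrite /size big_sumType /= [X in (_ + X)%N]big1 ?addn0.
    by rewrite (eq_bigr (fun=> 1%N)) ?sum1_card // => y _; rewrite connect_cadd.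
  by move=> y _; rewrite connect_cadd.
have sr x : size (inr x) = #|H|.
  rewrite /size big_sumType /= [X in (X + _)%N]big1 ?add0n.
    by rewrite (eq_bigr (fun=> 1%N)) ?sum1_card // => y _; rewrite connect_cadd.
  by move=> y _; rewrite connect_cadd.
by move=> x y; split; apply: hs; rewrite sl sr ?(ltn_eqF lt) ?(gtn_eqF lt).
Qed.

Lemma Qu_tree_intro X (V : finType) (e : rel V) (fl : pred V) :
  simple e -> rooted_forest e fl -> (0 < #|V|)%N -> is_Q X (flag_graph e fl) ->
  Qu_family is_tree X.
Proof.
move=> esi rf V0 /(forest_is_Q_tree 0 esi rf V0)[T [r [tT _ _ q _]]].
by exists T => //; apply: is_Q_unique q (is_Q_Qu C T).
Qed.

Lemma Qu_tree_elim X N : Qu_family is_tree X ->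
  exists (T' : sgraph) (r : T'), [/\ (N < #|T'|)%N, connected (@edge T'),
    rooted_forest (@edge T') (pred1 r)
    & is_Q X (flag_graph (@edge T') (pred1 r))].
Proof.
move=> [T tT iso]; apply: tree_is_Q_forest tT _.
exact: is_Q_qiso (qiso_sym iso) (is_Q_Qu C T).
Qed.

Lemma cadd_simple (G H : cgraph) : simple (@cedge G) -> simple (@cedge H) ->
  simple (@cedge (cadd G H)).
Proof.
move=> [gs gi] [hs hi]; split=> [[x|x] [y|y]|[x|x]] //=.
Qed.

Lemma unit_tree : exists2 T : sgraph, is_tree T & #|T| = 1%N.
Proof.
have s : symmetric (fun _ _ : unit => false) by [].
have i : irreflexive (fun _ _ : unit => false) by [].
have g : (0 < #|{: unit}|)%N by rewrite card_unit.
exists (SGraph s i g); last by rewrite card_unit.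
split=> [[] []|]; first exact: connect0.
by move=> [|x [|y c]] // /andP[].
Qed.

Theorem Qu_trees_stable : free_wreath_stable (@Qu_family C is_tree).
Proof.
split.
- move=> X Y iso [T tT iX]; exists T => //.
  exact: qiso_trans (qiso_sym iso) iX.
- have [T tT T1] := unit_tree; exists T => //.
  by apply: is_Q_unique (is_Q_Qu C T); apply: is_Q_trivial.
- move=> X Y /(Qu_tree_elim 0)[T [r [_ cT rT qX]]].
  (* A second tree larger than the first prevents mixing, even when [X] and [Y] are isomorphic. *)
  move=> /(Qu_tree_elim #|T|)[T' [r' [lt cT' rT' qY]]].
  have q := @is_Q_sum X Y (flag_graph (@edge T) (pred1 r))
    (flag_graph (@edge T') (pred1 r')) cT cT' lt qX qY.
  apply: (@Qu_tree_intro _ _ _ _ _ (rooted_sum rT rT')).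
  + by apply: cadd_simple; exact: sgraph_simple.
  + by rewrite card_sum addn_gt0 vertex_gt0.
  + apply: (is_Q_ciso _ q); exists id; split=> //; first by exists id.
    by case.
- move=> X n n0 /(Qu_tree_elim 0)[T [r [_ cT rT qX]]].
  have q := @is_Q_copies C X n n0 (flag_graph (@edge T) (pred1 r))
    (vertex_gt0 T) cT qX.
  apply: (@Qu_tree_intro _ _ _ _ _ (rooted_copies n rT)) q.
  + split=> [[i x] [j y]|[i x]] /=; first by rewrite eq_sym edge_sym.
    by rewrite edge_irrefl andbF.
  + by rewrite card_prod card_ord muln_gt0 n0 vertex_gt0.
Qed.

Theorem Qu_tree_cographs_least (F : qpgroup C -> Prop) : free_wreath_stable F ->
  forall X, Qu_family tree_cograph X -> F X.
Proof.
move=> hF X [G tG iso].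
have [|Y FY qY] := @tree_like_realized C F hF #|G|.+1 (cgraph_of G)
  (tree_cograph_tree_like tG).
  by rewrite vertex_gt0 ltnSn.
apply: (stable_iso hF _ FY); apply: qiso_trans (qiso_sym iso).
exact: is_Q_unique qY (is_Q_Qu C G).
Qed.

(** The family of trees is stable, so by [Qu_tree_cographs_least] it contains that of tree-cographs.
    Stability of the latter is then read off from trees. *)
Theorem Qu_tree_cographs_trees X :
  Qu_family tree_cograph X <-> Qu_family is_tree X.
Proof.
split; first exact: Qu_tree_cographs_least Qu_trees_stable X.
by move=> [G tG iso]; exists G => //; exact: tree_cograph_tree.
Qed.

Theorem Qu_tree_cographs_smallest :
  smallest_free_wreath_stable (@Qu_family C tree_cograph).
Proof.
split; last exact: Qu_tree_cographs_least.
have e := Qu_tree_cographs_trees; have [si st sf sw] := Qu_trees_stable.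
split.
- by move=> X Y iso /e FX; apply/e; apply: si iso FX.
- exact/e.
- by move=> X Y /e FX /e FY; apply/e; apply: sf.
- by move=> X n n0 /e FX; apply/e; apply: sw.
Qed.

End TreeFamily.

Theorem theorem6p35 (R : realType) :
  smallest_free_wreath_stable (@Qu_family R[i] tree_cograph) /\
  (forall X : qpgroup R[i],
     Qu_family tree_cograph X <-> Qu_family is_tree X).
Proof.
split; first exact: Qu_tree_cographs_smallest.
exact: Qu_tree_cographs_trees.
Qed.
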